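(* Let $A\in\mathcal{CR}$, let $\mathfrak S$ be a symmetrically-normed ideal and let $k\in\mathbb J_A$. Then $\mathcal C_k(A)$ is a real analytic homogeneous space of $\mathcal{G}\ell_{\mathfrak S}\times\mathcal{G}\ell_{\mathfrak S}$. Furthermore, $\mathcal C_k(A)$ is also a real analytic submanifold of $A+\mathfrak S$ with the same differential structure, whose tangent space at $B\in\mathcal C_k(A)$ is $$(T\mathcal C_k(A))_B=\{XB-BY:X,Y\in\mathfrak S\}\subset\mathfrak S=(T(A+\mathfrak S))_B.$$
   Context: $\mathcal H$ is a separable complex infinite-dimensional Hilbert space, $\mathcal B(\mathcal H)$ its bounded operators with operator norm $\|\cdot\|$; $N(\cdot)$, $R(\cdot)$ denote nullspace and range; $P_{\mathcal S}$ is the orthogonal projection onto a closed subspace $\mathcal S$. $\mathcal{CR}\subset\mathcal B(\mathcal H)$ is the set of closed range operators. A symmetrically-normed ideal is a two-sided ideal $\mathfrak S\subseteq\mathcal B(\mathcal H)$ with a norm $\|\cdot\|_{\mathfrak S}$ making it a Banach space, such that $\|XBY\|_{\mathfrak S}\le\|X\|\,\|B\|_{\mathfrak S}\|Y\|$ for $X,Y\in\mathcal B(\mathcal H)$, $B\in\mathfrak S$, and $\|B\|_{\mathfrak S}=\|B\|$ for every rank-one $B$. One has (finite-rank operators) $\subseteq\mathfrak S\subseteq$ (compact operators). $\mathcal{G}\ell_{\mathfrak S}=\{G\in\mathcal B(\mathcal H): G\text{ invertible},\ G-I\in\mathfrak S\}$ is a real Banach-Lie group with metric $\|G-K\|_{\mathfrak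 S}$ and Lie algebra $\mathfrak S$. $A+\mathfrak S$ is the affine Banach space with metric $d_{\mathfrak S}(B_1,B_2)=\|B_1-B_2\|_{\mathfrak S}$. For orthogonal projections $P,Q$ with $P-Q$ compact, the essential codimension is $[P:Q]=\mathrm{Ind}(QP|_{R(P)}:R(P)\to R(Q))=\dim(N(Q)\cap R(P))-\dim(R(Q)\cap N(P))$. For $A\in\mathcal{CR}$ put $\mathbb J_A=\{k\in\mathbb Z:-\min\{\dim N(A),\dim R(A)^\perp\}\le k\le\dim N(A)^\perp\}$, and for $k\in\mathbb J_A$ $$\mathcal C_k(A)=\{B\in\mathcal{CR}:B-A\in\mathfrak S,\ [P_{N(B)}:P_{N(A)}]=k\},$$ with the metric $d_{\mathfrak S}$ (the projections onto nullspaces differ by an element of $\mathfrak S$ when $B-A\in\mathfrak S$). The group $\mathcal{G}\ell_{\mathfrak S}\times\mathcal{G}\ell_{\mathfrak S}$ acts transitively on $\mathcal C_k(A)$ by $(G,K)\cdot B=GBK^{-1}$. Manifolds are real analytic and modeled on (real) Banach spaces. A submersion is a real analytic map whose tangent map at each point is surjective with closed complemented kernel. A real analytic homogeneous space of a Banach-Lie group $G$ is a manifold $M$ on which $G$ acts transitively and real analytically and such that for some $p\in M$ the map $G\to M$, $g\mapsto g\cdot p$, is a submersion. A subset $N$ of a manifold $M$ is a submanifold if for each $p\in N$ there is a chart $(\phi,\mathcal V,E)$ of $M$ at $p$ and a closed complemented subspace $F\subseteq E$ with $\phi(\mathcal V\cap N)=F\cap\phi(\mathcal V)$. *)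

(* Defs.v *)
From HB Require Import structures.
From mathcomp Require Import all_boot all_order all_algebra complex sesquilinear.
From mathcomp Require Import all_classical all_reals all_analysis.

Set Implicit Arguments.
Unset Strict Implicit.
Unset Printing Implicit Defensive.
Import Order.TTheory GRing.Theory Num.Theory Num.Def.
Import numFieldNormedType.Exports.
Local Open Scope classical_set_scope.
Local Open Scope ring_scope.

Section ProdComplete.
Context {K : numFieldType} {U V : completeNormedModType K}.

HB.instance Definition _ := Pointed.on (U * V)%type.

Lemma prod_complete (F : set_system (U * V)) :
  ProperFilter F -> cauchy F -> cvg F.
Proof.
move=> FF /cauchyP Fc.
have c1 : cvg (fst @ F).
  apply: cauchy_cvg; apply/cauchyP => e /Fc[x Fx]; exists x.1.
  by rewrite -[_ (ball _ _)]/(F [set y | ball x.1 e y.1]); apply: filterS Fx => y [].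
have c2 : cvg (snd @ F).
  apply: cauchy_cvg; apply/cauchyP => e /Fc[x Fx]; exists x.2.
  by rewrite -[_ (ball _ _)]/(F [set y | ball x.2 e y.2]); apply: filterS Fx => y [].
apply/cvg_ex; exists (lim (fst @ F), lim (snd @ F)).
have h := cvg_pair c1 c2.
move=> A /h FA; apply: (@filterS _ F _ (fun x => A (x.1, x.2))) => [[x y]//|].
exact: FA.
Qed.

HB.instance Definition _ := Uniform_isComplete.Build (U * V)%type prod_complete.

End ProdComplete.

(* A Banach space whose vectors form a linear subspace of V; its norm need not
   come from V. *)
Record banach_subspace (R : realType) (V : lmodType R) := BanachSubspace {
  bs_set :> set V;
  bs_norm : V -> R;
  bs_set0 : bs_set 0;
  bs_setP : forall a x y, bs_set x -> bs_set y -> bs_set (a *: x + y);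
  bs_normD : forall x y, bs_set x -> bs_set y ->
    bs_norm (x + y) <= bs_norm x + bs_norm y;
  bs_normZ : forall a x, bs_set x -> bs_norm (a *: x) = `|a| * bs_norm x;
  bs_norm0 : forall x, bs_set x -> bs_norm x = 0 -> x = 0;
  bs_complete : forall u : nat -> V, (forall n, bs_set (u n)) ->
    (forall e, 0 < e -> exists N, forall m n, (N <= m)%N -> (N <= n)%N ->
       bs_norm (u m - u n) < e) ->
    exists2 l, bs_set l &
      forall e, 0 < e -> exists N, forall n, (N <= n)%N -> bs_norm (u n - l) < e
}.

Section BanachSubspaceType.
Context {R : realType} {V : lmodType R} (B : banach_subspace V).

Definition bs_pred : {pred V} := fun x => x \in bs_set B.

Lemma bs_pred_submod : submod_closed bs_pred.
Proof.
split=> [|a u v]; first by rewrite unfold_in; apply/mem_set; exact: bs_set0.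
by rewrite !unfold_in => /set_mem Bu /set_mem Bv; apply/mem_set; exact: bs_setP.
Qed.
HB.instance Definition _ := GRing.isSubmodClosed.Build R V bs_pred bs_pred_submod.

Record bs_type := BsElem { bs_val :> V; bs_valP : bs_val \in bs_pred }.
HB.instance Definition _ := [isSub for bs_val].
HB.instance Definition _ := [Choice of bs_type by <:].
HB.instance Definition _ := [SubChoice_isSubLmodule of bs_type by <:].

Lemma bs_valS (x : bs_type) : bs_set B (bs_val x).
Proof. by case: x => x; rewrite /= unfold_in => /set_mem. Qed.

Let nrm (x : bs_type) : R := bs_norm B (bs_val x).

Let nrmD x y : nrm (x + y) <= nrm x + nrm y.
Proof. by apply: bs_normD; exact: bs_valS. Qed.

Let nrmZ a x : nrm (a *: x) = `|a| * nrm x.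
Proof. by apply: bs_normZ; exact: bs_valS. Qed.

Let nrm0 x : nrm x = 0 -> x = 0.
Proof. by move=> /(bs_norm0 (bs_valS x)) ?; exact: val_inj. Qed.

HB.instance Definition _ := Lmodule_isNormed.Build R bs_type nrmD nrmZ nrm0.

Lemma bs_normE (x : bs_type) : `|x| = bs_norm B x.
Proof. by []. Qed.

Let bs_cauchy_cvg (F : set_system bs_type) :
  ProperFilter F -> cauchy F -> cvg F.
Proof.
move=> FF /cauchyP Fc.
have e0 (n : nat) : 0 < n.+1%:R^-1 :> R by rewrite invr_gt0.
have /choice[u Fu] : forall n : nat, exists x : bs_type, F (ball x n.+1%:R^-1).
  by move=> n; exact: Fc.
have small (e : R) : 0 < e -> exists N, forall n, (N <= n)%N -> n.+1%:R^-1 < e.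
  move=> e_gt0.
  have [N _ NP] := near_infty_natSinv_lt (PosNum e_gt0).
  by exists N => n Nn; exact: NP.
have cu (e : R) : 0 < e -> exists N, forall m n, (N <= m)%N -> (N <= n)%N ->
    bs_norm B (bs_val (u m) - bs_val (u n)) < e.
  move=> e_gt0; have e2 : 0 < e / 2 by rewrite divr_gt0.
  have [N NP] := small _ e2; exists N => m n Nm Nn.
  have /filter_ex[y] : F (ball (u m) m.+1%:R^-1 `&` ball (u n) n.+1%:R^-1).
    by apply: filterI; exact: Fu.
  rewrite -!ball_normE /= => -[my ny].
  rewrite -[ltLHS]/(`|u m - u n|) -(subrKA y) [e]splitr.
  rewrite (le_lt_trans (ler_normD _ _))// [`|y - _|]distrC.
  by rewrite ltrD// ?(lt_trans my)// ?(lt_trans ny)// NP.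
have [l Bl lP] := bs_complete (fun n => bs_valS (u n)) cu.
have Bl' : l \in bs_pred by rewrite unfold_in; exact: mem_set.
apply/cvg_ex; exists (BsElem Bl'); apply/cvgrPdist_lt => e e_gt0.
have e2 : 0 < e / 2 by rewrite divr_gt0.
have [N1 N1P] := small _ e2; have [N2 N2P] := lP _ e2.
pose n := maxn N1 N2.
apply: filterS (Fu n) => y; rewrite -ball_normE /= => ny.
rewrite -(subrKA (u n)) [e]splitr (le_lt_trans (ler_normD _ _))//.
rewrite ltrD//; last by rewrite (lt_trans ny)// N1P// leq_maxl.
by rewrite distrC; apply: N2P; exact: leq_maxr.
Qed.

HB.instance Definition _ := Uniform_isComplete.Build bs_type bs_cauchy_cvg.

End BanachSubspaceType.

Record closed_subspace (R : realType) (E : completeNormedModType R) :=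
  ClosedSubspace {
  cs_set :> set E;
  cs_set0 : cs_set 0;
  cs_setP : forall a x y, cs_set x -> cs_set y -> cs_set (a *: x + y);
  cs_closed : closed cs_set
}.

Section ClosedSubspaceBanach.
Context {R : realType} {E : completeNormedModType R} (F : closed_subspace E).

Lemma cs_complete (u : nat -> E) : (forall n, cs_set F (u n)) ->
  (forall e : R, 0 < e -> exists N, forall m n, (N <= m)%N -> (N <= n)%N ->
     `|u m - u n| < e) ->
  exists2 l, cs_set F l &
    forall e : R, 0 < e -> exists N, forall n, (N <= n)%N -> `|u n - l| < e.
Proof.
move=> Fu uc.
have /cauchy_cvg/cvg_ex[l ul] : cauchy (u @ \oo).
  apply/cauchyP => e /uc[N NP]; exists (u N).
  by exists N => // n /= Nn; rewrite -ball_normE /=; exact: NP.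
exists l.
  by apply: (closed_cvg (cs_set F) (@cs_closed _ _ F) _ l ul); exact: nearW.
move=> e e0; move/cvgrPdist_lt : ul => /(_ e e0)[N _ NP].
by exists N => n /NP; rewrite distrC.
Qed.

Definition banach_of_closed : banach_subspace E :=
  BanachSubspace (cs_set0 F) (@cs_setP _ _ F)
    (fun x y _ _ => ler_normD x y) (fun a x _ => normrZ a x)
    (fun x _ => @normr0_eq0 _ _ x) cs_complete.

Definition cs_type := bs_type banach_of_closed.
HB.instance Definition _ := CompleteNormedModule.on cs_type.

End ClosedSubspaceBanach.

Definition topological_complement (R : realType) (E : completeNormedModType R)
    (F F' : closed_subspace E) :=
  F `&` F' = [set 0] /\ forall x, exists2 y, cs_set F y & cs_set F' (x - y).

Section Analytic.
Context {R : realType} {E F : normedModType R}.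

Definition multilinear n (a : ('I_n -> E) -> F) :=
  forall (v : 'I_n -> E) i k x y,
    a (dfwith v i (k *: x + y)) = k *: a (dfwith v i x) + a (dfwith v i y).

(* f (x + h) = sum_n a_n(h, ..., h) for |h| < r. The bound makes each a_n
   continuous and the radius of convergence at least r; symmetry of a_n is no
   restriction, since only its values on the diagonal matter. *)
Definition analytic_at (f : E -> F) (x : E) :=
  exists (a : forall n, ('I_n -> E) -> F) (M r : R),
  [/\ 0 < r,
      forall n, multilinear (a n),
      forall n v, `|a n v| <= M * r ^- n * \prod_(i < n) `|v i| &
      forall h, `|h| < r ->
        series (fun n => a n (fun=> h)) @ \oo --> f (x + h)].

End Analytic.

Section Manifolds.
Context {R : realType}.

Record chart (M : topologicalType) := Chart {
  model : completeNormedModType R;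
  dom : set M;
  coord :> M -> model
}.

(* c is a homeomorphism from the open set [dom c] onto an open subset of
   [model c]; the values of c outside [dom c] are irrelevant. *)
Definition is_chart (M : topologicalType) (c : chart M) :=
  [/\ open (dom c),
      {in dom c &, injective c},
      {in dom c, continuous c} &
      forall U, open U -> U `<=` dom c -> open (c @` U)].

(* f has the germ of d \o g \o c^-1 at c p; in particular g is continuous at p.
   For charts, this determines the germ of f, hence its differential at c p. *)
Definition local_rep (M N : topologicalType) (c : chart M) (d : chart N)
    (g : M -> N) (p : M) (f : model c -> model d) :=
  \forall x \near p, [/\ dom c x, dom d (g x) & d (g x) = f (c x)].
Arguments local_rep {M N} c d g p f.

Definition analytic_in (M N : topologicalType) (c : chart M) (d : chart N)
    (g : M -> N) (p : M) :=
  exists2 f, local_rep c d g p f & analytic_at f (c p).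

Definition compatible (M : topologicalType) (c d : chart M) :=
  forall p, dom c p -> dom d p -> analytic_in c d id p /\ analytic_in d c id p.

(* [set (chart M)] would be a universe inconsistency. *)
Definition atlas (M : topologicalType) := chart M -> Prop.

Definition is_atlas (M : topologicalType) (A : atlas M) :=
  [/\ forall c, A c -> is_chart c,
      forall p, exists2 c, A c & dom c p &
      forall c d, A c -> A d -> compatible c d].

Definition maximal_atlas (M : topologicalType) (A : atlas M) : atlas M :=
  fun c => is_chart c /\ forall d, A d -> compatible c d.

Definition same_structure (M : topologicalType) (A A' : atlas M) :=
  forall c c', A c -> A' c' -> compatible c c'.

Definition analytic_map (M N : topologicalType) (A : atlas M) (B : atlas N) (g : M -> N) :=
  forall p c d, A c -> B d -> dom c p -> dom d (g p) -> analytic_in c d g p.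

Definition submersion (M N : topologicalType) (A : atlas M) (B : atlas N) (g : M -> N) :=
  analytic_map A B g /\
  forall p c d f, A c -> B d -> dom c p -> dom d (g p) -> local_rep c d g p f ->
    range ('d f (c p)) = setT /\
    exists F F' : closed_subspace (model c),
      'd f (c p) @^-1` [set 0] = F /\ topological_complement F F'.

Definition prod_chart (M N : topologicalType) (c : chart M) (d : chart N) :
    chart (M * N)%type :=
  Chart (dom c `*` dom d) (fun p => (c p.1, d p.2) : (model c * model d)%type).

Definition prod_atlas (M N : topologicalType) (A : atlas M) (B : atlas N) : atlas (M * N)%type :=
  fun e => exists c d, [/\ A c, B d & e = prod_chart c d].

(* The image of T_p N under the tangent map of i : N -> M, read in the chart d
   of M. *)
Definition tangent_space (N M : topologicalType) (A : atlas N)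
    (i : N -> M) (d : chart M) (p : N) : set (model d) :=
  [set v | exists c f w, [/\ A c, dom c p, local_rep c d i p f,
                             analytic_at f (c p) & v = 'd f (c p) w]].

Section Submanifold.
Context {M : topologicalType} (A : atlas M) (N : set M).

Definition adapted (c : chart M) (F : closed_subspace (model c)) :=
  [/\ maximal_atlas A c,
      exists F', topological_complement F F' &
      c @` (dom c `&` N) = F `&` c @` dom c].

Definition submanifold :=
  forall p, N p -> exists (c : chart M) (F : closed_subspace (model c)),
    adapted F /\ dom c p.

(* [insubd 0] only corestricts c to F: c maps [dom c `&` N] into F. *)
Definition restrict_chart (c : chart M) (F : closed_subspace (model c)) :
    chart N :=
  @Chart N (cs_type F) (set_val @^-1` dom c)
    (fun x => insubd (0 : cs_type F) (c (set_val x))).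

Definition submanifold_atlas : atlas N :=
  fun e => exists (c : chart M) (F : closed_subspace (model c)),
    adapted F /\ e = restrict_chart F.

End Submanifold.

End Manifolds.
Arguments local_rep {R M N} c d g p f.
Arguments submanifold_atlas {R M} A N _.
Arguments tangent_space {R N M} A i d p _.

(* No compatibility is required here; [is_lie_group] below asks for analytic
   operations. *)
#[short(type="preTopologicalGroupType")]
HB.structure Definition PreTopologicalGroup := {G of Topological G & Group G}.

Section HomogeneousSpaces.
Context {R : realType}.

Definition is_lie_group (G : preTopologicalGroupType) (A : @atlas R G) :=
  [/\ is_atlas A,
      analytic_map (prod_atlas A A) A (fun gh => (gh.1 * gh.2)%g) &
      analytic_map A A (fun g : G => (g^-1)%g)].

Definition homogeneous_space (G : preTopologicalGroupType) (AG : @atlas R G)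
    (M : topologicalType) (AM : @atlas R M) (act : G -> M -> M) :=
  [/\ is_lie_group AG /\ is_atlas AM,
      (forall p, act 1%g p = p) /\
      (forall g h p, act (g * h)%g p = act g (act h p)),
      [set: M] !=set0 /\ (forall p q, exists g, act g p = q),
      analytic_map (prod_atlas AG AM) AM (fun gp => act gp.1 gp.2) &
      exists p, submersion AG AM (act ^~ p)].

End HomogeneousSpaces.

Section ProductGroup.
Context {G H : groupType}.
Implicit Types x y z : (G * H)%type.

Let one : (G * H)%type := (1%g, 1%g).
Let inv x : (G * H)%type := (x.1^-1, x.2^-1)%g.
Let mul x y : (G * H)%type := (x.1 * y.1, x.2 * y.2)%g.

Let mulA : associative mul.
Proof. by move=> x y z; rewrite /mul /= !mulgA. Qed.
Let mul1 : left_id one mul.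
Proof. by case=> x y; rewrite /mul /= !mul1g. Qed.
Let mul1r : right_id one mul.
Proof. by case=> x y; rewrite /mul /= !mulg1. Qed.
Let mulV : left_inverse one inv mul.
Proof. by case=> x y; rewrite /mul /= !mulVg. Qed.
Let mulVr : right_inverse one inv mul.
Proof. by case=> x y; rewrite /mul /= !mulgV. Qed.

HB.instance Definition _ :=
  isGroup.Build (G * H)%type mulA mul1 mul1r mulV mulVr.

End ProductGroup.

HB.instance Definition _ (G H : preTopologicalGroupType) :=
  Group.on (G * H)%type.

HB.mixin Record isHilbert (R : realType) H & CompleteNormedModule R[i] H := {
  hdot : {dot H for conjC};
  hdotE : forall x : H, `|x| ^+ 2 = hdot x x
}.

#[short(type="hilbertType")]
HB.structure Definition Hilbert (R : realType) :=
  {H of CompleteNormedModule R[i] H & isHilbert R H}.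

(* Restriction of scalars *)
Definition realify (R : realType) (V : lmodType R[i]) : Type := V.

Section Realify.
Context {R : realType} (V : lmodType R[i]).

HB.instance Definition _ := GRing.Zmodule.on (realify V).

Let rscale (a : R) (x : realify V) : realify V := (a%:C)%C *: (x : V).

Let rscaleA a b x : rscale a (rscale b x) = rscale (a * b) x.
Proof. by rewrite /rscale scalerA -rmorphM. Qed.
Let rscale1 : left_id 1 rscale.
Proof. by move=> x; rewrite /rscale rmorph1 scale1r. Qed.
Let rscaleDr : right_distributive rscale +%R.
Proof. by move=> a x y; rewrite /rscale scalerDr. Qed.
Let rscaleDl x : {morph rscale^~ x : a b / a + b}.
Proof. by move=> a b; rewrite /rscale rmorphD scalerDl. Qed.

HB.instance Definition _ := GRing.Zmodule_isLmodule.Build R (realify V)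
  rscaleA rscale1 rscaleDr rscaleDl.

End Realify.

Section Operators.
Context {R : realType} {H : hilbertType R}.
Implicit Types (A B X Y P Q : H -> H) (W : set H).

Definition bounded_op A := linear A /\ continuous A.

Definition opnorm A : R :=
  sup [set complex.Re `|A x| | x in [set x : H | `|x| <= 1]].

Definition nullspace A : set H := A @^-1` [set 0].

Definition lin_indep n (v : 'I_n -> H) :=
  forall a : 'I_n -> R[i], \sum_i a i *: v i = 0 -> forall i, a i = 0.

(* Dimension over R[i], with the value +oo for every infinite one *)
Definition hdim W : \bar R :=
  ereal_sup [set (n%:R)%:E | n in
    [set n | exists2 v : 'I_n -> H, (forall i, W (v i)) & lin_indep v]].

Definition orthc W : set H := [set x | forall y, W y -> hdot x y = 0].

Definition orthproj W : H -> H :=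
  fun x => xget 0 [set y | W y /\ orthc W (x - y)].

Definition closed_range_op A := bounded_op A /\ closed (range A).

Definition finite_rank_op A := bounded_op A /\ (hdim (range A) < +oo)%E.

Definition compact_op A :=
  bounded_op A /\ precompact (A @` [set x | `|x| <= 1]).

(* In \bar R the difference is finite only if both dimensions are. *)
Definition ess_codim P Q : \bar R :=
  (hdim (nullspace Q `&` range P) - hdim (range Q `&` nullspace P))%E.

Definition invertible A :=
  bounded_op A /\ exists2 B, bounded_op B & A \o B = id /\ B \o A = id.

Definition op_inv A : H -> H :=
  xget (0 : H -> H) [set B | bounded_op B /\ A \o B = id /\ B \o A = id].

(* [sn_finite_rank] and [sn_compact] exclude the degenerate ideals 0 and B(H). *)
Record sn_ideal := SnIdeal {
  sn_set :> set (H -> H);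
  sn_norm : (H -> H) -> R;
  sn_add : forall A B, sn_set A -> sn_set B -> sn_set (A + B);
  sn_mul : forall X B, bounded_op X -> sn_set B ->
    sn_set (X \o B) /\ sn_set (B \o X);
  sn_finite_rank : finite_rank_op `<=` sn_set;
  sn_compact : sn_set `<=` compact_op;
  sn_normD : forall A B, sn_set A -> sn_set B ->
    sn_norm (A + B) <= sn_norm A + sn_norm B;
  sn_normZ : forall (a : R[i]) B, sn_set B ->
    sn_norm (a *: B) = complex.Re `|a| * sn_norm B;
  sn_norm0 : forall B, sn_set B -> sn_norm B = 0 -> B = 0;
  sn_complete : forall u : nat -> H -> H, (forall n, sn_set (u n)) ->
    (forall e, 0 < e -> exists N, forall m n, (N <= m)%N -> (N <= n)%N ->
       sn_norm (u m - u n) < e) ->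
    exists2 B, sn_set B &
      forall e, 0 < e -> exists N, forall n, (N <= n)%N -> sn_norm (u n - B) < e;
  sn_norm_ideal : forall X B Y, bounded_op X -> sn_set B -> bounded_op Y ->
    sn_norm (X \o B \o Y) <= opnorm X * sn_norm B * opnorm Y;
  sn_norm_rank1 : forall B, bounded_op B -> hdim (range B) = 1%E ->
    sn_norm B = opnorm B
}.

Lemma bounded_op_id : bounded_op id.
Proof. by split=> // x; exact: cvg_id. Qed.

Lemma bounded_op_comp A B : bounded_op A -> bounded_op B -> bounded_op (A \o B).
Proof.
move=> [Al Ac] [Bl Bc]; split=> [a x y|x]; first by rewrite /= Bl Al.
by apply: continuous_comp; [exact: Bc | exact: Ac].
Qed.

Lemma bounded_op_scale (a : R[i]) : bounded_op ( *:%R a).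
Proof.
split=> [b x y|]; last exact: scaler_continuous.
by rewrite scalerDr !scalerA mulrC.
Qed.

Lemma op_invP A : invertible A ->
  [/\ bounded_op (op_inv A), A \o op_inv A = id & op_inv A \o A = id].
Proof.
move=> [_ [B Bb BA]]; rewrite /op_inv.
by case: xgetP => [C _ [Cb [AC CA]]|/(_ B) /not_andP[]].
Qed.

Section Ideal.
Variable S : sn_ideal.

Lemma sn_scale (a : R[i]) B : sn_set S B -> sn_set S (a *: B).
Proof. by move=> SB; have [] := sn_mul (bounded_op_scale a) SB. Qed.

Lemma sn_set0 : sn_set S 0.
Proof.
apply: sn_finite_rank; split.
  split=> [a x y|x]; last exact: cst_continuous.
  by rewrite [RHS]addr0 scaler0.
apply: (@le_lt_trans _ _ 0%E); last exact: ltry.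
apply: ge_ereal_sup => _ [n [v v0 vi]] <-; rewrite lee_fin.
case: n v v0 vi => // n v v0 vi; exfalso.
have := vi (fun=> 1); rewrite big1 => [/(_ erefl ord0)/eqP|i _].
  by rewrite oner_eq0.
by have [x _ <-] := v0 i; rewrite scaler0.
Qed.

Lemma sn_bounded B : sn_set S B -> bounded_op B.
Proof. by move=> /sn_compact[]. Qed.

Let scaleE (a : R) (B : H -> H) : a *: (B : realify (H -> H)) = (a%:C)%C *: B.
Proof. by []. Qed.

Let snP (a : R) (A B : realify (H -> H)) :
  sn_set S A -> sn_set S B -> sn_set S (a *: A + B).
Proof. by move=> SA SB; apply: sn_add => //; exact: sn_scale. Qed.

Let snZ (a : R) (B : realify (H -> H)) :
  sn_set S B -> sn_norm S (a *: B) = `|a| * sn_norm S B.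
Proof.
move=> SB; rewrite scaleE sn_normZ//.
by rewrite normc_def /= expr0n addr0 sqrtr_sqr.
Qed.

Definition sn_banach : banach_subspace (realify (H -> H)) :=
  @BanachSubspace R (realify (H -> H)) (sn_set S) (sn_norm S) sn_set0 snP
    (@sn_normD S) snZ (@sn_norm0 S) (@sn_complete S).

Definition sn_type := bs_type sn_banach.
HB.instance Definition _ := CompleteNormedModule.on sn_type.

Lemma sn_type_pred B : sn_set S B -> (B : realify (H -> H)) \in bs_pred sn_banach.
Proof. by move=> SB; rewrite unfold_in; exact: mem_set. Qed.

End Ideal.

End Operators.
Arguments sn_ideal {R} H.

Section Orbits.
Context {R : realType} {H : hilbertType R} (S : sn_ideal H).
Implicit Types A B X Y : H -> H.

(* The affine space A + S, with the topology of the metric |B1 - B2|_S *)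
Definition aff_sig A := {B : H -> H | (B - A) \in sn_set S}.

Definition aff_vec A (B : aff_sig A) : sn_type S :=
  BsElem (valP B : (val B - A : realify (H -> H)) \in bs_pred (sn_banach S)).

Definition aff A := initial_topology (@aff_vec A).
HB.instance Definition _ A := Topological.on (aff A).

Definition aff_op A (B : aff A) : H -> H := sval B.

Definition aff_chart A : chart (aff A) :=
  @Chart R (aff A) (sn_type S) setT (@aff_vec A).

Definition aff_atlas A : atlas (aff A) := fun c => c = aff_chart A.

Definition Gl := set_type [set G : aff idfun | invertible (aff_op G)].
HB.instance Definition _ := Topological.on Gl.

Definition Gl_op (G : Gl) : H -> H := aff_op (set_val G).

Lemma Gl_inj : injective Gl_op.
Proof.
move=> [[G p] q] [[K p'] q']; rewrite /Gl_op /aff_op /= => GK; subst K.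
have pp' := bool_irrelevance p p'; subst p'.
by rewrite (bool_irrelevance q q').
Qed.

Lemma Gl_invertible G : invertible (Gl_op G).
Proof. by case: G => G Gi; exact: (set_mem Gi). Qed.

Lemma Gl_bounded G : bounded_op (Gl_op G).
Proof. by have [] := Gl_invertible G. Qed.

Lemma Gl_sub1 G : sn_set S (Gl_op G - idfun).
Proof. by case: G => -[G GS] GI; exact: (set_mem GS). Qed.

Lemma sn_opp B : sn_set S B -> sn_set S (- B).
Proof. by move=> SB; rewrite -scaleN1r; exact: sn_scale. Qed.

Lemma Gl_of_subproof B (SB : sn_set S (B - idfun)) (Bi : invertible B) :
  (exist _ B (mem_set SB) : aff idfun) \in
    [set G : aff idfun | invertible (aff_op G)].
Proof. exact: mem_set. Qed.

Definition Gl_of B (SB : sn_set S (B - idfun)) (Bi : invertible B) : Gl :=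
  SigSub (Gl_of_subproof SB Bi).

Lemma invertible_id : invertible (idfun : H -> H).
Proof.
split; first exact: bounded_op_id.
by exists idfun => //; exact: bounded_op_id.
Qed.

Lemma invertible_comp A B : invertible A -> invertible B -> invertible (A \o B).
Proof.
move=> [Ab [A' A'b [AA' A'A]]] [Bb [B' B'b [BB' B'B]]]; split.
  exact: bounded_op_comp.
exists (B' \o A'); first exact: bounded_op_comp.
have E (f g : H -> H) : f \o g = id -> forall y, f (g y) = y.
  by move=> fg y; exact: (congr1 (@^~ y) fg).
split; apply/funext => x /=.
  by rewrite (E _ _ BB') (E _ _ AA').
by rewrite (E _ _ A'A) (E _ _ B'B).
Qed.

Lemma invertible_op_inv A : invertible A -> invertible (op_inv A).
Proof. by move=> Ai; have [? ? ?] := op_invP Ai; split=> //; exists A => //; case: Ai. Qed.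

Lemma Gl_mul_subproof (G K : Gl) : sn_set S (Gl_op G \o Gl_op K - idfun).
Proof.
have -> : Gl_op G \o Gl_op K - idfun =
    (Gl_op G - idfun) \o Gl_op K + (Gl_op K - idfun).
  apply/funext => x; rewrite [LHS]/(Gl_op G (Gl_op K x) - x).
  rewrite [RHS]/((Gl_op G (Gl_op K x) - Gl_op K x) + (Gl_op K x - x)).
  exact: (esym (subrKA _ _ _)).
apply: sn_add; last exact: Gl_sub1.
by have [] := sn_mul (Gl_bounded K) (Gl_sub1 G).
Qed.

Lemma Gl_inv_subproof (G : Gl) : sn_set S (op_inv (Gl_op G) - idfun).
Proof.
have [Ib GI IG] := op_invP (Gl_invertible G).
have -> : op_inv (Gl_op G) - idfun = - ((Gl_op G - idfun) \o op_inv (Gl_op G)).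
  apply/funext => x; rewrite [LHS]/(op_inv (Gl_op G) x - x).
  rewrite [RHS]/(- ((Gl_op G \o op_inv (Gl_op G)) x - op_inv (Gl_op G) x)) GI.
  exact: (esym (opprB _ _)).
by apply: sn_opp; have [] := sn_mul Ib (Gl_sub1 G).
Qed.

Lemma Gl_one_subproof : sn_set S (idfun - idfun).
Proof. by rewrite subrr; exact: sn_set0. Qed.

Let Gl1 : Gl := Gl_of Gl_one_subproof invertible_id.

Let Glmul (G K : Gl) : Gl :=
  Gl_of (Gl_mul_subproof G K)
    (invertible_comp (Gl_invertible G) (Gl_invertible K)).

Let Glinv (G : Gl) : Gl :=
  Gl_of (Gl_inv_subproof G) (invertible_op_inv (Gl_invertible G)).

Let GlmulA : associative Glmul.
Proof. by move=> G K L; exact: Gl_inj. Qed.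
Let Gl1mul : left_id Gl1 Glmul.
Proof. by move=> G; exact: Gl_inj. Qed.
Let Glmul1 : right_id Gl1 Glmul.
Proof. by move=> G; exact: Gl_inj. Qed.
Let GlVmul : left_inverse Gl1 Glinv Glmul.
Proof. by move=> G; apply: Gl_inj; have [] := op_invP (Gl_invertible G). Qed.
Let GlmulV : right_inverse Gl1 Glinv Glmul.
Proof. by move=> G; apply: Gl_inj; have [] := op_invP (Gl_invertible G). Qed.

HB.instance Definition _ :=
  isGroup.Build Gl GlmulA Gl1mul Glmul1 GlVmul GlmulV.

Lemma Gl_op1 : Gl_op 1%g = idfun. Proof. by []. Qed.
Lemma Gl_opM G K : Gl_op (G * K)%g = Gl_op G \o Gl_op K. Proof. by []. Qed.
Lemma Gl_opV G : Gl_op (G^-1)%g = op_inv (Gl_op G). Proof. by []. Qed.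

Definition Gl_chart : chart Gl :=
  @Chart R Gl (sn_type S) setT (fun G => aff_vec (set_val G)).

Definition Gl_atlas : atlas Gl := fun c => c = Gl_chart.

Definition index_range A : set int :=
  [set k : int | (- Order.min (hdim (nullspace A)) (hdim (orthc (range A)))
                  <= (k%:~R : R)%:E <= hdim (orthc (nullspace A)))%E].

Definition Ck A (k : int) : set (aff A) :=
  [set B : aff A | closed_range_op (aff_op B) /\
    ess_codim (orthproj (nullspace (aff_op B))) (orthproj (nullspace A))
      = (k%:~R : R)%:E].

Definition Ck_op A k (B : @Ck A k) : H -> H := aff_op (set_val B).

End Orbits.
Arguments Ck {R H} S A k.
Arguments Gl_atlas {R H} S _.
Arguments aff_atlas {R H} S A _.
Arguments aff_chart {R H} S A.

(* Main.v *)
(* The essential codimension of the nullspaces is an orbit invariant, and it is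
   the only one: if the nullspaces of B and B' have the same codimension data with
   respect to those of A, then 1 + S contains, by Riesz theory, an invertible
   operator matching the nullspaces and one matching the ranges.

   For the manifold structure, fix B in C_k(A) and T with BTB = B and TBT = T.
   For X in S near 0, block elimination with respect to the projections TB and BT
   gives B + X = G (B + Q) K with G and K in Gl_S depending analytically on X and
   Q = (1 - BT)(X - q(X))(1 - TB), where q(X) is the subtracted term of the Schur
   complement. Then B + X is in C_k(A) if and only if Q = 0: otherwise the
   nullspace of B + Q is strictly smaller than that of B. As q(X) only depends on
   the entries of X other than the lower right one, which it alone changes,
   X |-> X - q(X) is an analytic chart that maps C_k(A) to a complemented subspace.
   Where Q = 0, (G, K^-1) is an analytic local section of the orbit map. Hence the
   orbit map is a submersion, and its differential (X, Y) |-> XB - BY at the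
   identity has the tangent space as its range. *)

Require Import Defs.
From HB Require Import structures.
From mathcomp Require Import all_boot all_order all_algebra complex sesquilinear.
From mathcomp Require Import all_classical all_reals all_analysis.
From mathcomp Require Import ring lra zify.

Set Implicit Arguments.
Unset Strict Implicit.
Unset Printing Implicit Defensive.
Import Order.TTheory GRing.Theory Num.Theory Num.Def.
Import numFieldNormedType.Exports.
Local Open Scope classical_set_scope.
Local Open Scope ring_scope.

(** Nullspaces may have infinite dimension and codimension, so only relative dimensions are
    available. They are counted along chains that add one vector at a time, and subspaces are
    compared up to the action of [Gl S]. All counting rests on one finiteness fact of Riesz theory:
    an injective operator of 1 + S that maps a closed subspace into itself maps it onto itself. It
    makes the count well defined, and it also turns an inclusion between the nullspaces of two
    points of C_k(A) into an equality. No index theory is developed: an operator of 1 + S that is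
    injective on a closed subspace is made invertible by rank-one terms that vanish there.

    Analyticity means convergent power series in Banach spaces, so composition needs explicit
    majorants. No inverse function theorem is involved: the inverse of X - q(X) is X + q(X), and
    every section is a formula. The open mapping theorem serves twice: for the continuity of the
    projection along a complement, and for bounded generalized inverses of closed range
    operators. *)

Section ZmodReflection.
Context {V : zmodType}.

(** Syntax for reflexive proofs of identities in an abelian group: both sides are read as integer
    combinations of the same atoms. *)
Inductive zexp := ZVar of nat | ZZero | ZAdd of zexp & zexp | ZOpp of zexp.

Fixpoint zeval (env : seq V) e : V :=
  match e with
  | ZVar i => nth 0 env i
  | ZZero => 0
  | ZAdd a b => zeval env a + zeval env b
  | ZOpp a => - zeval env a
  end.

(** Positive and negative occurrences are counted apart, so that natural numbers suffice and an
    opposite merely swaps the pair. *)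
Fixpoint zcoef e i : nat * nat :=
  match e with
  | ZVar j => (nat_of_bool (j == i), 0%N)
  | ZZero => (0%N, 0%N)
  | ZAdd a b => ((zcoef a i).1 + (zcoef b i).1, (zcoef a i).2 + (zcoef b i).2)%N
  | ZOpp a => ((zcoef a i).2, (zcoef a i).1)
  end.

Lemma zevalE env e : zeval env e =
  \sum_(i < size env) env`_i *+ (zcoef e i).1 - \sum_(i < size env) env`_i *+ (zcoef e i).2.
Proof.
elim: e => [j||a IHa b IHb|a IHa] /=.
- rewrite [X in _ - X]big1 ?subr0 //.
  have [lt|ge] := ltnP j (size env).
    rewrite (bigD1 (Ordinal lt)) //= eqxx big1 ?addr0 // => i.
    by rewrite eq_sym -val_eqE /= => /negbTE ->.
  rewrite nth_default // big1 // => i _; case: eqP => // ji.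
  by have := ltn_ord i; rewrite -ji ltnNge ge.
- by rewrite !big1 ?subr0.
- rewrite IHa IHb; under [in RHS]eq_bigr do rewrite mulrnDr.
  under [X in _ = _ - X]eq_bigr do rewrite mulrnDr.
  by rewrite !big_split /= opprD addrACA.
- by rewrite IHa opprB.
Qed.

Definition zcheck n e1 e2 :=
  all (fun i => (zcoef e1 i).1 + (zcoef e2 i).2 == (zcoef e2 i).1 + (zcoef e1 i).2)%N
    (iota 0 n).

Lemma zcheckP env e1 e2 : zcheck (size env) e1 e2 -> zeval env e1 = zeval env e2.
Proof.
move=> /allP h; rewrite !zevalE; apply/eqP; rewrite subr_eq addrAC eq_sym subr_eq eq_sym.
rewrite -!big_split /=; apply/eqP; apply: eq_bigr => i _.
rewrite -!mulrnDr; congr (_ *+ _); apply/eqP; apply: h.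
by rewrite mem_iota /= add0n.
Qed.

End ZmodReflection.

(* Scalings are compared up to conversion, since rewriting may leave different
   instances of the same scaling. *)
Ltac zmod_index x env :=
  match env with
  | cons ?y ?env' => match x with
     | y => constr:(0%N)
     | (?a *: ?u)%R => match y with (a *: u)%R => constr:(0%N) end
     | _ => let n := zmod_index x env' in constr:(S n) end
  end.

Ltac zmod_vars env t :=
  match t with
  | (?a + ?b)%R => let env' := zmod_vars env a in zmod_vars env' b
  | (- ?a)%R => zmod_vars env a
  | 0%R => env
  | _ => match goal with
     | _ => let _ := zmod_index t env in env
     | _ => constr:(cons t env) end
  end.

Ltac zmod_reify env t :=
  match t with
  | (?a + ?b)%R => let a' := zmod_reify env a in let b' := zmod_reify env b in
      constr:(ZAdd a' b')
  | (- ?a)%R => let a' := zmod_reify env a in constr:(ZOpp a')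
  | 0%R => constr:(ZZero)
  | _ => let n := zmod_index t env in constr:(ZVar n)
  end.

Ltac zmod :=
  match goal with |- @eq ?T ?a ?b =>
    let env0 := constr:(@nil T) in
    let env1 := zmod_vars env0 a in
    let env := zmod_vars env1 b in
    let a' := zmod_reify env a in
    let b' := zmod_reify env b in
    exact: (@zcheckP _ env a' b' (erefl true))
  end.

(** * Power series and analytic maps *)

(** Peeling off the first term writes the sum as [e] times (1 + the previous sum), and
    [e * (1 + 2 * e) <= 2 * e] as soon as [e <= 2^-1]. *)
Lemma geometric_le2 (R : realFieldType) (e : R) n : 0 <= e -> e <= 2^-1 ->
  \sum_(i < n) e ^+ i.+1 <= 2 * e.
Proof.
move=> e0 e2; elim: n => [|n IH]; first by rewrite big_ord0; nra.
rewrite big_ord_recl /= expr1; under eq_bigr => i _ do rewrite /bump /= add1n exprS.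
rewrite -big_distrr /=; nra.
Qed.

Section PowerSeries.
Context {R : realType}.

Section Fps.
Context {E F : normedModType R}.

Definition upd (w : nat -> E) i x : nat -> E := fun j => if j == i then x else w j.

(* Coefficients take infinite argument lists, so that shifting the arguments
   does not change their type; the n-th one only looks at the first n. *)
Definition fps (a : nat -> (nat -> E) -> F) (M s : R) :=
  [/\ forall n w w', (forall i, (i < n)%N -> w i = w' i) -> a n w = a n w',
      forall n w i k x y, (i < n)%N ->
        a n (upd w i (k *: x + y)) = k *: a n (upd w i x) + a n (upd w i y) &
      forall n w, `|a n w| <= M * s ^- n * \prod_(i < n) `|w i|].

Definition has_fps (f : E -> F) x a (M s : R) :=
  [/\ 0 < s, fps a M s &
      forall h, `|h| < s -> series (fun n => a n (fun=> h)) @ \oo --> f (x + h)].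

Lemma analytic_fps f x : analytic_at f x -> exists a M s, has_fps f x a M s.
Proof.
move=> [a [M [r [r0 al ab ac]]]].
exists (fun n w => a n (fun i : 'I_n => w i)), M, r; split=> //; split.
- by move=> n w w' ww'; congr a; apply/funext => i; apply: ww'.
- move=> n w i k x1 y1 ltin.
  have E1 z : (fun j : 'I_n => upd w i z j) =
              dfwith (fun j : 'I_n => w j) (Ordinal ltin) z.
    apply/funext => j; rewrite /upd; case: dfwithP => [|j' ne]; first by rewrite eqxx.
    case: eqP => // ji; move: ne; rewrite -val_eqE /= ji eqxx //.
  by rewrite !E1 al.
- by move=> n w; exact: ab.
Qed.

Lemma fps_analytic f x a M s : has_fps f x a M s -> analytic_at f x.
Proof.
move=> [s0 [aloc al ab] ac].
(* Arguments from the n-th on are filled with 0; locality of the coefficients makes the filling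
   irrelevant. *)
pose ext n (v : 'I_n -> E) j := if insub j is Some i then v i else 0.
have extE n (v : 'I_n -> E) (i : 'I_n) : ext n v i = v i.
  by rewrite /ext valK.
exists (fun n v => a n (ext n v)), M, s; split=> //.
- move=> n v i k x1 y1.
  have E1 z : a n (ext n (dfwith v i z)) = a n (upd (ext n v) i z).
    apply: aloc => j ltj; rewrite -[j]/(val (Ordinal ltj)) extE /upd.
    case: dfwithP => [|j' ne]; first by rewrite eqxx.
    by rewrite val_eqE eq_sym (negbTE ne) extE.
  by rewrite !E1 al.
- move=> n v; apply: le_trans (ab _ _) _; rewrite le_eqVlt; apply/orP; left.
  by apply/eqP; congr (_ * _); apply: eq_bigr => i _; rewrite extE.
- move=> h hs; have := ac h hs.
  suff -> : (fun n => a n (fun=> h)) = (fun n => a n (ext n (fun=> h))) by [].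
  apply/funext => n; apply: aloc => i ltin.
  by have := extE n (fun=> h) (Ordinal ltin); rewrite /= => ->.
Qed.

Lemma fps_bound_ge0 a M s : fps a M s -> 0 <= M.
Proof.
move=> [_ _ ab]; have := ab 0%N (fun=> 0).
by rewrite big_ord0 expr0 invr1 !mulr1; exact: le_trans.
Qed.

Lemma fps_diag a M s h n : fps a M s -> 0 < s ->
  `|a n (fun=> h)| <= M * (`|h| / s) ^+ n.
Proof.
move=> [_ _ ab] s0; apply: le_trans (ab _ _) _.
by rewrite prodr_const card_ord expr_div_n -mulrA [X in M * X]mulrC.
Qed.

(** Within half the radius the tail is dominated by a geometric series of ratio at most 1/2, hence
    by twice its first term. Differentiability and composition rely on this explicit remainder, not
    on mere convergence. *)
Lemma fps_tail a M s h l n : fps a M s -> 0 < s -> `|h| / s <= 2^-1 ->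
  series (fun k => a k (fun=> h)) @ \oo --> l ->
  `|l - \sum_(k < n) a k (fun=> h)| <= 2 * M * (`|h| / s) ^+ n.
Proof.
move=> fa s0 ht cl; set t := `|h| / s in ht *.
have M0 := fps_bound_ge0 fa.
have t0 : 0 <= t by rewrite divr_ge0 // ltW.
have pb m : `|\sum_(k < n + m) a k (fun=> h) - \sum_(k < n) a k (fun=> h)|
    <= 2 * M * t ^+ n.
  rewrite big_split_ord /= [X in X - _]addrC addrK.
  apply: le_trans (ler_norm_sum _ _ _) _.
  apply: (@le_trans _ _ (\sum_(i < m) M * t ^+ n * t ^+ i)).
    apply: ler_sum => i _; apply: le_trans (fps_diag _ _ fa s0) _.
    by rewrite exprD mulrA.
  rewrite -big_distrr /= (_ : 2 * M * t ^+ n = M * t ^+ n * 2); last by ring.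
  apply: ler_wpM2l; first by rewrite mulr_ge0 ?exprn_ge0.
  case: m => [|m]; first by rewrite big_ord0.
  rewrite big_ord_recl expr0.
  have := @geometric_le2 _ t m t0 ht.
  by rewrite (eq_bigr (fun i : 'I_m => t ^+ i.+1)) //; lra.
have c2 : `|series (fun k => a k (fun=> h)) m -
             \sum_(k < n) a k (fun=> h)| @[m --> \oo] -->
          `|l - \sum_(k < n) a k (fun=> h)|.
  by apply: cvg_norm; apply: cvgB => //; exact: cvg_cst.
apply: (cvgr_to_le c2); exists n => // m /= nm.
by rewrite seriesEord -(subnKC nm) pb.
Qed.

End Fps.
End PowerSeries.

Section Composition.
Context {R : realType} {E F : normedModType R} {G : completeNormedModType R}.
Implicit Types (b : nat -> (nat -> F) -> G) (a : nat -> (nat -> E) -> F).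

Lemma fps_cvg b M s u : fps b M s -> 0 < s -> `|u| / s <= 2^-1 ->
  cvgn (series (fun n => b n (fun=> u))).
Proof.
move=> fb s0 hu; apply: normed_cvg.
have t0 : 0 <= `|u| / s by rewrite divr_ge0 // ltW.
have M0 := fps_bound_ge0 fb.
apply: (@series_le_cvg _ _ (geometric M (`|u| / s))).
- by move=> n /=.
- by move=> n; rewrite /geometric /= mulr_ge0 ?exprn_ge0.
- by move=> n; exact: fps_diag fb s0.
- apply: is_cvg_geometric_series; rewrite ger0_norm //; lra.
Qed.

Definition fcons (k : F) (w : nat -> F) j := if j is j'.+1 then w j' else k.

(** The series [b] with its constant term dropped and its first argument frozen at [k]. It is again
    a power series, whose bound gains a factor [|k| / s], and it is linear in [k]: these facts drive
    the recursion for composition. *)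
Definition tau (k : F) b : nat -> (nat -> F) -> G := fun m w => b m.+1 (fcons k w).

Lemma fcons_upd0 k x w : fcons k w = upd (fcons x w) 0 k.
Proof. by apply/funext => -[|j]. Qed.

Lemma fcons_updS k w i x : fcons k (upd w i x) = upd (fcons k w) i.+1 x.
Proof. by apply/funext => -[|j]. Qed.

Lemma tau_fps k b M s : 0 < s -> fps b M s -> fps (tau k b) (M * (`|k| / s)) s.
Proof.
move=> s0 [bloc bl bb]; split.
- move=> n w w' ww'; apply: bloc => -[|j] //=; exact: ww'.
- by move=> n w i c x y ltin; rewrite /tau !fcons_updS bl.
- move=> n w; apply: le_trans (bb _ _) _; rewrite big_ord_recl /= exprS invfM.
  rewrite le_eqVlt; apply/orP; left; apply/eqP.
  rewrite [X in _ = _ * X](_ : _ = \prod_(i < n) `|fcons k w (lift ord0 i)|).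
    by ring.
  by apply: eq_bigr.
Qed.

Lemma tau_lin b M s c x y : fps b M s ->
  tau (c *: x + y) b = fun m w => c *: tau x b m w + tau y b m w.
Proof.
move=> [_ bl _]; apply/funext => m; apply/funext => w.
by rewrite /tau (fcons_upd0 (_ + _) 0) bl // -!fcons_upd0.
Qed.

Definition gsum b (u : F) : G := limn (series (fun n => b n (fun=> u))).

Lemma gsum_cons b M s u : fps b M s -> 0 < s -> `|u| / s <= 2^-1 ->
  gsum b u = b 0 (fun=> u) + gsum (tau u b) u.
Proof.
move=> fb s0 hu.
have c2 := fps_cvg (tau_fps u s0 fb) s0 hu.
apply/cvg_lim => //; rewrite -cvg_shiftS.
rewrite [X in X @ _](_ : _ =
    (fun n => b 0 (fun=> u) + series (fun n => tau u b n (fun=> u)) n)); last first.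
  apply/funext => n; rewrite !seriesEord /= big_ord_recl; congr (_ + _).
  by apply: eq_bigr => i _; congr (b _ _); apply/funext => -[].
by apply: cvgD; [exact: cvg_cst | exact: c2].
Qed.

Lemma gsum_bound b M s u : fps b M s -> 0 < s -> `|u| / s <= 2^-1 ->
  `|gsum b u| <= 2 * M.
Proof.
move=> fb s0 hu; have := @fps_tail _ _ _ _ _ _ _ _ 0 fb s0 hu (fps_cvg fb s0 hu).
by rewrite big_ord0 subr0 expr0 mulr1.
Qed.

Lemma gsum_tau_lin b M s u c x y : fps b M s -> 0 < s -> `|u| / s <= 2^-1 ->
  gsum (tau (c *: x + y) b) u = c *: gsum (tau x b) u + gsum (tau y b) u.
Proof.
move=> fb s0 hu; rewrite (tau_lin _ _ _ fb); apply/cvg_lim => //.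
have cx := fps_cvg (tau_fps x s0 fb) s0 hu.
have cy := fps_cvg (tau_fps y s0 fb) s0 hu.
rewrite [X in X @ _](_ : _ = c \*: series (fun n => tau x b n (fun=> u)) \+
  series (fun n => tau y b n (fun=> u))); last first.
  by apply/funext => n; rewrite /= !seriesEord /= scaler_sumr -big_split.
by apply: cvgD cy; exact: cvgZl_tmp cx.
Qed.

Lemma gsum_tau_sum b M s u n (x : 'I_n -> F) y :
  fps b M s -> 0 < s -> `|u| / s <= 2^-1 ->
  gsum (tau (\sum_i x i + y) b) u = \sum_i gsum (tau (x i) b) u + gsum (tau y b) u.
Proof.
move=> fb s0 hu; elim: n x => [|n IH] x; first by rewrite !big_ord0 !add0r.
rewrite !big_ord_recl -!addrA -[x ord0]scale1r (gsum_tau_lin _ _ _ fb) //.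
by rewrite !scale1r IH.
Qed.

Definition wdrop (i : nat) (w : nat -> E) : nat -> E := fun j => w (i + j)%N.

(* comp f N b a w is the N-th coefficient of b(a_1 + a_2 + ...): the first
   argument of b is fed with a_i, i > 0, and tau moves on to the next one. The
   recursion is on the fuel f, and any f >= N gives the same result. *)
Fixpoint comp (f N : nat) b a (w : nat -> E) : G :=
  if f is f'.+1 then
    if N is N'.+1 then
      \sum_(i < N) comp f' (N' - i)%N (tau (a i.+1 w) b) a (wdrop i.+1 w)
    else b 0 (fun=> 0)
  else b 0 (fun=> 0).

Lemma comp_lin f N b b' a w c :
  comp f N (fun m w => c *: b m w + b' m w) a w = c *: comp f N b a w + comp f N b' a w.
Proof.
elim: f N b b' w => [//|f IH] [//|N] b b' w /=.
by rewrite scaler_sumr -big_split; apply: eq_bigr => i _; exact: IH.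
Qed.

Lemma comp_loc f N b a Ma s w w' : (N <= f)%N -> fps a Ma s ->
  (forall i, (i < N)%N -> w i = w' i) -> comp f N b a w = comp f N b a w'.
Proof.
move=> Nf [aloc _ _]; elim: f N b w w' Nf => [|f IH] [|N] b w w' //= Nf ww'.
apply: eq_bigr => i _; have lti := ltn_ord i.
rewrite (aloc i.+1 w w') => [|j hj]; last by apply: ww'; lia.
apply: IH => [|j hj]; first by lia.
by rewrite /wdrop; apply: ww'; lia.
Qed.

(** Position [j] belongs to exactly one block. If it is the first block, linearity of [a] and of
    [tau] applies; otherwise the first block does not see the change and induction treats the
    rest. *)
Lemma comp_mlin f N b a Ma s Mb s' w j c x y : (N <= f)%N -> 0 < s' -> (j < N)%N ->
  fps a Ma s -> fps b Mb s' ->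
  comp f N b a (upd w j (c *: x + y)) =
  c *: comp f N b a (upd w j x) + comp f N b a (upd w j y).
Proof.
move=> Nf s'0 jN fa; elim: f N b w Mb j Nf jN => [|f IH] [|N] b w Mb j //= Nf jN fb.
have [aloc al ab] := fa.
rewrite scaler_sumr -big_split; apply: eq_bigr => i _; have lti := ltn_ord i.
case: (leqP j i) => ji.
  rewrite al // (tau_lin _ _ _ fb) comp_lin.
  by congr (_ *: _ + _); apply: comp_loc fa _ => [|k hk]; try lia;
    rewrite /wdrop /upd; case: eqP => //; lia.
have E1 z : wdrop i.+1 (upd w j z) = upd (wdrop i.+1 w) (j - i.+1)%N z.
  by apply/funext => k; rewrite /wdrop /upd; congr (if _ then _ else _); lia.
have E2 z : a i.+1 (upd w j z) = a i.+1 w.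
  by apply: aloc => k hk; rewrite /upd; case: eqP => //; lia.
rewrite !E1 !E2; apply: IH (tau_fps _ s'0 fb); lia.
Qed.

Lemma comp_fuel f f' N b a w : (N <= f)%N -> (N <= f')%N ->
  comp f N b a w = comp f' N b a w.
Proof.
elim: f f' N b w => [|f IH] [|f'] [|N] b w //= Nf Nf'.
by apply: eq_bigr => i _; apply: IH; lia.
Qed.

Lemma prod_ord_split (f : nat -> R) i m :
  \prod_(j < i + m) f j = (\prod_(j < i) f j) * \prod_(j < m) f (i + j)%N.
Proof. by rewrite big_split_ord. Qed.

(** Shrinking the radius by the factor [e] pays for the many ways of cutting [N] into blocks: a
    first block of length [i.+1] costs [Ma / s' * e ^+ i.+1] relative to the claim, and these costs
    sum to at most [2 * (Ma / s') * e <= 2^-1]. *)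
Lemma comp_bound f N b a Ma s Mb s' e w : (N <= f)%N -> 0 < s -> 0 < s' ->
  0 < e -> e <= 2^-1 -> Ma / s' * e <= 4^-1 ->
  fps a Ma s -> fps b Mb s' ->
  `|comp f N b a w| <= Mb * (s * e) ^- N * \prod_(i < N) `|w i|.
Proof.
move=> Nf s0 s'0 e0 e2 ke fa; elim: f N b w Mb Nf => [|f IH] [|N] b w Mb //= Nf fb.
- by rewrite big_ord0; case: fb => _ _ /(_ 0%N (fun=> 0)); rewrite big_ord0.
- by rewrite big_ord0; case: fb => _ _ /(_ 0%N (fun=> 0)); rewrite big_ord0.
have Ma0 := fps_bound_ge0 fa; have Mb0 := fps_bound_ge0 fb.
have [_ _ ab] := fa.
apply: le_trans (ler_norm_sum _ _ _) _.
set Pi := \prod_(i < N.+1) _; set Q := (s * e) ^- N.+1.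
have Q0 : 0 <= Q by rewrite invr_ge0 exprn_ge0 // mulr_ge0 // ltW.
have Pi0 : 0 <= Pi by apply: prodr_ge0.
apply: (@le_trans _ _ (\sum_(i < N.+1) Mb * Q * Pi * (Ma / s') * e ^+ i.+1)).
  apply: ler_sum => i _; have lti := ltn_ord i.
  apply: le_trans (IH _ _ _ _ _ (tau_fps _ s'0 fb)) _; first by lia.
  have E1 : (i.+1 + (N - i) = N.+1)%N by lia.
  have := prod_ord_split (fun j => `|w j|) i.+1 (N - i)%N; rewrite E1 -/Pi => ->.
  set P1 := \prod_(j < i.+1) _; set P2 := \prod_(j < N - i) _.
  have P20 : 0 <= P2 by apply: prodr_ge0.
  have -> : Q = (s ^+ i.+1)^-1 * (e ^+ i.+1)^-1 * (s * e) ^- (N - i).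
    by rewrite -invfM -exprMn -invfM -exprD E1.
  have := ab i.+1 w; rewrite -/P1 => h.
  have q0 : 0 <= (s * e) ^- (N - i) by rewrite invr_ge0 exprn_ge0 // mulr_ge0 // ltW.
  have ei : e ^+ i.+1 != 0 by rewrite expf_neq0 // gt_eqF.
  rewrite [leRHS](_ : _ = Mb * ((Ma / s ^+ i.+1 * P1) / s') * (s * e) ^- (N - i) * P2).
    apply: ler_wpM2r => //; apply: ler_wpM2r => //; apply: ler_wpM2l => //.
    by apply: ler_wpM2r => //; rewrite invr_ge0 ltW.
  rewrite /Q; field; rewrite ei /=.
  by rewrite !expf_neq0 ?mulf_neq0 ?gt_eqF.
rewrite -big_distrr /=.
have := @geometric_le2 _ e N.+1 (ltW e0) e2; set G1 := \sum_(_ < _) _ => hG.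
have k0 : 0 <= Ma / s' by rewrite divr_ge0 // ltW.
rewrite -[leRHS]mulr1 -[leLHS]mulrA; apply: ler_wpM2l; first by rewrite !mulr_ge0.
by apply: le_trans (ler_wpM2l k0 hG) _; lra.
Qed.

Lemma fps_shrink (E' F' : normedModType R) (a : nat -> (nat -> E') -> F') M s s' :
  0 < s' -> s' <= s -> fps a M s -> fps a M s'.
Proof.
move=> s'0 ss' fa; have M0 := fps_bound_ge0 fa; have [al alin ab] := fa; split=> // n w.
apply: le_trans (ab n w) _; apply: ler_wpM2r; first exact: prodr_ge0.
apply: ler_wpM2l => //; rewrite lef_pV2 ?posrE ?exprn_gt0 //; last exact: lt_le_trans ss'.
by apply: lerXn2r; rewrite ?nnegrE //; apply: ltW => //; apply: lt_le_trans ss'.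
Qed.

(** Groups the contributions to the partial sum by the length of the first block, mirroring
    [gsum_cons] on the side of the coefficients. *)
Lemma comp_sum_rec N b a w :
  \sum_(n < N.+1) comp n n b a w = b 0 (fun=> 0) +
  \sum_(i < N) \sum_(n < N - i) comp n n (tau (a i.+1 w) b) a (wdrop i.+1 w).
Proof.
elim: N => [|N IH]; first by rewrite big_ord_recl !big_ord0.
rewrite big_ord_recr /= IH -!addrA; congr (_ + _).
rewrite [in RHS]big_ord_recr /= subSnn big_ord1.
rewrite [X in _ + X = _]big_ord_recr /= subnn addrA; congr (_ + _); last by case: (N).
rewrite -big_split /=; apply: eq_bigr => i _; have lti := ltn_ord i.
rewrite subSn; last by lia.
rewrite big_ord_recr /=; congr (_ + _); apply: comp_fuel; lia.
Qed.

(** Strong induction on [N], for all [b] at once. The increment [u] is split into its first [N]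
    terms and a remainder [r]. Freezing the term [a i.+1] as first argument leaves the same problem
    for [tau] and [N - i.+1]; all these errors together use half of the claimed bound, and the part
    of [r] uses a quarter. The decay [2^-1 ^+ N] comes from taking [h] in half the radius of the
    coefficients. *)
Lemma comp_converges N b a Ma s Mb s' e h u : 0 < s -> 0 < s' ->
  0 < e -> e <= 2^-1 -> Ma / s' * e <= 4^-1 ->
  `|h| / s <= e / 2 -> fps a Ma s -> fps b Mb s' ->
  (forall n, `|u - \sum_(i < n) a i.+1 (fun=> h)| <= 2 * Ma * (`|h| / s) ^+ n.+1) ->
  `|gsum b u - \sum_(n < N.+1) comp n n b a (fun=> h)| <= 2 * Mb * 2^-1 ^+ N.
Proof.
move=> s0 s'0 e0 e2 ke hh fa + uR.
have Ma0 := fps_bound_ge0 fa.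
set t := `|h| / s in hh uR; set k := Ma / s' in ke.
have t0 : 0 <= t by rewrite divr_ge0 // ltW.
have k0 : 0 <= k by rewrite divr_ge0 // ltW.
have us : `|u| / s' <= 2^-1.
  have := uR 0%N; rewrite big_ord0 subr0 expr1 => h1.
  rewrite ler_pdivrMr //; apply: le_trans h1 _.
  have -> : Ma = k * s' by rewrite /k divfK // gt_eqF.
  rewrite mulrA mulrAC; apply: ler_wpM2r; first exact: ltW.
  by nra.
have Ub i : `|a i.+1 (fun=> h)| / s' <= k * (e / 2) ^+ i.+1.
  rewrite /k mulrAC; apply: ler_wpM2r; first by rewrite invr_ge0 ltW.
  apply: le_trans (fps_diag _ _ fa s0) _; apply: ler_wpM2l => //.
  by apply: lerXn2r => //; rewrite nnegrE; lra.
elim/ltn_ind: N b Mb => N IH b Mb fb.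
have Mb0 := fps_bound_ge0 fb.
set r := u - \sum_(i < N) a i.+1 (fun=> h).
have -> : gsum b u = b 0 (fun=> 0) +
    \sum_(i < N) gsum (tau (a i.+1 (fun=> h)) b) u + gsum (tau r b) u.
  rewrite (gsum_cons fb) // -addrA; congr (_ + _).
    by case: fb => bl _ _; exact: bl.
  rewrite -(gsum_tau_sum _ _ fb) //; congr (gsum (tau _ b) u).
  by rewrite /r addrC subrK.
rewrite comp_sum_rec [X in `|X|](_ : _ =
  \sum_(i < N) (gsum (tau (a i.+1 (fun=> h)) b) u -
    \sum_(n < N - i) comp n n (tau (a i.+1 (fun=> h)) b) a (fun=> h)) +
  gsum (tau r b) u); last first.
  by rewrite sumrB opprD addrACA [X in X - _]addrC addrK addrCA addrC.
apply: le_trans (ler_normD _ _) _.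
have B1 : `|gsum (tau r b) u| <= Mb * 2^-1 ^+ N * 2^-1.
  apply: le_trans (gsum_bound (tau_fps r s'0 fb) s'0 us) _.
  rewrite mulrCA -mulrA; apply: ler_wpM2l => //.
  have : `|r| / s' <= 2 * k * (e / 2) ^+ N.+1.
    rewrite /k mulrA mulrAC; apply: ler_wpM2r; first by rewrite invr_ge0 ltW.
    apply: le_trans (uR N) _; apply: ler_wpM2l; first by rewrite mulr_ge0.
    by apply: lerXn2r => //; rewrite nnegrE; lra.
  move=> /(ler_wpM2l (ler0n R 2)) /le_trans; apply.
  rewrite exprMn exprS [2^-1 ^+ N.+1]exprSr.
  have eN : e ^+ N <= 1 by apply: exprn_ile1; lra.
  have eN0 : 0 <= e ^+ N by apply: exprn_ge0; lra.
  set z := 2^-1 ^+ N; have z0 : 0 <= z by apply: exprn_ge0; lra.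
  have kee : k * e * e ^+ N <= 4^-1 by nra.
  rewrite [leLHS](_ : _ = (k * e * e ^+ N) * (2 * z)); last by field.
  by nra.
have B2 : `|\sum_(i < N) (gsum (tau (a i.+1 (fun=> h)) b) u -
    \sum_(n < N - i) comp n n (tau (a i.+1 (fun=> h)) b) a (fun=> h))|
   <= Mb * 2^-1 ^+ N.
  apply: le_trans (ler_norm_sum _ _ _) _.
  apply: (@le_trans _ _ (\sum_(i < N) 2 * Mb * 2^-1 ^+ N * k * e ^+ i.+1)).
    apply: ler_sum => i _; have lti := ltn_ord i.
    have -> : (N - i = (N - i.+1).+1)%N by lia.
    apply: le_trans (IH (N - i.+1)%N _ _ _ (tau_fps _ s'0 fb)) _; first by lia.
    have -> : 2^-1 ^+ N = 2^-1 ^+ (N - i.+1) * 2^-1 ^+ i.+1 :> R.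
      by rewrite -exprD; congr (_ ^+ _); lia.
    have := Ub i; rewrite exprMn; set A1 := `|_| / s'; set z1 := 2^-1 ^+ i.+1.
    set z2 := 2^-1 ^+ (N - i.+1) => hA.
    have z20 : 0 <= z2 by apply: exprn_ge0; lra.
    rewrite [leRHS](_ : _ = 2 * Mb * (k * (e ^+ i.+1 * z1)) * z2); last by ring.
    rewrite [leLHS](_ : _ = 2 * Mb * A1 * z2); last by ring.
    apply: ler_wpM2r => //; apply: ler_wpM2l => //.
    by rewrite mulr_ge0.
  rewrite -big_distrr /=.
  have := @geometric_le2 _ e N (ltW e0) e2; set G1 := \sum_(_ < _) _ => hG.
  rewrite -[leRHS]mulr1 (_ : 2 * Mb * 2^-1 ^+ N * k * G1 =
    Mb * 2^-1 ^+ N * (2 * (k * G1))); last by ring.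
  apply: ler_wpM2l; first by rewrite mulr_ge0 // exprn_ge0 // invr_ge0.
  have := ler_wpM2l k0 hG; lra.
have z0 : 0 <= Mb * 2^-1 ^+ N by rewrite mulr_ge0 // exprn_ge0 // invr_ge0.
lra.
Qed.

End Composition.

Lemma bounded_linear_continuousE (K : numFieldType) (V W : normedModType K) (f : V -> W) C :
  linear f -> (forall x, `|f x| <= C * `|x|) -> continuous f.
Proof.
move=> fl fC.
have fB x y : f x - f y = f (x - y).
  by rewrite -[in RHS](scaleN1r y) [x + _]addrC fl scaleN1r addrC.
(* The sign of [C] is not given: a nonzero vector forces [0 <= C], and without one the space is
   trivial and [f] is constant. *)
have C0 : 0 <= C \/ forall x : V, x = 0.
  have [[x x0]|/forallNP h] := pselect (exists x : V, x != 0).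
    left; have := le_trans (normr_ge0 _) (fC x).
    by rewrite pmulr_lge0 // normr_gt0.
  by right=> x; have /negP := h x; rewrite negbK => /eqP.
case: C0 => [C0|V0]; last first.
  by move=> x; rewrite (_ : f = cst (f x)); [exact: cst_continuous|
    apply/funext => y; rewrite (V0 x) (V0 y)].
move=> x; apply/cvgrPdist_le => e e0.
have C1 : 0 < C + 1 by rewrite ltr_wpDl.
near=> y; rewrite fB; apply: le_trans (fC _) _.
apply: (@le_trans _ _ ((C + 1) * `|x - y|)).
  by apply: ler_wpM2r => //; rewrite lerDl.
rewrite mulrC -ler_pdivlMr //; near: y.
by apply: cvgr_dist_le; [exact: cvg_id|exact: divr_gt0].
Unshelve. all: by end_near. Qed.

Lemma continuous_linear_boundE (K : numFieldType) (V W : normedModType K) (f : V -> W) :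
  linear f -> continuous f -> exists2 C, 0 < C & forall x, `|f x| <= C * `|x|.
Proof.
move=> fl fc.
pose f' : {linear V -> W} := HB.pack f (GRing.isLinear.Build _ _ _ _ f fl).
have /linear_boundedP[C [Cr CP]] : bounded_near f' (nbhs (0 : V)).
  by apply: continuous_linear_bounded; exact: fc.
exists (`|C| + 1); first by rewrite ltr_wpDl.
move=> x; apply: CP; rewrite (le_lt_trans (real_ler_norm Cr)) //.
by rewrite ltrDl.
Qed.

(** * Composition and differentials of analytic maps *)

Section AnalyticCalculus.
Context {R : realType}.

Lemma has_fps_at0 (E F : normedModType R) (f : E -> F) x a M s w :
  has_fps f x a M s -> f x = a 0%N w.
Proof.
move=> [s0 fa fc]; have := @fps_tail _ _ _ _ _ _ 0 (f x) 1 fa s0.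
rewrite normr0 mul0r invr_ge0 ler0n => /(_ isT).
rewrite -{1}[x]addr0 => /(_ (fc 0 _)); rewrite normr0 => /(_ s0).
rewrite big_ord1 expr1 mulr0 normr_le0 subr_eq0 => /eqP ->.
by case: fa => al _ _; exact: al.
Qed.

Lemma analytic_comp (E F : normedModType R) (G : completeNormedModType R)
    (f : E -> F) (g : F -> G) x :
  analytic_at f x -> analytic_at g (f x) -> analytic_at (g \o f) x.
Proof.
move=> /analytic_fps[a [Ma [s [s0 fa fc]]]] /analytic_fps[b [Mb [s' [s'0 fb gc]]]].
have Ma0 := fps_bound_ge0 fa; have Mb0 := fps_bound_ge0 fb.
set k := Ma / s'; have k0 : 0 <= k by rewrite divr_ge0 // ltW.
(* Chosen so that [e <= 2^-1] and [k * e <= 4^-1] hold together. *)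
pose e := (4 * k + 2)^-1.
have d0 : 0 < 4 * k + 2 by lra.
have e0 : 0 < e by rewrite invr_gt0.
have ed : e * (4 * k + 2) = 1 by rewrite mulVf // gt_eqF.
have ek0 : 0 <= e * k by rewrite mulr_ge0 // ltW.
have e2 : e <= 2^-1 by lra.
have ke : k * e <= 4^-1 by lra.
(* The coefficients are bounded with radius [s * e]; half of it gives [|h| / s <= e / 2], as the
   convergence estimate requires. *)
apply: (@fps_analytic _ _ _ _ _ (fun N w => comp N N b a w) Mb (s * e / 2)).
have r0 : 0 < s * e / 2 by rewrite divr_gt0 // mulr_gt0.
split=> //.
  apply: (@fps_shrink _ _ _ _ _ (s * e)) => //.
    by rewrite ler_piMr ?mulr_ge0 ?ltW // invf_lt1 // ltr1n.
  split.
  - by move=> n w w'; apply: (comp_loc b (leqnn n) fa).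
  - by move=> n w i c y z lti; exact: comp_mlin (leqnn n) s'0 lti fa fb.
  - by move=> n w; exact: comp_bound (leqnn n) s0 s'0 e0 e2 ke fa fb.
move=> h hr.
have hs : `|h| / s <= e / 2 by rewrite ler_pdivrMr // ltW // mulrC mulrA.
have hs2 : `|h| / s <= 2^-1 by lra.
have t0 : 0 <= `|h| / s by rewrite divr_ge0 // ltW.
have hs1 : `|h| < s.
  by rewrite -[ltRHS]mul1r -ltr_pdivrMr //; lra.
set u := f (x + h) - f x.
have uR n : `|u - \sum_(i < n) a i.+1 (fun=> h)| <= 2 * Ma * (`|h| / s) ^+ n.+1.
  have := @fps_tail _ _ _ _ _ _ h _ n.+1 fa s0 hs2 (fc h hs1).
  by rewrite big_ord_recl -(has_fps_at0 _ (And3 s0 fa fc)) opprD addrA.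
have us : `|u| / s' <= 2^-1.
  have := uR 0%N; rewrite big_ord0 subr0 expr1 => h1.
  rewrite ler_pdivrMr //; apply: le_trans h1 _.
  have -> : Ma = k * s' by rewrite /k divfK // gt_eqF.
  rewrite mulrA mulrAC; apply: ler_wpM2r; first exact: ltW.
  by have := ler_wpM2l k0 hs; lra.
have -> : (g \o f) (x + h) = gsum b u.
  rewrite /= -(subrK (f x) (f (x + h))) -/u addrC; apply/esym/cvg_lim => //.
  by apply: gc; rewrite -[ltRHS]mul1r -ltr_pdivrMr //; lra.
rewrite -cvg_shiftS; apply/cvgrPdist_le => d d0'.
have h12 : `|2^-1 : R| < 1 by rewrite ger0_norm; lra.
have := cvg_geometric (2 * Mb) h12.
move=> /cvgrPdist_le/(_ d d0') [N _ NP]; exists N => // n /NP /=.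
rewrite sub0r normrN => h2; rewrite seriesEord /=.
apply: le_trans (comp_converges n s0 s'0 e0 e2 ke hs fa fb uR) _.
by apply: le_trans h2; exact: ler_norm.
Qed.

Lemma has_fps_near (E F : normedModType R) (f g : E -> F) x a M s :
  (\forall y \near x, f y = g y) -> has_fps f x a M s -> exists s', has_fps g x a M s'.
Proof.
move=> /nbhs_ballP[e /= e0 fg] [s0 fa fc].
have m0 : 0 < Num.min s e by rewrite lt_min s0.
exists (Num.min s e); split=> //.
  by apply: fps_shrink fa => //; rewrite ge_min lexx.
move=> h; rewrite lt_min => /andP[hs he].
rewrite -fg; first exact: fc.
by rewrite -ball_normE /= opprD addNKr normrN.
Qed.

Lemma analytic_near (E F : normedModType R) (f g : E -> F) x :
  (\forall y \near x, f y = g y) -> analytic_at f x -> analytic_at g x.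
Proof.
move=> fg /analytic_fps[a [M [s fa]]]; have [s' ga] := has_fps_near fg fa.
exact: fps_analytic ga.
Qed.

Lemma has_fps_diff (E F : normedModType R) (f : E -> F) x a M s :
  has_fps f x a M s ->
  differentiable f x /\ forall h, 'd f x h = a 1%N (fun=> h).
Proof.
move=> fP; have [s0 fa fc] := fP; have M0 := fps_bound_ge0 fa.
have [al alin ab] := fa.
pose df h := a 1%N (fun=> h).
have dfE h : df h = a 1%N (upd (fun=> 0) 0%N h).
  by apply: al => -[].
have dfl : linear df by move=> c y z; rewrite !dfE alin.
have dfb h : `|df h| <= (M / s) * `|h|.
  by apply: le_trans (fps_diag _ _ fa s0) _; rewrite expr1 mulrCA mulrC.
have dfc : continuous df := bounded_linear_continuousE dfl dfb.
pose df' : {linear E -> F} := HB.pack df (GRing.isLinear.Build _ _ _ _ df dfl).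
have fo : f \o shift x = cst (f x) + df' +o_ (0 : E) id.
  apply/eqaddoP => d d0 /=.
  (* With [p = 2 * M / s ^+ 2] the remainder is at most [p * |h| ^+ 2], which is below [d * |h|]
     once [|h| < d / (p + 1)]; the 1 keeps the denominator positive. *)
  have d1 : 0 < d / (2 * M / s ^+ 2 + 1).
    by rewrite divr_gt0 // ltr_wpDl // divr_ge0 ?exprn_ge0 ?mulr_ge0 // ltW.
  have s2 : 0 < s / 2 by rewrite divr_gt0.
  have q0 : 0 < Num.min (s / 2) (d / (2 * M / s ^+ 2 + 1)) by rewrite lt_min s2.
  apply/nbhs_ballP; exists (Num.min (s / 2) (d / (2 * M / s ^+ 2 + 1))) => //= h.
  rewrite -ball_normE /= sub0r normrN lt_min => /andP[hs hd].
  have hs2 : `|h| / s <= 2^-1 by rewrite ler_pdivrMr // mulrC ltW.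
  have hs1 : `|h| < s by lra.
  have := @fps_tail _ _ _ _ _ _ h _ 2 fa s0 hs2 (fc h hs1).
  rewrite big_ord_recl big_ord1 -(has_fps_at0 _ fP) /=.
  rewrite -[a (bump 0 0) _]/(df h) -[(f \o _ - _) h]/(f (h + x) - (f x + df h)).
  rewrite [h + x]addrC => /le_trans; apply.
  rewrite expr2 (_ : 2 * M * _ = (2 * M / s ^+ 2) * `|h| * `|h|); last first.
    by field; rewrite gt_eqF.
  apply: ler_wpM2r => //.
  have p0 : 0 <= 2 * M / s ^+ 2 by rewrite divr_ge0 ?exprn_ge0 ?mulr_ge0 // ltW.
  set p := 2 * M / s ^+ 2 in hd p0 *.
  have : `|h| * (p + 1) < d by rewrite -ltr_pdivlMr //; lra.
  have := normr_ge0 h; nra.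
have dE := @diff_unique _ _ _ f df' x dfc fo.
split; last by move=> h; rewrite dE.
by apply/diff_locallyP; rewrite dE.
Qed.

Lemma analytic_differentiable (E F : normedModType R) (f : E -> F) x :
  analytic_at f x -> differentiable f x.
Proof. by move=> /analytic_fps[a [M [s /has_fps_diff[]]]]. Qed.

Lemma analytic_near_diff (E F : normedModType R) (f g : E -> F) x h :
  (\forall y \near x, f y = g y) -> analytic_at f x -> 'd f x h = 'd g x h.
Proof.
move=> fg /analytic_fps[a [M [s fa]]]; have [s' ga] := has_fps_near fg fa.
by have [_ ->] := has_fps_diff fa; have [_ ->] := has_fps_diff ga.
Qed.

Lemma analytic_continuous (E F : normedModType R) (f : E -> F) x :
  analytic_at f x -> {for x, continuous f}.
Proof. by move=> /analytic_differentiable/differentiable_continuous. Qed.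

(** The common source of analyticity for constant, linear and bilinear maps. The expansion stops at
    degree 2 and is exact, so the radius 1 is an arbitrary choice. *)
Lemma has_fps_poly2 (E F : normedModType R) (f : E -> F) x
    (a1 : E -> F) (a2 : E -> E -> F) C :
  linear a1 -> (forall y, linear (a2 y)) -> (forall y, linear (a2^~ y)) ->
  (forall y, `|a1 y| <= C * `|y|) ->
  (forall y z, `|a2 y z| <= C * `|y| * `|z|) ->
  (forall h, f (x + h) = f x + a1 h + a2 h h) ->
  has_fps f x (fun n w => match n with
     0 => f x | 1 => a1 (w 0%N) | 2 => a2 (w 0%N) (w 1%N) | _ => 0 end)
     (`|f x| + `|C|) 1.
Proof.
move=> l1 l2 l2' b1 b2 fE.
have C0 : C <= `|f x| + `|C|.
  by apply: le_trans (ler_norm C) _; rewrite lerDr.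
split=> //; first split.
- by move=> [|[|[|n]]] w w' ww' //; rewrite !ww'.
- move=> [|[|[|n]]] w i c y z //= lti.
  + by case: i lti => // _; rewrite /upd eqxx l1.
  + by case: i lti => [|[|]] //= _; rewrite /upd /= ?l2' ?l2.
  + by rewrite scaler0 addr0.
- move=> [|[|[|n]]] w; rewrite expr1n invr1 mulr1.
  + by rewrite big_ord0 mulr1 lerDl.
  + by rewrite big_ord1; apply: le_trans (b1 _) _; exact: ler_wpM2r.
  + rewrite big_ord_recl big_ord1 mulrA /bump /=; apply: le_trans (b2 _ _) _.
    by apply: ler_wpM2r => //; exact: ler_wpM2r.
  + by rewrite normr0 mulr_ge0 ?prodr_ge0 // addr_ge0.
move=> h _; rewrite -cvg_shiftS -cvg_shiftS -cvg_shiftS fE.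
apply: cvg_near_cst; apply: nearW => n /=.
by rewrite seriesEord /= 3!big_ord_recl big1 // addr0 addrA.
Qed.

Lemma diff_linear (E F : normedModType R) (f : E -> F) x h :
  linear f -> continuous f -> 'd f x h = f h.
Proof.
move=> fl fc; have [C C0 fC] := continuous_linear_boundE fl fc.
have hf := @has_fps_poly2 _ _ f x f (fun _ _ => 0) C fl.
have [] := has_fps_diff (hf _ _ _ _ _) => //.
- by move=> y k u v; rewrite scaler0 addr0.
- by move=> y k u v; rewrite scaler0 addr0.
- by move=> y z; rewrite normr0 !mulr_ge0 // ltW.
- by move=> v; rewrite addr0 -[x in LHS]scale1r fl scale1r.
Qed.

End AnalyticCalculus.

Section AnalyticMaps.
Context {R : realType}.

Lemma analytic_linear (E F : normedModType R) (f : E -> F) x :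
  linear f -> continuous f -> analytic_at f x.
Proof.
move=> fl fc; have [C C0 fC] := continuous_linear_boundE fl fc.
apply: fps_analytic; apply: (@has_fps_poly2 _ _ _ _ _ f (fun _ _ => 0) C) => //.
- by move=> y k u v; rewrite scaler0 addr0.
- by move=> y k u v; rewrite scaler0 addr0.
- by move=> y z; rewrite normr0 !mulr_ge0 // ltW.
- by move=> h; rewrite addr0 -[x in LHS]scale1r fl scale1r.
Qed.

Lemma analytic_cst (E F : normedModType R) (c : F) (x : E) : analytic_at (fun=> c) x.
Proof.
apply: fps_analytic; apply: (@has_fps_poly2 _ _ _ _ _ (fun _ => 0) (fun _ _ => 0) 0) => //.
- by move=> k u v; rewrite scaler0 addr0.
- by move=> y k u v; rewrite scaler0 addr0.
- by move=> y k u v; rewrite scaler0 addr0.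
- by move=> y; rewrite normr0 mul0r.
- by move=> y z; rewrite normr0 !mul0r.
- by move=> h; rewrite !addr0.
Qed.

Lemma analytic_id (E : normedModType R) (x : E) : analytic_at id x.
Proof. by apply: analytic_linear => // y; exact: cvg_id. Qed.

Lemma bilinear_has_fps (E1 E2 F : normedModType R) (B : E1 -> E2 -> F) C x :
  (forall y, linear (B y)) -> (forall y, linear (B^~ y)) -> 0 <= C ->
  (forall y z, `|B y z| <= C * `|y| * `|z|) ->
  exists M s, has_fps (fun p : E1 * E2 => B p.1 p.2) x
    (fun n w => match n with 0 => B x.1 x.2 | 1 => B x.1 (w 0%N).2 + B (w 0%N).1 x.2
      | 2 => B (w 0%N).1 (w 1%N).2 | _ => 0 end) M s.
Proof.
move=> l1 l2 C0 bC.
have BD1 y u v : B (u + v) y = B u y + B v y.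
  by have := l2 y 1 u v; rewrite !scale1r.
have BD2 y u v : B y (u + v) = B y u + B y v.
  by have := l1 y 1 u v; rewrite !scale1r.
(* One constant for both parts: in the max norm the linear part is bounded by [C * (|x.1| + |x.2|)]
   and the quadratic part by [C]. *)
pose K := C * (`|x.1| + `|x.2| + 1).
have h1 (y : E1) (z : E2) m m' : `|y| <= m -> `|z| <= m' -> `|B y z| <= C * m * m'.
  move=> ym zm; apply: le_trans (bC _ _) _.
  by apply: ler_pM => //; [exact: mulr_ge0|exact: ler_wpM2l].
exists (`|B x.1 x.2| + `|K|), 1.
apply: (@has_fps_poly2 _ _ _ (fun p : E1 * E2 => B p.1 p.2) x
   (fun h => B x.1 h.2 + B h.1 x.2) (fun h k => B h.1 k.2) K).
- by move=> k [u1 u2] [v1 v2] /=; rewrite l1 l2 scalerDr addrACA.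
- by move=> y k [u1 u2] [v1 v2] /=; rewrite l1.
- by move=> y k [u1 u2] [v1 v2] /=; rewrite l2.
- move=> [y1 y2]; rewrite prod_normE /=.
  set m := Num.max _ _.
  have m1 : `|y1| <= m by rewrite le_max lexx.
  have m2 : `|y2| <= m by rewrite le_max lexx orbT.
  have m0 := le_trans (normr_ge0 _) m1.
  apply: le_trans (ler_normD _ _) _.
  have g1 := h1 _ _ _ _ (lexx `|x.1|) m2; have g2 := h1 _ _ _ _ m1 (lexx `|x.2|).
  have := mulr_ge0 C0 m0; rewrite /K; nra.
- move=> [y1 y2] [z1 z2]; rewrite !prod_normE /=.
  set m := Num.max `|y1| _; set m' := Num.max `|z1| _.
  have m1 : `|y1| <= m by rewrite le_max lexx.
  have m2 : `|z2| <= m' by rewrite le_max lexx orbT.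
  apply: le_trans (h1 _ _ _ _ m1 m2) _.
  apply: ler_wpM2r; first exact: le_trans m2.
  apply: ler_wpM2r; first exact: le_trans m1.
  have := mulr_ge0 C0 (normr_ge0 x.1); have := mulr_ge0 C0 (normr_ge0 x.2).
  rewrite /K; nra.
- by move=> h /=; rewrite BD1 !BD2 !addrA.
Qed.

Lemma analytic_bilinear (E1 E2 F : normedModType R) (B : E1 -> E2 -> F) C x :
  (forall y, linear (B y)) -> (forall y, linear (B^~ y)) -> 0 <= C ->
  (forall y z, `|B y z| <= C * `|y| * `|z|) ->
  analytic_at (fun p : E1 * E2 => B p.1 p.2) x.
Proof.
move=> l1 l2 C0 /(bilinear_has_fps x l1 l2 C0)[M [s h]]; exact: fps_analytic h.
Qed.

Lemma bilinear_diff (E1 E2 F : normedModType R) (B : E1 -> E2 -> F) C x h :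
  (forall y, linear (B y)) -> (forall y, linear (B^~ y)) -> 0 <= C ->
  (forall y z, `|B y z| <= C * `|y| * `|z|) ->
  'd (fun p : E1 * E2 => B p.1 p.2) x h = B x.1 h.2 + B h.1 x.2.
Proof.
move=> l1 l2 C0 /(bilinear_has_fps x l1 l2 C0)[M [s /has_fps_diff[_ ->]]] //.
Qed.

Lemma analytic_pair (E F G : normedModType R) (f : E -> F) (g : E -> G) x :
  analytic_at f x -> analytic_at g x -> analytic_at (fun y => (f y, g y)) x.
Proof.
move=> /analytic_fps[a [M [s [s0 fa fc]]]] /analytic_fps[b [M' [s' [s'0 gb gc]]]].
set m := Num.min s s'; have m0 : 0 < m by rewrite lt_min s0.
have ms : m <= s by rewrite ge_min lexx.
have ms' : m <= s' by rewrite ge_min lexx orbT.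
have fa' := fps_shrink m0 ms fa; have gb' := fps_shrink m0 ms' gb.
have M0 := fps_bound_ge0 fa; have M'0 := fps_bound_ge0 gb.
apply: (@fps_analytic _ _ _ _ _ (fun n w => (a n w, b n w)) (M + M') m).
have [al alin ab] := fa'; have [bl blin bb] := gb'.
split=> //.
  split.
  - by move=> n w w' ww'; rewrite (al _ w w') // (bl _ w w').
  - by move=> n w i k y z lti; rewrite alin // blin.
  - move=> n w; rewrite prod_normE /= ge_max mulrDl mulrDl.
    have p0 : 0 <= \prod_(i < n) `|w i| by exact: prodr_ge0.
    have q0 : 0 <= m ^- n by rewrite invr_ge0 exprn_ge0 // ltW.
    have h1 := mulr_ge0 (mulr_ge0 M0 q0) p0; have h2 := mulr_ge0 (mulr_ge0 M'0 q0) p0.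
    by have g1 := ab n w; have g2 := bb n w; apply/andP; split; lra.
move=> h hm.
have c1 := fc h (lt_le_trans hm ms); have c2 := gc h (lt_le_trans hm ms').
rewrite [X in X @ _](_ : _ = fun n => (series (fun n => a n (fun=> h)) n,
   series (fun n => b n (fun=> h)) n)); first exact: cvg_pair c1 c2.
apply/funext => n; rewrite !seriesEord /=.
elim: n => [|n IH]; first by rewrite !big_ord0.
by rewrite !big_ord_recr /= IH.
Qed.

Lemma analytic_comp2 (E F1 F2 : normedModType R) (G : completeNormedModType R)
    (f1 : E -> F1) (f2 : E -> F2) (g : F1 * F2 -> G) x :
  analytic_at f1 x -> analytic_at f2 x -> analytic_at g (f1 x, f2 x) ->
  analytic_at (fun y => g (f1 y, f2 y)) x.
Proof. by move=> a1 a2; apply: (analytic_comp (analytic_pair a1 a2)). Qed.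

Lemma analytic_fst (E F : normedModType R) (x : E * F) : analytic_at fst x.
Proof. by apply: analytic_linear => // y; exact: cvg_fst. Qed.

Lemma analytic_snd (E F : normedModType R) (x : E * F) : analytic_at snd x.
Proof. by apply: analytic_linear => // y; exact: cvg_snd. Qed.

Lemma analyticD (E : normedModType R) (F : completeNormedModType R) (f g : E -> F) x :
  analytic_at f x -> analytic_at g x -> analytic_at (f + g) x.
Proof.
move=> fa ga; apply: (analytic_comp2 (g := fun p => p.1 + p.2) fa ga).
apply: analytic_linear => [k [u1 u2] [v1 v2]|p] /=; first by rewrite scalerDr addrACA.
exact: add_continuous.
Qed.

End AnalyticMaps.

(** * The open mapping theorem *)

Section OpenMapping.
Context {R : realType} {U V : completeNormedModType R}.

(** By Baire, the closure of the image of some ball contains a ball. Successive approximation,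
    halving the error each time, then replaces approximate preimages by exact ones with a controlled
    norm. *)
Theorem open_mapping (f : U -> V) : linear f -> continuous f ->
  (forall y, exists x, f x = y) ->
  exists2 C, 0 <= C & forall y, exists2 x, f x = y & `|x| <= C * `|y|.
Proof.
move=> fl fc fs.
pose g : {linear U -> V} := HB.pack f (GRing.isLinear.Build _ _ _ _ f fl).
pose B (n : nat) : set V := closure (f @` [set x | `|x| <= n%:R]).
have [n [y0 [e e0 eB]]] : exists n y0, exists2 e, 0 < e & ball y0 e `<=` B n.
  have [h|/existsNP[n h]] := pselect (forall n, dense (~` B n)).
    have Bo n : open (~` B n) /\ dense (~` B n).
      by split=> //; apply: closed_openC; exact: closed_closure.
    have /(_ setT) := Baire Bo; case; [by exists 0|exact: openT|].
    move=> y [_ /= yB]; have [x xy] := fs y; exfalso.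
    apply: (yB (Num.truncn `|x|).+1 I); apply: subset_closure; exists x => //=.
    by rewrite ltW // truncnS_gt.
  exists n; have /existsNP[Q /not_implyP[[y Qy] /not_implyP[Qo hQ]]] := h.
  have : nbhs y Q by exact: open_nbhs_nbhs.
  move=> /nbhs_ballP[e /= e0 eQ]; exists y, e => // z /eQ Qz.
  by apply: contrapT => zB; apply: hQ; exists z.
(* [y] is the difference of [y0 + y] and [y0], both approximated from the ball of radius [n]; hence
   the norm [2 * n] and the accuracy [d / 2] for each. *)
have small y d : `|y| < e -> 0 < d -> exists2 x, `|x| <= 2 * n%:R & `|y - f x| < d.
  move=> ye d0; have d2 : 0 < d / 2 by rewrite divr_gt0.
  have := eB (y0 + y); rewrite -ball_normE /= opprD addNKr normrN => /(_ ye).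
  move=> /(_ (ball (y0 + y) (d / 2)) (nbhsx_ballx _ _ d2)) [_ [[x1 /= x1n <-]]].
  have := eB y0 (ballxx _ e0) (ball y0 (d / 2)) (nbhsx_ballx _ _ d2).
  move=> [_ [[x2 /= x2n <-]]]; rewrite -!ball_normE /= => b2 b1.
  exists (x1 - x2).
    by apply: le_trans (ler_normB _ _) _; lra.
  rewrite -[f]/(g : U -> V) linearB /=.
  have -> : y - (f x1 - f x2) = (y0 + y - f x1) - (y0 - f x2).
    by zmod.
  by apply: le_lt_trans (ler_normB _ _) _; lra.
(* Scaling [y] to norm [e / 2] and approximating within [e / 4] halves the error. Scaling back turns
   the norm [2 * n] into [4 * n / e * |y|]; the 1 makes [K] positive. *)
pose K := 4 * n%:R / e + 1.
have K0 : 0 < K by rewrite ltr_wpDl // divr_ge0 ?mulr_ge0 // ltW.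
have step y : exists x, `|x| <= K * `|y| /\ `|y - f x| <= 2^-1 * `|y|.
  have [->|y0'] := eqVneq y 0.
    by exists 0; rewrite -[f]/(g : U -> V) linear0 subr0 !normr0 !mulr0.
  have ny : 0 < `|y| by rewrite normr_gt0.
  pose c := e / (2 * `|y|).
  have c0 : 0 < c by rewrite divr_gt0 // mulr_gt0.
  have cy : `|c *: y| < e.
    rewrite normrZ gtr0_norm // /c invfM mulrA divfK ?gt_eqF //.
    by rewrite ltr_pdivrMr // mulr_natr mulr2n ltrDl.
  have [x xn xd] := small _ (e / 4) cy (divr_gt0 e0 (ltr0n _ 4)).
  exists (c^-1 *: x); rewrite normrZ (gtr0_norm (_ : 0 < c^-1)) ?invr_gt0 //.
  have ce : c^-1 = 2 * `|y| / e by rewrite /c invf_div.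
  split.
    apply: (@le_trans _ _ (c^-1 * (2 * n%:R))).
      by apply: ler_wpM2l => //; rewrite invr_ge0 ltW.
    rewrite ce (_ : _ * _ = 4 * n%:R / e * `|y|); last by field; rewrite gt_eqF.
    by rewrite /K [leRHS]mulrDl mul1r lerDl.
  have -> : y - f (c^-1 *: x) = c^-1 *: (c *: y - f x).
    rewrite -[f]/(g : U -> V) linearZ /= scalerBr scalerA mulVf ?gt_eqF //.
    by rewrite scale1r.
  rewrite normrZ (gtr0_norm (_ : 0 < c^-1)) ?invr_gt0 // ce.
  apply: (@le_trans _ _ (2 * `|y| / e * (e / 4))).
    by apply: ler_wpM2l; rewrite ?ltW // divr_gt0 // mulr_gt0.
  rewrite le_eqVlt; apply/orP; left; apply/eqP; field; rewrite gt_eqF //.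
have [h hP] := choice step.
exists (2 * K); first by rewrite mulr_ge0 // ltW.
(* [z n] is the error left after [n] corrections, so the corrections [h (z n)] sum to a preimage of
   [y] of norm at most [2 * K * |y|]. *)
move=> y; pose z n := iter n (fun v => v - f (h v)) y.
have zn m : `|z m| <= 2^-1 ^+ m * `|y|.
  elim: m => [|m IH]; first by rewrite expr0 mul1r.
  rewrite /= exprS -mulrA; apply: le_trans (hP _).2 _.
  by apply: ler_wpM2l => //; rewrite invr_ge0.
have hn m : `|h (z m)| <= K * `|y| * 2^-1 ^+ m.
  apply: le_trans (hP _).1 _; rewrite -mulrA [`|y| * _]mulrC.
  by apply: ler_wpM2l => //; exact: ltW.
have h12 : `|2^-1 : R| < 1 by rewrite ger0_norm; lra.
have hc : cvgn (series (h \o z)).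
  apply: normed_cvg.
  apply: (@series_le_cvg _ _ (geometric (K * `|y|) 2^-1)) => //.
  - by move=> m /=.
  - by move=> m; rewrite /geometric /= mulr_ge0 ?exprn_ge0 ?invr_ge0 ?mulr_ge0 // ltW.
  - exact: is_cvg_geometric_series.
have fz m : f (series (h \o z) m) = y - z m.
  elim: m => [|m IH]; first by rewrite /series /= big_geq // -[f]/(g : U -> V) linear0 subrr.
  rewrite seriesSr /= -[f]/(g : U -> V) linearD /= IH.
  by zmod.
have zc : z @ \oo --> 0.
  apply/norm_cvg0P/(@squeeze_cvgr _ _ _ _ (fun=> 0) (geometric `|y| 2^-1)).
  - apply: nearW => m; rewrite normr_ge0 /geometric /= mulrC; exact: zn.
  - exact: cvg_cst.
  - exact: cvg_geometric.
exists (limn (series (h \o z))).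
  have c1 : f (series (h \o z) m) @[m --> \oo] --> f (limn (series (h \o z))).
    by apply: continuous_cvg hc; exact: fc.
  have c3 : f (series (h \o z) m) @[m --> \oo] --> y.
    rewrite [X in X @ _](funext fz) -[X in _ --> X](subr0 y).
    by apply: cvgB zc; exact: cvg_cst.
  exact: cvg_unique c1 c3.
have c2 : `|series (h \o z) m| @[m --> \oo] --> `|limn (series (h \o z))|.
  exact: cvg_norm hc.
apply: (cvgr_to_le c2); apply: nearW => m; rewrite seriesEord /=.
apply: le_trans (ler_norm_sum _ _ _) _.
apply: (@le_trans _ _ (\sum_(i < m) K * `|y| * 2^-1 ^+ i)).
  by apply: ler_sum => i _; exact: hn.
rewrite -big_distrr /= [2 * K]mulrC -[K * 2 * _]mulrA [2 * _]mulrC mulrA.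
apply: ler_wpM2l; first by rewrite mulr_ge0 // ltW.
case: m => [|m]; first by rewrite big_ord0.
rewrite big_ord_recl expr0.
have := @geometric_le2 R 2^-1 m; rewrite invr_ge0 ler0n lexx => /(_ isT isT).
rewrite mulfV ?pnatr_eq0 // => h3.
by rewrite (eq_bigr (fun i : 'I_m => 2^-1 ^+ i.+1)) //; lra.
Qed.

End OpenMapping.

Lemma nbhsI (T : topologicalType) (x : T) (A B : set T) :
  nbhs x A -> nbhs x B -> nbhs x (A `&` B).
Proof. by move=> ? ?; apply: filterI. Qed.

(** * Charts and submanifolds *)

Section Charts.
Context {R : realType}.
Implicit Types (M N L : topologicalType).

Lemma chart_nbhs M (c : @chart R M) p : is_chart c -> dom c p -> nbhs p (dom c).
Proof. by move=> [co _ _ _] cp; exact: open_nbhs_nbhs. Qed.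

Lemma chart_cont M (c : @chart R M) p : is_chart c -> dom c p -> {for p, continuous c}.
Proof. by move=> [_ _ cc _] cp; apply: cc; exact: mem_set. Qed.

Lemma chart_open M (c : @chart R M) p A : is_chart c -> dom c p -> nbhs p A ->
  nbhs (c p) (c @` (A `&` dom c)).
Proof.
move=> [co _ _ cU] cp; rewrite nbhsE => -[B [Bo Bp] BA].
have Uo : open (B `&` dom c) by exact: openI.
apply: (filterS _ (open_nbhs_nbhs (conj (cU _ Uo _) _))).
- by apply: image_subset => x [Bx cx]; split=> //; exact: BA.
- by move=> x [].
- by exists p.
Qed.

Lemma chart_inj M (c : @chart R M) p q : is_chart c -> dom c p -> dom c q ->
  c p = c q -> p = q.
Proof. by move=> [_ ci _ _] cp cq; apply: ci; exact: mem_set. Qed.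

Lemma local_rep_dom M N c d (g : M -> N) p f :
  @local_rep R M N c d g p f -> [/\ dom c p, dom d (g p) & d (g p) = f (c p)].
Proof. exact: nbhs_singleton. Qed.

Lemma local_rep_uniq M N (c : @chart R M) (d : @chart R N) (g : M -> N) p f f' :
  is_chart c -> local_rep c d g p f -> local_rep c d g p f' ->
  \forall y \near c p, f y = f' y.
Proof.
move=> cc fr fr'; have [cp _ _] := local_rep_dom fr.
have := chart_open cc cp (nbhsI fr fr').
apply: filterS => y [x [[[_ _ h1] [_ _ h2]] cx] <-].
by rewrite -h1 -h2.
Qed.

Lemma local_rep_cont M N (c : @chart R M) (d : @chart R N) (g : M -> N) p f :
  is_chart c -> is_chart d -> local_rep c d g p f -> {for c p, continuous f} ->
  {for p, continuous g}.
Proof.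
move=> cc dd fr fc A Ag; have [cp dgp E] := local_rep_dom fr.
have cA := chart_open dd dgp Ag; rewrite E in cA.
have ccp := chart_cont cc cp.
have h : nbhs p [set x | (d @` (A `&` dom d)) (f (c x))] := ccp _ (fc _ cA).
have := nbhsI fr h; apply: filterS => x [[cx dgx Ex] [z [Az dz] zx]].
have gz : g x = z by apply: (chart_inj dd) => //; rewrite zx Ex.
by rewrite -gz in Az.
Qed.

Lemma local_rep_comp M N L (c : @chart R M) (d : @chart R N) (e : @chart R L)
    (g : M -> N) (h : N -> L) p f f' :
  {for p, continuous g} -> local_rep c d g p f -> local_rep d e h (g p) f' ->
  local_rep c e (h \o g) p (f' \o f).
Proof.
move=> gc fr /gc fr'; apply: (filterS _ (filterI fr fr')).
by move=> x [[cx dx h1] [_ ex h2]]; split=> //=; rewrite h2 h1.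
Qed.

Lemma analytic_in_cont M N (c : @chart R M) (d : @chart R N) (g : M -> N) p :
  is_chart c -> is_chart d -> analytic_in c d g p -> {for p, continuous g}.
Proof. by move=> cc dd [f fr /analytic_continuous]; exact: local_rep_cont fr. Qed.

Lemma analytic_in_comp M N L (c : @chart R M) (d : @chart R N) (e : @chart R L)
    (g : M -> N) (h : N -> L) p : is_chart c -> is_chart d ->
  analytic_in c d g p -> analytic_in d e h (g p) -> analytic_in c e (h \o g) p.
Proof.
move=> cc dd cg [f' fr' fa']; have gc := analytic_in_cont cc dd cg.
have [f fr fa] := cg; exists (f' \o f); first exact: local_rep_comp fr fr'.
by apply: analytic_comp => //; have [_ _ <-] := local_rep_dom fr.
Qed.

(** Transition maps inside the two atlases carry analyticity from one pair of charts around a point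
    to every other pair. *)
Lemma analytic_map_in M N (A : atlas M) (B : atlas N) (g : M -> N) :
  is_atlas A -> is_atlas B ->
  (forall p, exists c d, [/\ A c, B d & @analytic_in R M N c d g p]) ->
  analytic_map A B g.
Proof.
move=> [Ac _ Aa] [Bc _ Bb] h p c d cA dB cp dp.
have [c' [d' [c'A d'B gp]]] := h p.
have [f fr _] := gp; have [c'p d'p _] := local_rep_dom fr.
have h1 := analytic_in_comp (Ac _ cA) (Ac _ c'A) (Aa _ _ cA c'A p cp c'p).1 gp.
exact: analytic_in_comp (Ac _ cA) (Bc _ d'B) h1 (Bb _ _ d'B dB _ d'p dp).1.
Qed.

Lemma maximal_compatible M (A : @atlas R M) c d : is_atlas A ->
  maximal_atlas A c -> maximal_atlas A d -> compatible c d.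
Proof.
move=> [Ac Acov _] [cc cA] [dd dA] p cp dp.
have [a aA ap] := Acov p.
have [ca ac] := cA _ aA p cp ap; have [da ad] := dA _ aA p dp ap.
by split; [exact: analytic_in_comp cc (Ac _ aA) ca ad|
  exact: analytic_in_comp dd (Ac _ aA) da ac].
Qed.

Lemma prod_is_chart M N (c : @chart R M) (d : @chart R N) :
  is_chart c -> is_chart d -> is_chart (prod_chart c d).
Proof.
move=> cc dd; have [co ci cc' cU] := cc; have [dO di dc dU] := dd; split.
- rewrite openE => -[x y] [/= cx dy].
  by exists (dom c, dom d); [split; exact: chart_nbhs|case].
- move=> [x y] [x' y'] /set_mem[/= cx dy] /set_mem[/= cx' dy'] [h1 h2].
  by rewrite (chart_inj cc cx cx' h1) (chart_inj dd dy dy' h2).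
- move=> [x y] /set_mem[/= cx dy] A [[A1 A2] /= [h1 h2] hA].
  exists (c @^-1` A1, d @^-1` A2) => /=.
    by split; [exact: (chart_cont cc cx)|exact: (chart_cont dd dy)].
  by move=> [u v] [/= hu hv]; exact: (hA (c u, d v)).
- move=> U Uo UD; rewrite openE => _ [[x y] Uxy <-].
  have [/= cx dy] := UD _ Uxy.
  have [[A1 A2] /= [h1 h2] hA] : nbhs (x, y) U by exact: open_nbhs_nbhs.
  exists (c @` (A1 `&` dom c), d @` (A2 `&` dom d)) => /=.
    by split; exact: chart_open.
  move=> [u v] [/= [a [A1a ca] <-] [b [A2b db] <-]].
  by exists (a, b) => //; apply: hA.
Qed.

Lemma analytic_in_prod M N M' N' (c : @chart R M) (d : @chart R N)
    (c' : @chart R M') (d' : @chart R N') (g : M -> M') (h : N -> N') p q :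
  analytic_in c c' g p -> analytic_in d d' h q ->
  analytic_in (prod_chart c d) (prod_chart c' d') (fun x => (g x.1, h x.2)) (p, q).
Proof.
move=> [f fr fa] [f' fr' fa'].
exists (fun y => (f y.1, f' y.2)).
  exists ([set x | [/\ dom c x, dom c' (g x) & c' (g x) = f (c x)]],
          [set x | [/\ dom d x, dom d' (h x) & d' (h x) = f' (d x)]]) => //=.
  by move=> [x y] /= [[h1 h2 h3] [k1 k2 k3]]; split => //=; rewrite h3 k3.
apply: analytic_pair.
- by apply: (analytic_comp (f := fst)); [exact: analytic_fst|exact: fa].
- by apply: (analytic_comp (f := snd)); [exact: analytic_snd|exact: fa'].
Qed.

Lemma prod_is_atlas M N (A : @atlas R M) (B : @atlas R N) :
  is_atlas A -> is_atlas B -> is_atlas (prod_atlas A B).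
Proof.
move=> [Ac Acov Aa] [Bc Bcov Bb]; split.
- by move=> _ [c [d [cA dB ->]]]; apply: prod_is_chart; [exact: Ac|exact: Bc].
- move=> [p q]; have [c cA cp] := Acov p; have [d dB dq] := Bcov q.
  by exists (prod_chart c d) => //; exists c, d.
- move=> _ _ [c [d [cA dB ->]]] [c' [d' [c'A d'B ->]]] [p q] [/= cp dq] [/= c'p d'q].
  have [h1 h2] := Aa _ _ cA c'A p cp c'p; have [k1 k2] := Bb _ _ dB d'B q dq d'q.
  have E : id = (fun x : M * N => (x.1, x.2)) by apply/funext => -[].
  by rewrite E; split; exact: (@analytic_in_prod _ _ _ _ _ _ _ _ id id).
Qed.

End Charts.

(** * The differentiable structure of a submanifold *)

Section SubmanifoldAtlas.
Context {R : realType}.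

Lemma cs_val_linear (E : completeNormedModType R) (F : closed_subspace E) :
  linear (fun y : cs_type F => bs_val y).
Proof. by []. Qed.

Lemma cs_val_continuous (E : completeNormedModType R) (F : closed_subspace E) :
  continuous (fun y : cs_type F => bs_val y).
Proof.
apply: (@bounded_linear_continuousE _ _ _ _ 1); first exact: cs_val_linear.
by move=> y; rewrite mul1r.
Qed.

Lemma cs_valP (E : completeNormedModType R) (F : closed_subspace E) (y : cs_type F) :
  cs_set F (bs_val y).
Proof. exact: (bs_valS y). Qed.

Lemma cs_mem (E : completeNormedModType R) (F : closed_subspace E) y :
  cs_set F y -> y \in @bs_pred R E (banach_of_closed F).
Proof. by move=> Fy; rewrite unfold_in; exact: mem_set. Qed.

(** Addition from [F * F'] to [E] is a continuous linear bijection of Banach spaces; the open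
    mapping theorem bounds its inverse, whose first component is the projection. *)
Lemma complement_projection (E : completeNormedModType R) (F F' : closed_subspace E) :
  topological_complement F F' ->
  exists pi : E -> cs_type F,
    [/\ linear pi, continuous pi & forall y : cs_type F, pi (bs_val y) = y].
Proof.
move=> [FF' FS].
pose f (p : cs_type F * cs_type F') : E := bs_val p.1 + bs_val p.2.
have fl : linear f.
  move=> k [u1 u2] [v1 v2]; rewrite /f /=.
  by rewrite scalerDr addrACA.
have fc : continuous f.
  apply: (@bounded_linear_continuousE _ _ _ _ 2) => // -[u v].
  rewrite /f prod_normE /=; apply: le_trans (ler_normD _ _) _.
  rewrite -[`|bs_val u|]/(`|u|) -[`|bs_val v|]/(`|v|).
  have h1 : `|u| <= Num.max `|u| `|v| by rewrite le_max lexx.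
  have h2 : `|v| <= Num.max `|u| `|v| by rewrite le_max lexx orbT.
  lra.
have fs y : exists x, f x = y.
  have [u Fu Fv] := FS y.
  by exists (BsElem (cs_mem Fu), BsElem (cs_mem Fv)); rewrite /f /= addrC subrK.
have [C C0 fC] := open_mapping fl fc fs.
have fI p q : f p = f q -> p = q.
  case: p q => [u v] [u' v']; rewrite /f /= => h.
  have h' : bs_val u - bs_val u' = bs_val v' - bs_val v.
    apply/eqP; rewrite -subr_eq0; apply/eqP.
    transitivity (bs_val u + bs_val v - (bs_val u' + bs_val v')); first by zmod.
    by rewrite h subrr.
  have F1 : cs_set F (bs_val u - bs_val u') by exact: (cs_valP (u - u')).
  have F2 : cs_set F' (bs_val u - bs_val u') by rewrite h'; exact: (cs_valP (v' - v)).
  have : [set 0] (bs_val u - bs_val u') by rewrite -FF'; split.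
  move=> /= /eqP e1; have e2 := e1; rewrite h' in e2.
  move: e1 e2; rewrite !subr_eq0 => /eqP e1 /eqP e2.
  by congr (_, _); apply: val_inj.
have [g gP] := choice fs.
have gl : linear (fst \o g).
  move=> k x y /=.
  have -> : g (k *: x + y) = k *: g x + g y by apply: fI; rewrite fl !gP.
  by [].
exists (fst \o g); split=> //.
  apply: (bounded_linear_continuousE (C := C) gl) => y /=.
  have [x xy xC] := fC y; have -> : g y = x by apply: fI; rewrite gP.
  by apply: le_trans xC; rewrite prod_normE le_max lexx.
move=> y /=; have -> : g (bs_val y) = (y, 0) by apply: fI; rewrite gP /f /= addr0.
by [].
Qed.

Section Restrict.
Context {M : topologicalType} (A : @atlas R M) (N : set M).
Hypothesis aA : is_atlas A.

Lemma set_val_continuous : continuous (set_val : N -> M).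
Proof. exact: initial_continuous. Qed.

Lemma set_val_nbhs (x : N) B : nbhs (set_val x) B -> nbhs x ((set_val : N -> M) @^-1` B).
Proof. exact: set_val_continuous. Qed.

Lemma restrict_valE (c : chart M) (F : closed_subspace (model c)) (x : N) :
  adapted A N F -> dom c (set_val x) ->
  bs_val (restrict_chart N F x) = c (set_val x).
Proof.
move=> [_ _ cF] cx; rewrite /restrict_chart /=.
have : (F `&` c @` dom c) (c (set_val x)).
  by rewrite -cF; exists (set_val x) => //; split=> //; exact: set_valP.
by move=> [/cs_mem h _]; rewrite insubdK.
Qed.

Lemma restrict_is_chart (c : chart M) (F : closed_subspace (model c)) :
  adapted A N F -> is_chart (restrict_chart N F).
Proof.
move=> ad; have [[cc _] [F' FF'] cF] := ad.
have [co ci _ _] := cc.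
have [pi [pil pic piE]] := complement_projection FF'.
split.
- by apply: open_comp => // x _; exact: set_val_continuous.
- move=> x y /set_mem /= cx /set_mem /= cy /(congr1 (@bs_val _ _ _)).
  rewrite !(restrict_valE ad) // => h; apply: val_inj.
  exact: (chart_inj cc cx cy h).
- move=> x /set_mem /= cx.
  (* Near [x] the restricted chart coincides with [pi \o c], because [pi] fixes [F]; continuity is
     easier to see on this form than through [insubd]. *)
  have h : {for x, continuous (pi \o c \o (set_val : N -> M))}.
    apply: (@continuous_comp _ _ _ (set_val : N -> M) (pi \o c)).
      exact: set_val_continuous.
    by apply: continuous_comp; [exact: chart_cont|exact: pic].
  have E : \forall y \near x, (pi \o c \o set_val) y = restrict_chart N F y.
    have := set_val_nbhs (chart_nbhs cc cx); apply: filterS => y /= cy.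
    by rewrite -[RHS]piE (restrict_valE ad).
  have Ex := nbhs_singleton E; move=> B hB0.
  have := h B; rewrite Ex => /(_ hB0) hB.
  by have := nbhsI E hB; apply: filterS => y [/= <-].
- move=> U Uo UD; rewrite openE => _ [x Ux <-].
  have /= cx := UD _ Ux.
  have : nbhs x U by exact: open_nbhs_nbhs.
  move=> [_ [[Q Qo <-] /= Qx] QU].
  have Qn : nbhs (set_val x) Q by exact: open_nbhs_nbhs.
  have hQ := chart_open cc cx Qn; rewrite -(restrict_valE ad cx) in hQ.
  suff : nbhs (restrict_chart N F x) (restrict_chart N F @` U) by [].
  have : nbhs (restrict_chart N F x)
      ((fun y : cs_type F => bs_val y) @^-1` (c @` (Q `&` dom c))).
    exact: cs_val_continuous hQ.
  apply: filterS => y /= [m [Qm cm] my].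
  (* Adaptedness provides a point of [N] with the same coordinate; injectivity of [c] identifies it
     with [m]. *)
  have : (c @` (dom c `&` N)) (bs_val y).
    by rewrite cF; split; [exact: cs_valP|exists m].
  move=> [m' [cm' Nm'] m'y].
  have mm : m' = m by apply: (chart_inj cc) => //; rewrite m'y my.
  rewrite mm in Nm'.
  exists (SigSub (mem_set Nm')); first exact: QU.
  by apply: val_inj => /=; rewrite -my -[LHS]/(bs_val (restrict_chart N F _)) (restrict_valE ad).
Qed.

Lemma restrict_inclusion_rep (c : chart M) (F : closed_subspace (model c)) x :
  adapted A N F -> dom c (set_val x) ->
  local_rep (restrict_chart N F) c (set_val : N -> M) x
    (fun y : cs_type F => bs_val y).
Proof.
move=> ad cx; have [[cc _] _ _] := ad.
have := set_val_nbhs (chart_nbhs cc cx); apply: filterS => y /= cy.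
split=> //; exact: esym (restrict_valE ad cy).
Qed.

Lemma restrict_inclusion_analytic (c : chart M) (F : closed_subspace (model c)) x :
  adapted A N F -> dom c (set_val x) ->
  analytic_in (restrict_chart N F) c (set_val : N -> M) x.
Proof.
move=> ad cx; exists (fun y : cs_type F => bs_val y).
  exact: restrict_inclusion_rep.
by apply: analytic_linear; [exact: cs_val_linear|exact: cs_val_continuous].
Qed.

(** Composing with the continuous projection onto [F] corestricts the local representative. Hence
    analyticity of a map into [N] can be checked in [M], which is how the orbit maps and the action
    are treated. *)
Lemma analytic_in_restrict (c : chart M) (F : closed_subspace (model c))
    (L : topologicalType) (b : chart L) (g : L -> N) q :
  adapted A N F -> analytic_in b c (set_val \o g) q ->
  analytic_in b (restrict_chart N F) g q.
Proof.
move=> ad [f fr fa]; have [_ [F' FF'] _] := ad.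
have [pi [pil pic piE]] := complement_projection FF'.
exists (pi \o f).
  apply: filterS fr => x [bx cx E]; split=> //=.
  by rewrite -E -[LHS]piE -[insubd _ _]/(restrict_chart N F _) (restrict_valE ad).
by apply: analytic_comp => //; exact: analytic_linear.
Qed.

Hypothesis sN : submanifold A N.

Lemma submanifold_is_atlas : is_atlas (submanifold_atlas A N).
Proof.
have key (c c' : chart M) (F : closed_subspace (model c)) (F' : closed_subspace (model c')) p :
    adapted A N F -> adapted A N F' -> dom c (set_val p) -> dom c' (set_val p) ->
    analytic_in (restrict_chart N F) (restrict_chart N F') (id : N -> N) p.
  move=> ad ad' cp c'p; have [cm _ _] := ad; have [cm' _ _] := ad'.
  apply: (analytic_in_restrict ad').
  have [] := maximal_compatible aA cm cm' cp c'p => h _.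
  apply: (analytic_in_comp _ _ (restrict_inclusion_analytic ad cp) h).
    exact: restrict_is_chart.
  by case: cm.
split.
- by move=> _ [c [F [ad ->]]]; exact: restrict_is_chart.
- move=> p; have [c [F [ad cp]]] := sN (set_valP p).
  by exists (restrict_chart N F) => //; exists c, F.
- move=> _ _ [c [F [ad ->]]] [c' [F' [ad' ->]]] p /= cp c'p.
  by split; exact: key.
Qed.

Lemma submanifold_inclusion_analytic :
  analytic_map (submanifold_atlas A N) A (set_val : N -> M).
Proof.
have [Ac _ _] := aA.
move=> p _ d [c [F [ad ->]]] dA /= cp dp.
have [[cc cA] _ _] := ad.
exact: (analytic_in_comp (restrict_is_chart ad) cc (restrict_inclusion_analytic ad cp)
  (cA _ dA _ cp dp).1).
Qed.

Lemma analytic_map_submanifold (L : topologicalType) (B : atlas L) (g : L -> N) :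
  is_atlas B -> analytic_map B A (set_val \o g) ->
  analytic_map B (submanifold_atlas A N) g.
Proof.
move=> [Bc _ _] ag p b _ bB [c [F [ad ->]]] bp /= cp.
have [Ac Acov _] := aA; have [[cc cA] _ _] := ad.
have [a aA' ap] := Acov (set_val (g p)).
apply: (analytic_in_restrict ad).
exact: (analytic_in_comp (Bc _ bB) (Ac _ aA') (ag p b a bB aA' bp ap)
  (cA _ aA' _ cp ap).2).
Qed.

End Restrict.
End SubmanifoldAtlas.

(** * Hilbert space geometry and dimension *)

Section HilbertGeometry.
Context {R : realType} {H : hilbertType R}.
Implicit Types (x y z u v : H) (W V : set H) (A B : H -> H).

(** Norms in [H] take values in [R[i]]; the real version makes the order of [R] and its decision
    procedures available. *)
Definition hn x : R := complex.Re `|x|.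

Lemma hnE x : `|x| = (hn x)%:C%C.
Proof. by rewrite /hn RRe_real // ger0_real. Qed.

Lemma hn_ge0 x : 0 <= hn x.
Proof. by rewrite -ler0c -hnE. Qed.

Lemma hnD x y : hn (x + y) <= hn x + hn y.
Proof. by rewrite -lecR rmorphD /= -!hnE ler_normD. Qed.

Lemma hnN x : hn (- x) = hn x.
Proof. by rewrite /hn normrN. Qed.

Lemma hnB x y : hn (x - y) <= hn x + hn y.
Proof. by rewrite -(hnN y) hnD. Qed.

Lemma hnC x y : hn (x - y) = hn (y - x).
Proof. by rewrite -hnN opprB. Qed.

Lemma hn0 : hn 0 = 0.
Proof. by rewrite /hn normr0. Qed.

Lemma hn_eq0 x : (hn x == 0) = (x == 0).
Proof. by rewrite -[RHS]normr_eq0 hnE -[0 in RHS]/(0%:C)%C (inj_eq (@complexI _)). Qed.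

Lemma hn_gt0 x : (0 < hn x) = (x != 0).
Proof. by rewrite lt_def hn_ge0 andbT hn_eq0. Qed.

Lemma hnZ (a : R[i]) x : hn (a *: x) = complex.Re `|a| * hn x.
Proof.
have ha : (complex.Re `|a|)%:C%C = `|a| by rewrite RRe_real // ger0_real.
by apply: (@complexI R); rewrite -hnE normrZ hnE -{1}ha rmorphM.
Qed.

Lemma hnZr (a : R) x : hn (a%:C%C *: x) = `|a| * hn x.
Proof. by rewrite hnZ normc_def /= expr0n addr0 sqrtr_sqr. Qed.

Lemma dotDl x y z : hdot (x + y) z = hdot x z + hdot y z.
Proof. exact: linearDl. Qed.
Lemma dotZl (a : R[i]) x z : hdot (a *: x) z = a * hdot x z.
Proof. exact: linearZl_LR. Qed.
Lemma dotDr x y z : hdot z (x + y) = hdot z x + hdot z y.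
Proof. exact: linearDr. Qed.
Lemma dotNl x y : hdot (- x) y = - hdot x y.
Proof. exact: linearNl. Qed.
Lemma dotNr x y : hdot y (- x) = - hdot y x.
Proof. exact: linearNr. Qed.
Lemma dotBl x y z : hdot (x - y) z = hdot x z - hdot y z.
Proof. by rewrite dotDl dotNl. Qed.
Lemma dot0l x : hdot 0 x = 0. Proof. exact: linear0l. Qed.
Lemma dot0r x : hdot x 0 = 0. Proof. exact: linear0r. Qed.

Lemma dotC x y : hdot x y = (hdot y x)^*.
Proof. by rewrite hermC /= expr0 mul1r. Qed.

Lemma dotZr (a : R[i]) x z : hdot z (a *: x) = a^* * hdot z x.
Proof. by rewrite dotC dotZl rmorphM /= -dotC. Qed.

Lemma dot_sym0 x y : hdot x y = 0 -> hdot y x = 0.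
Proof. by move=> h; rewrite dotC h conjC0. Qed.

Lemma dotxx x : hdot x x = ((hn x) ^+ 2)%:C%C.
Proof. by rewrite -hdotE hnE rmorphXn. Qed.

Lemma dotxx_eq0 x : (hdot x x == 0) = (x == 0).
Proof.
by rewrite dotxx -[0]/(0%:C)%C (inj_eq (@complexI _)) expf_eq0 /= hn_eq0.
Qed.

Lemma pythagoras x y : hdot x y = 0 -> hn (x + y) ^+ 2 = hn x ^+ 2 + hn y ^+ 2.
Proof.
move=> xy; apply: (@complexI R); rewrite rmorphD /= -!dotxx.
by rewrite dotDl !dotDr xy (dot_sym0 xy) addr0 add0r.
Qed.

Lemma orth_le x y : hdot x y = 0 -> hn x <= hn (x + y).
Proof.
move=> /pythagoras h; rewrite -(@ler_pXn2r _ 2) // ?nnegrE ?hn_ge0 // h.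
by rewrite lerDl sqr_ge0.
Qed.

Lemma parallelogram x y :
  hn (x + y) ^+ 2 + hn (x - y) ^+ 2 = 2 * (hn x ^+ 2 + hn y ^+ 2).
Proof.
apply: (@complexI R); rewrite rmorphM rmorph_nat !rmorphD /= -!dotxx.
by rewrite !dotDl !dotDr !dotNl !dotNr opprK; ring.
Qed.

Definition subspace W := W 0 /\ forall (a : R[i]) x y, W x -> W y -> W (a *: x + y).

Lemma subspaceD W x y : subspace W -> W x -> W y -> W (x + y).
Proof. by move=> [_ h] Wx Wy; rewrite -[x]scale1r; exact: h. Qed.
Lemma subspaceZ W (a : R[i]) x : subspace W -> W x -> W (a *: x).
Proof. by move=> [h0 h] Wx; rewrite -[_ *: _]addr0; exact: h. Qed.
Lemma subspaceN W x : subspace W -> W x -> W (- x).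
Proof. by move=> sW Wx; rewrite -scaleN1r; exact: subspaceZ. Qed.
Lemma subspaceB W x y : subspace W -> W x -> W y -> W (x - y).
Proof. by move=> sW Wx Wy; apply: subspaceD => //; exact: subspaceN. Qed.

Lemma nbhs_hn x (B : set H) :
  nbhs x B <-> exists2 e : R, 0 < e & forall y, hn (x - y) < e -> B y.
Proof.
split=> [/nbhs_ballP[e /= e0 eB]|[e e0 eB]].
  have er : (complex.Re e)%:C%C = e by rewrite RRe_real // ger0_real // ltW.
  exists (complex.Re e); first by rewrite -ltcR er.
  by move=> y xy; apply: eB; rewrite -ball_normE /= hnE -er ltcR.
apply/nbhs_ballP; exists (e%:C)%C; first by rewrite /= ltcR.
by move=> y; rewrite -ball_normE /= hnE ltcR; exact: eB.
Qed.

Lemma closed_hn W : closed W <->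
  forall x, (forall e : R, 0 < e -> exists2 w, W w & hn (x - w) < e) -> W x.
Proof.
split=> [Wc x h|h].
  apply: Wc => B /nbhs_hn[e e0 eB]; have [w Ww xw] := h e e0.
  by exists w; split=> //; exact: eB.
move=> x clx; apply: h => e e0.
have /clx[w [Ww wx]] : nbhs x [set y | hn (x - y) < e] by apply/nbhs_hn; exists e.
by exists w.
Qed.

Lemma hcomplete (u : nat -> H) :
  (forall e : R, 0 < e -> exists N, forall m n, (N <= m)%N -> (N <= n)%N ->
     hn (u m - u n) < e) ->
  exists l, forall e : R, 0 < e -> exists N, forall n, (N <= n)%N -> hn (l - u n) < e.
Proof.
move=> uc.
have /cauchy_cvg/cvg_ex[l ul] : cauchy (u @ \oo).
  apply/cauchyP => e e0.
  have er : (complex.Re e)%:C%C = e by rewrite RRe_real // ger0_real // ltW.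
  have /uc[N NP] : 0 < complex.Re e by rewrite -ltcR er.
  exists (u N); exists N => // n /= Nn.
  by rewrite -ball_normE /= hnE -er ltcR; exact: NP.
exists l => e e0.
have /ul [N _ NP] : nbhs l [set y | hn (l - y) < e] by apply/nbhs_hn; exists e.
by exists N => n /NP.
Qed.

Lemma natSinv_lt (e : R) : 0 < e -> exists N, forall n, (N <= n)%N -> n.+1%:R^-1 < e.
Proof.
move=> e0; have [N _ NP] := near_infty_natSinv_lt (PosNum e0).
by exists N => n Nn; exact: NP.
Qed.

Lemma half_scale x : x = (2^-1 : R)%:C%C *: x + (2^-1 : R)%:C%C *: x.
Proof.
rewrite -scalerDl -rmorphD /=.
by rewrite [X in (X%:C)%C](_ : _ = 1) ?scale1r //; lra.
Qed.

(** If [x - y] had a component along some [z] in [W], moving [y] by it would bring [y] strictly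
    closer to [x], by Pythagoras. *)
Lemma orth_of_min W x y : subspace W -> W y ->
  (forall w, W w -> hn (x - y) <= hn (x - w)) -> orthc W (x - y).
Proof.
move=> sW Wy ymin z Wz.
have [->|z0] := eqVneq z 0; first by rewrite dot0r.
pose a := hdot (x - y) z / hdot z z.
have h0 : hdot (x - y - a *: z) (a *: z) = 0.
  rewrite dotZr dotBl dotZl divfK ?dotxx_eq0 //.
  by rewrite subrr mulr0.
have h1 : hn (x - y) ^+ 2 = hn (x - y - a *: z) ^+ 2 + hn (a *: z) ^+ 2.
  by rewrite -(pythagoras h0) subrK.
have h2 : hn (x - y) <= hn (x - y - a *: z).
  rewrite -addrA -opprD; apply: ymin.
  by apply: subspaceD => //; exact: subspaceZ.
have h3 : hn (a *: z) ^+ 2 <= 0.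
  have := hn_ge0 (x - y); nra.
have : hn (a *: z) == 0.
  by have := hn_ge0 (a *: z); rewrite le_eqVlt => /orP[/eqP <-//|]; nra.
rewrite hn_eq0 scaler_eq0 (negbTE z0) orbF mulf_eq0 invr_eq0 dotxx_eq0 (negbTE z0).
by rewrite orbF => /eqP.
Qed.

Theorem projection W x : subspace W -> closed W -> exists2 y, W y & orthc W (x - y).
Proof.
move=> sW cW.
pose D := [set hn (x - w) | w in W].
have D0 : D !=set0 by exists (hn (x - 0)), 0 => //; case: sW.
have Dlb : has_lbound D by exists 0 => _ [w _ <-]; exact: hn_ge0.
set d := inf D.
have dP w : W w -> d <= hn (x - w) by move=> Ww; apply: ge_inf => //; exists w.
have d0 : 0 <= d by apply: lb_le_inf => // _ [w _ <-]; exact: hn_ge0.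
have /choice[u uP] : forall n : nat, exists w, W w /\ hn (x - w) < d + n.+1%:R^-1.
  move=> n; have e0 : 0 < n.+1%:R^-1 :> R by rewrite invr_gt0.
  by have [_ [w Ww <-] wd] := inf_adherent e0 (conj D0 Dlb); exists w.
(* Parallelogram law: the midpoint of [u m] and [u n] lies in [W], so its distance to [x] is at
   least [d]. *)
have cauchy_u m n : hn (u m - u n) ^+ 2 <=
   2 * ((d + m.+1%:R^-1) ^+ 2 + (d + n.+1%:R^-1) ^+ 2) - 4 * d ^+ 2.
  have [Wm um] := uP m; have [Wn un] := uP n.
  pose c : R[i] := (2^-1 : R)%:C%C.
  have Wmid : W (c *: (u m + u n)) by apply: subspaceZ => //; exact: subspaceD.
  have := dP _ Wmid.
  have -> : x - c *: (u m + u n) = c *: ((x - u m) + (x - u n)).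
    by rewrite {1}(half_scale x) -/c !scalerDr !scalerN opprD addrACA.
  rewrite /c hnZr ger0_norm ?invr_ge0 //.
  have -> : u m - u n = (x - u n) - (x - u m) by zmod.
  have := parallelogram (x - u n) (x - u m).
  rewrite [x - u n + (x - u m)]addrC.
  move=> h1 h2; have g1 := hn_ge0 (x - u m); have g2 := hn_ge0 (x - u n).
  have sq (a b : R) : 0 <= a -> a <= b -> a ^+ 2 <= b ^+ 2.
    by move=> a0 ab; apply: lerXn2r => //; rewrite nnegrE //; exact: le_trans ab.
  have i1 : 0 < m.+1%:R^-1 :> R by rewrite invr_gt0.
  have i2 : 0 < n.+1%:R^-1 :> R by rewrite invr_gt0.
  have g3 := hn_ge0 (x - u m + (x - u n)).
  move: um un i1 i2; set a := m.+1%:R^-1; set b := n.+1%:R^-1 => um un i1 i2.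
  have e1 : hn (x - u m) ^+ 2 <= (d + a) ^+ 2 by apply: sq; lra.
  have e2 : hn (x - u n) ^+ 2 <= (d + b) ^+ 2 by apply: sq; lra.
  have e3 : (2 * d) ^+ 2 <= hn (x - u m + (x - u n)) ^+ 2 by apply: sq; lra.
  by rewrite exprMn in e3; lra.
have [y uy] : exists l, forall e : R, 0 < e -> exists N, forall n, (N <= n)%N -> hn (l - u n) < e.
  apply: hcomplete => e e0.
  (* For [a, b] below 1 and below some [t], the bound of [cauchy_u] is at most
     [(4 * d + 2) * (a + b) < (8 * d + 4) * t], hence below [e ^+ 2] for the chosen [t]. *)
  have [N NP] : exists N, forall n, (N <= n)%N -> n.+1%:R^-1 < Num.min 1 (e ^+ 2 / (8 * d + 5)).
    by apply: natSinv_lt; rewrite lt_min ltr01 divr_gt0 ?exprn_gt0 //; lra.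
  exists N => m n /NP + /NP; have := cauchy_u m n.
  set a := _^-1; set b := _^-1; rewrite !lt_min => hmn /andP[a1 a2] /andP[b1 b2].
  have a0 : 0 < a by rewrite invr_gt0.
  have b0 : 0 < b by rewrite invr_gt0.
  rewrite ltNge; apply/negP => /(lerXn2r 2)-/(_ (ltW e0) (hn_ge0 _)) eh.
  rewrite ltr_pdivlMr in a2; last by lra.
  rewrite ltr_pdivlMr in b2; last by lra.
  nra.
have Wy : W y.
  have /closed_hn cW' := cW; apply: cW' => e /uy[N NP].
  by exists (u N); [have [] := uP N|exact: NP].
exists y => //; apply: orth_of_min => // w Ww.
apply: (le_trans _ (dP _ Ww)); apply/ler_addgt0Pl => e e0.
have e2 : 0 < e / 2 by rewrite divr_gt0.
have [N NP] := uy _ e2; have [M MP] := natSinv_lt e2.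
pose n := maxn N M; have [Wn un] := uP n.
have := NP n (leq_maxl _ _); move: un (MP n (leq_maxr _ _)).
set a := n.+1%:R^-1 => un an.
have := hnD (x - u n) (u n - y); rewrite addrA subrK [hn (u n - y)]hnC.
lra.
Qed.

End HilbertGeometry.

Section HilbertOperators.
Context {R : realType} {H : hilbertType R}.
Implicit Types (x y z u v : H) (W V : set H) (A B L : H -> H).

Lemma cauchy_schwarz x y : complex.Re `|hdot x y| <= hn x * hn y.
Proof.
have [->|y0] := eqVneq y 0; first by rewrite dot0r normr0 hn0 mulr0.
have ny : 0 < hn y by rewrite hn_gt0.
pose a := hdot x y / hdot y y.
have h0 : hdot (a *: y) (x - a *: y) = 0.
  rewrite dotZl (_ : hdot y _ = 0) ?mulr0 //; apply: dot_sym0.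
  by rewrite dotBl dotZl divfK ?dotxx_eq0 // subrr.
have := orth_le h0; rewrite addrC subrK hnZ => h1.
have -> : complex.Re `|hdot x y| = complex.Re `|a| * hn y * hn y.
  have -> : hdot x y = a * hdot y y by rewrite divfK ?dotxx_eq0.
  rewrite dotxx -mulrA -expr2; apply: (@complexI R).
  have e (b : R[i]) : (complex.Re `|b|)%:C%C = `|b| by rewrite RRe_real // ger0_real.
  rewrite e normrM -{1}(e a) [X in _ * X]ger0_norm ?ler0c ?sqr_ge0 //.
  by rewrite -rmorphM.
by apply: ler_wpM2r => //; exact: hn_ge0.
Qed.

Lemma bounded_op_hnP A : bounded_op A <->
  linear A /\ exists2 C : R, 0 < C & forall x, hn (A x) <= C * hn x.
Proof.
split=> [[Al Ac]|[Al [C C0 AC]]]; split=> //.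
  have [C C0 AC] := continuous_linear_boundE Al Ac.
  have Cr : (complex.Re C)%:C%C = C by rewrite RRe_real // ger0_real // ltW.
  exists (complex.Re C); first by rewrite -ltcR Cr.
  by move=> x; rewrite -lecR rmorphM /= Cr -!hnE.
apply: (bounded_linear_continuousE (C := (C%:C)%C)) => // x.
by rewrite !hnE -rmorphM lecR.
Qed.

Section Linear.
Variable A : H -> H.
Hypothesis Ab : bounded_op A.
Lemma opD x y : A (x + y) = A x + A y.
Proof. by case: Ab => Al _; have := Al 1 x y; rewrite !scale1r. Qed.
Lemma op0 : A 0 = 0.
Proof. by have := opD 0 0; rewrite addr0 -{1}[A 0]addr0 => /addrI/esym. Qed.
Lemma opZ (a : R[i]) x : A (a *: x) = a *: A x.
Proof. by case: Ab => Al _; have := Al a x 0; rewrite op0 !addr0. Qed.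
Lemma opN x : A (- x) = - A x.
Proof. by rewrite -scaleN1r opZ scaleN1r. Qed.
Lemma opB x y : A (x - y) = A x - A y.
Proof. by rewrite opD opN. Qed.

Lemma nullspace_subspace : subspace (nullspace A).
Proof.
by split=> [|a x y]; rewrite /nullspace /= ?op0 // opD opZ => -> ->; rewrite scaler0 addr0.
Qed.

Lemma nullspace_closed : closed (nullspace A).
Proof.
have /bounded_op_hnP[_ [C C0 AC]] := Ab.
apply/closed_hn => x h; apply/eqP; rewrite -hn_eq0 eq_le hn_ge0 andbT.
apply/ler_addgt0Pl => e e0; rewrite addr0.
have [w Aw xw] := h (e / C) (divr_gt0 e0 C0).
rewrite -[A x]subr0 -[X in A x - X](Aw : A w = 0) -opB.
by apply: le_trans (AC _) _; rewrite mulrC -ler_pdivlMr // ltW.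
Qed.

Lemma image_subspace W : subspace W -> subspace (A @` W).
Proof.
move=> [W0 WP]; split; first by exists 0 => //; exact: op0.
by move=> a _ _ [x Wx <-] [y Wy <-]; exists (a *: x + y); [exact: WP|rewrite opD opZ].
Qed.

Lemma range_subspace : subspace (range A).
Proof. by apply: image_subspace. Qed.

Lemma image_closed W (c : R) : subspace W -> closed W -> 0 < c ->
  (forall x, W x -> c * hn x <= hn (A x)) -> closed (A @` W).
Proof.
move=> sW cW c0 Ac; apply/closed_hn => y h.
have /choice[u uP] : forall n : nat, exists w, W w /\ hn (y - A w) < n.+1%:R^-1.
  move=> n; have e0 : 0 < n.+1%:R^-1 :> R by rewrite invr_gt0.
  by have [_ [w Ww <-] wd] := h _ e0; exists w.
have [l ul] : exists l, forall e : R, 0 < e -> exists N, forall n, (N <= n)%N -> hn (l - u n) < e.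
  apply: hcomplete => e e0.
  have [N NP] := natSinv_lt (divr_gt0 (mulr_gt0 c0 e0) (ltr0n _ 2)).
  exists N => m n /NP + /NP; have [Wm +] := uP m; have [Wn +] := uP n.
  set a := _^-1; set b := _^-1 => h1 h2 h3 h4.
  have := Ac _ (subspaceB sW Wm Wn); rewrite opB.
  have := hnB (y - A (u n)) (y - A (u m)).
  rewrite (_ : _ - _ = A (u m) - A (u n)); last by zmod.
  move=> h5 h6; rewrite -(ltr_pM2l c0); lra.
have Wl : W l.
  have /closed_hn cW' := cW; apply: cW' => e /ul[N NP].
  by exists (u N); [have [] := uP N|exact: NP].
exists l => //; apply/eqP; rewrite -subr_eq0 -hn_eq0 eq_le hn_ge0 andbT.
apply/ler_addgt0Pl => e e0; rewrite addr0.
have /bounded_op_hnP[_ [C C0 AC]] := Ab.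
have e2 : 0 < e / 2 by rewrite divr_gt0.
have [N NP] := ul _ (divr_gt0 e2 C0); have [M MP] := natSinv_lt e2.
pose n := maxn N M; have [Wn] := uP n.
have := NP n (leq_maxl _ _); move: (MP n (leq_maxr _ _)).
set a := n.+1%:R^-1 => an; rewrite ltr_pdivlMr // => ln un.
have := AC (l - u n); rewrite opB.
have := hnB (A l - A (u n)) (y - A (u n)).
rewrite (_ : A l - _ - _ = A l - y); last by zmod.
lra.
Qed.

End Linear.

Lemma subspaceI W V : subspace W -> subspace V -> subspace (W `&` V).
Proof.
move=> [W0 WP] [V0 VP]; split=> // a x y [Wx Vx] [Wy Vy].
by split; [exact: WP|exact: VP].
Qed.

Lemma orthc_subspace W : subspace (orthc W).
Proof.
split=> [y _|a x y hx hy z Wz]; first by rewrite dot0l.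
by rewrite dotDl dotZl hx // hy // mulr0 addr0.
Qed.

Lemma orthc_closed W : closed (orthc W).
Proof.
apply/closed_hn => x h y Wy; apply/eqP; rewrite -normr_le0.
have er : (complex.Re `|hdot x y|)%:C%C = `|hdot x y| by rewrite RRe_real // ger0_real.
rewrite -er lecR; apply/ler_addgt0Pl => e e0; rewrite addr0.
have c0 : 0 < hn y + 1 by rewrite ltr_wpDl // hn_ge0.
have [w ow xw] := h (e / (hn y + 1)) (divr_gt0 e0 c0).
rewrite -[hdot x y]subr0 -(ow _ Wy) -dotBl.
apply: le_trans (cauchy_schwarz _ _) _.
rewrite ltr_pdivlMr // in xw.
by have := hn_ge0 (x - w); have := hn_ge0 y; nra.
Qed.

Lemma orthc_disjoint W x : W x -> orthc W x -> x = 0.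
Proof. by move=> Wx ox; apply/eqP; rewrite -dotxx_eq0 ox. Qed.

Section Orthproj.
Variable W : set H.
Hypotheses (sW : subspace W) (cW : closed W).

Lemma orthprojP x : W (orthproj W x) /\ orthc W (x - orthproj W x).
Proof.
rewrite /orthproj; case: xgetP => [y _ //|/=].
by have [y Wy xy] := projection x sW cW => /(_ y) [].
Qed.

Lemma orthproj_in x : W (orthproj W x). Proof. by have [] := orthprojP x. Qed.
Lemma orthproj_orth x : orthc W (x - orthproj W x). Proof. by have [] := orthprojP x. Qed.

Lemma orthproj_uniq x y : W y -> orthc W (x - y) -> orthproj W x = y.
Proof.
move=> Wy oy; apply/eqP; rewrite -subr_eq0; apply/eqP/(@orthc_disjoint W).
  by apply: subspaceB => //; exact: orthproj_in.
have -> : orthproj W x - y = (x - y) - (x - orthproj W x) by zmod.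
by apply: (subspaceB (orthc_subspace W)) => //; exact: orthproj_orth.
Qed.

Lemma orthproj_bounded : bounded_op (orthproj W).
Proof.
apply/bounded_op_hnP; split.
  move=> a x y; apply: orthproj_uniq.
    by case: sW => _ h; apply: h; exact: orthproj_in.
  have -> : a *: x + y - (a *: orthproj W x + orthproj W y) =
     a *: (x - orthproj W x) + (y - orthproj W y).
    by rewrite opprD addrACA scalerBr.
  by case: (orthc_subspace W) => _ h; apply: h; exact: orthproj_orth.
exists 1 => // x; rewrite mul1r -{2}[x](subrK (orthproj W x)) addrC.
by apply/orth_le/dot_sym0/orthproj_orth/orthproj_in.
Qed.

Lemma orthproj_id x : W x -> orthproj W x = x.
Proof. by move=> Wx; apply: orthproj_uniq => // y _; rewrite subrr dot0l. Qed.

Lemma orthproj_range : range (orthproj W) = W.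
Proof.
apply/seteqP; split=> [_ [x _ <-]|x Wx]; first exact: orthproj_in.
by exists x => //; exact: orthproj_id.
Qed.

Lemma orthproj_nullspace : nullspace (orthproj W) = orthc W.
Proof.
apply/seteqP; split=> x; rewrite /nullspace /=.
  by move=> h; have := orthproj_orth x; rewrite h subr0.
by move=> h; apply: orthproj_uniq; [case: sW|rewrite subr0].
Qed.

End Orthproj.

Definition has_indep W n := exists2 v : 'I_n -> H, (forall i, W (v i)) & lin_indep v.

(** A linear functional costs at most one dimension: a vector on which it does not vanish serves as
    pivot and is eliminated from the others. *)
Lemma has_indep_kernel W n (phi : H -> R[i]) : subspace W ->
  (forall (a : R[i]) x y, phi (a *: x + y) = a * phi x + phi y) ->
  has_indep W n.+1 -> has_indep (W `&` [set x | phi x = 0]) n.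
Proof.
move=> sW phil [v Wv vi].
have [h|/existsNP[j pj]] := pselect (forall i, phi (v i) = 0).
  exists (fun i => v (lift ord0 i)) => [i|a sa i].
    by split; [exact: Wv|exact: h].
  have := vi (fun k => if unlift ord0 k is Some i then a i else 0).
  rewrite big_ord_recl unlift_none scale0r add0r => /(_ _ (lift ord0 i)).
  rewrite liftK; apply; rewrite -[RHS]sa; apply: eq_bigr => k _; by rewrite liftK.
pose c i := - (phi (v (lift j i)) / phi (v j)).
exists (fun i => c i *: v j + v (lift j i)).
  move=> i; split; first by apply: subspaceD => //; exact: subspaceZ.
  by rewrite /= phil /c mulNr divfK ?addNr //; exact/eqP.
move=> a sa i.
have := vi (fun k => if unlift j k is Some i then a i else \sum_i a i * c i).
move=> /(_ _ (lift j i)); rewrite liftK; apply.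
rewrite (bigD1_ord j) //= unlift_none.
rewrite [X in _ + X](_ : _ = \sum_i a i *: v (lift j i)); last first.
  by apply: eq_bigr => k _; rewrite liftK.
rewrite scaler_suml -big_split /= -[RHS]sa; apply: eq_bigr => k _.
by rewrite scalerDr scalerA.
Qed.

Lemma has_indepW W n m : subspace W -> (m <= n)%N -> has_indep W n -> has_indep W m.
Proof.
move=> sW; elim: n => [|n IH]; first by rewrite leqn0 => /eqP ->.
rewrite leq_eqVlt => /orP[/eqP ->//|mn] hW; apply: IH => //.
have [|v Wv vi] := @has_indep_kernel W n (fun=> 0) sW _ hW.
  by move=> a x y; rewrite mulr0 addr0.
by exists v => // i; case: (Wv i).
Qed.

Lemma has_indep_cons W n x (phi : H -> R[i]) : subspace W ->
  (forall (a : R[i]) x y, phi (a *: x + y) = a * phi x + phi y) ->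
  W x -> phi x != 0 -> has_indep (W `&` [set x | phi x = 0]) n -> has_indep W n.+1.
Proof.
move=> sW phil Wx px [v Wv vi].
have phi0 : phi 0 = 0 by have := phil (-1) 0 0; rewrite scaler0 addr0 mulN1r addNr.
have phis (a : 'I_n -> R[i]) : phi (\sum_i a i *: v i) = 0.
  elim/big_ind: _ => // [y z hy hz|i _].
    by rewrite -[y]scale1r phil hy hz mulr0 addr0.
  by rewrite -[_ *: _]addr0 phil phi0 (Wv i).2 mulr0 addr0.
exists (fun i => if unlift ord0 i is Some k then v k else x).
  by move=> i; case: unliftP => // j _; case: (Wv j).
move=> a; rewrite big_ord_recl unlift_none.
under eq_bigr do rewrite liftK.
move=> h; have a0 : a ord0 = 0.
  have := congr1 phi h; rewrite phil phis phi0 addr0 => /eqP.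
  by rewrite mulf_eq0 (negbTE px) orbF => /eqP.
move: h; rewrite a0 scale0r add0r => /(vi (fun j => a (lift ord0 j))) av i.
by case: (unliftP ord0 i) => [j ->|->//]; exact: av.
Qed.

Lemma hdim_ge W n : has_indep W n -> ((n%:R : R)%:E <= hdim W)%E.
Proof. by move=> h; apply: ereal_sup_ubound; exists n. Qed.

Lemma has_indep0 W : has_indep W 0.
Proof. by exists (fun=> 0) => [[]|a _ []]. Qed.

Lemma hdim_le W n : subspace W -> ~ has_indep W n.+1 -> (hdim W <= (n%:R : R)%:E)%E.
Proof.
move=> sW h; apply: ge_ereal_sup => _ [m hm <-]; rewrite lee_fin ler_nat leqNgt.
by apply/negP => nm; apply: h; exact: has_indepW hm.
Qed.

Lemma hdim_eqP W n : subspace W ->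
  hdim W = (n%:R : R)%:E <-> has_indep W n /\ ~ has_indep W n.+1.
Proof.
move=> sW; split=> [h|[h1 h2]]; last first.
  by apply/eqP; rewrite eq_le hdim_le // hdim_ge.
split.
  apply: contrapT => h'; case: n h h' => [_ []|n h h']; first exact: has_indep0.
  by have := hdim_le sW h'; rewrite h lee_fin ler_nat ltnn.
by move=> /hdim_ge; rewrite h lee_fin ler_nat ltnn.
Qed.

Lemma hdim_geP W n : subspace W -> ((n%:R : R)%:E <= hdim W)%E -> has_indep W n.
Proof.
move=> sW h; apply: contrapT => h'; case: n h h' => [_ []|n h h']; first exact: has_indep0.
by have := le_trans h (hdim_le sW h'); rewrite lee_fin ler_nat ltnn.
Qed.

Lemma hdim_finite W n : subspace W -> ~ has_indep W n ->
  exists m, hdim W = (m%:R : R)%:E.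
Proof.
move=> sW; elim: n => [[]|n IH h]; first exact: has_indep0.
have [h'|/IH//] := pselect (has_indep W n).
by exists n; apply/hdim_eqP.
Qed.

Lemma subset_has_indep W V n : W `<=` V -> has_indep W n -> has_indep V n.
Proof. by move=> WV [v Wv vi]; exists v => // i; exact: WV. Qed.

Lemma has_indep_orthogonal W (s : seq H) n : subspace W -> has_indep W (size s + n) ->
  has_indep (W `&` [set x | forall y, y \in s -> hdot x y = 0]) n.
Proof.
elim: s W => [|y s IH] W sW h; first by apply: subset_has_indep h => x Wx.
have sW' : subspace (W `&` [set x | hdot x y = 0]).
  apply: subspaceI => //; split; first by rewrite /= dot0l.
  by move=> a u v /= hu hv; rewrite dotDl dotZl hu hv mulr0 addr0.
have : has_indep (W `&` [set x | hdot x y = 0]) (size s + n).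
  apply: has_indep_kernel h => // a u v; by rewrite dotDl dotZl.
move=> /(IH _ sW'); apply: subset_has_indep => x [[Wx xy] xs]; split=> // z.
by rewrite inE => /orP[/eqP ->//|]; exact: xs.
Qed.

Lemma normalize W x : subspace W -> W x -> x != 0 ->
  W ((hn x)^-1%:C%C *: x) /\ hn ((hn x)^-1%:C%C *: x) = 1.
Proof.
move=> sW Wx x0; split; first exact: subspaceZ.
by rewrite hnZr ger0_norm ?invr_ge0 ?hn_ge0 // mulVf // hn_eq0.
Qed.

End HilbertOperators.

(** * Riesz theory *)

Section CompactPerturbations.
Context {R : realType} {H : hilbertType R}.
Implicit Types (x y z u v : H) (W V : set H) (A B C L : H -> H).

(** Cluster points of the image filter replace convergent subsequences: each one is approached at
    arbitrarily large indices. *)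
Lemma compact_cluster C (e : nat -> H) : compact_op C -> (forall n, hn (e n) <= 1) ->
  exists z, forall (d : R) N, 0 < d -> exists2 n, (N <= n)%N & hn (z - C (e n)) < d.
Proof.
move=> [_]; rewrite precompactE => Cc e1.
have e1' n : `|e n| <= 1 by rewrite hnE -[1]/((1 : R)%:C)%C lecR.
have Fc : ((fun n => C (e n)) @ \oo) (closure (C @` [set x | `|x| <= 1])).
  by exists 0%N => // n _ /=; apply: subset_closure; exists (e n) => //=; exact: e1'.
have [z [_ zc]] := Cc ((fun n => C (e n)) @ \oo) _ Fc.
exists z => d N d0.
have h1 : ((fun n => C (e n)) @ \oo) [set y | exists2 n, (N <= n)%N & y = C (e n)].
  by exists N => // n /= Nn; exists n.
have h2 : nbhs z [set y | hn (z - y) < d] by apply/nbhs_hn; exists d.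
by have [y [[n Nn ->] zy]] := zc _ _ h1 h2; exists n.
Qed.

(** The contradiction that closes the Riesz arguments about strict chains and infinite-dimensional
    kernels. *)
Lemma compact_not_separated C (e : nat -> H) : compact_op C ->
  (forall n, hn (e n) <= 1) ->
  (forall m n, (m < n)%N -> 1 <= hn (C (e m) - C (e n))) -> False.
Proof.
move=> Cc e1 sep; have [z zP] := compact_cluster Cc e1.
have d0 : 0 < 2^-1 :> R by rewrite invr_gt0.
have [m _ zm] := zP _ 0%N d0; have [n mn zn] := zP _ m.+1 d0.
have := sep _ _ mn; have := hnB (z - C (e n)) (z - C (e m)).
rewrite (_ : z - _ - _ = C (e m) - C (e n)); last by zmod.
lra.
Qed.

Section Riesz.
Variable L : H -> H.
Hypotheses (Lb : bounded_op L) (Lc : compact_op (L - idfun)).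

Let CE x : (L - idfun) x = L x - x. Proof. by []. Qed.

(** Otherwise there are unit vectors [e n] in [W] with [L (e n)] tending to 0. A cluster point [z]
    of [(L - 1) (e n)] has some [e n] arbitrarily close to [- z], so [- z] is in [W] and in the
    kernel, hence 0, against the unit norms. *)
Lemma riesz_bounded_below W : subspace W -> closed W ->
  (forall x, W x -> L x = 0 -> x = 0) ->
  exists2 c : R, 0 < c & forall x, W x -> c * hn x <= hn (L x).
Proof.
move=> sW cW Li; apply: contrapT => no.
have /choice[e eP] : forall n : nat, exists x, [/\ W x, hn x = 1 & hn (L x) < n.+1%:R^-1].
  move=> n; have n0 : 0 < n.+1%:R^-1 :> R by rewrite invr_gt0.
  have [x [Wx /negP]] : exists x, W x /\ ~ (n.+1%:R^-1 * hn x <= hn (L x)).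
    apply: contrapT => h; apply: no; exists (n.+1%:R^-1) => // x Wx.
    by apply: contrapT => h'; apply: h; exists x.
  rewrite -ltNge => Lx.
  have x0 : x != 0.
    by apply/eqP => x0; move: Lx; rewrite x0 (op0 Lb) hn0 mulr0 ltxx.
  have [h1 h2] := normalize sW Wx x0; exists ((hn x)^-1%:C%C *: x); split=> //.
  rewrite (opZ Lb) hnZr ger0_norm ?invr_ge0 ?hn_ge0 // mulrC ltr_pdivrMr //.
  by rewrite hn_gt0.
have e1 n : hn (e n) <= 1 by have [_ -> _] := eP n.
have [z zP] := compact_cluster Lc e1.
have near (d : R) : 0 < d -> exists x, [/\ W x, hn x = 1, hn (L x) < d & hn (x + z) < d].
  move=> d0; have d2 : 0 < d / 2 by rewrite divr_gt0.
  have [N NP] := natSinv_lt d2; have [n /NP + zn] := zP _ N d2.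
  have [Wn n1 +] := eP n; set a := n.+1%:R^-1 => h1 h2.
  exists (e n); split=> //; first lra.
  have -> : e n + z = L (e n) + (z - (L - idfun) (e n)) by rewrite CE; zmod.
  by apply: le_lt_trans (hnD _ _) _; lra.
have Wz : W (- z).
  have /closed_hn cW' := cW; apply: cW' => d /near[x [Wx _ _ xz]]; exists x => //.
  by rewrite -hnN opprB opprK.
have Lz : L (- z) = 0.
  apply/eqP; rewrite -hn_eq0 eq_le hn_ge0 andbT; apply/ler_addgt0Pl => d d0.
  have /bounded_op_hnP[_ [K K0 LK]] := Lb.
  have K1 : 0 < K + 1 by rewrite ltr_wpDl // ltW.
  rewrite addr0; have [x [_ _ h1 h2]] := near _ (divr_gt0 d0 K1).
  have -> : - z = x - (x + z) by zmod.
  rewrite (opB Lb); apply: le_trans (hnB _ _) _.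
  move: h1 h2; rewrite !ltr_pdivlMr // => h1 h2.
  have := LK (x + z); have := hn_ge0 (x + z); have := hn_ge0 (L x); nra.
have := Li _ Wz Lz => /eqP; rewrite oppr_eq0 => /eqP z0.
have [x [_ x1 _]] := near 1 ltr01; rewrite z0 addr0 x1; lra.
Qed.

Lemma riesz_image_closed W : subspace W -> closed W ->
  (forall x, W x -> L x = 0 -> x = 0) -> closed (L @` W).
Proof.
move=> sW cW Li; have [c c0 cP] := riesz_bounded_below sW cW Li.
exact: image_closed cP.
Qed.

Lemma unit_orth W V x : subspace W -> subspace V -> closed V -> V `<=` W ->
  W x -> ~ V x -> exists y, [/\ W y, orthc V y & hn y = 1].
Proof.
move=> sW sV cV VW Wx Vx.
have [p Vp oxp] := projection x sV cV.
have y0 : x - p != 0 by rewrite subr_eq0; apply/eqP => xp; apply: Vx; rewrite xp.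
have Wy : W (x - p) by apply: subspaceB => //; exact: VW.
have [h1 h2] := normalize sW Wy y0; exists ((hn (x - p))^-1%:C%C *: (x - p)).
by split=> //; exact: (subspaceZ _ (orthc_subspace V) oxp).

Qed.

(** If [y] is missed, the closed subspaces [L ^ n W] decrease strictly, since [L] is injective on
    [W]. Unit vectors of each one orthogonal to the next have images under the compact [L - 1] at
    mutual distance at least 1. *)
Theorem riesz_surjective W : subspace W -> closed W ->
  (forall x, W x -> W (L x)) -> (forall x, W x -> L x = 0 -> x = 0) ->
  forall y, W y -> exists2 x, W x & L x = y.
Proof.
move=> sW cW LW Li y Wy; apply: contrapT => no.
pose X n := iter n (fun V => L @` V) W.
have XP n : [/\ subspace (X n), closed (X n) & X n `<=` W].
  elim: n => [|n [s c XW]]; first by split.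
  split=> /=.
  - exact: (image_subspace Lb s).
  - by apply: (riesz_image_closed s c) => x /XW; exact: Li.
  - by move=> _ [x /XW Wx <-]; exact: LW.
have XS n : X n.+1 `<=` X n.
  elim: n => [_ [x Wx <-]|n IH _ [x Xx <-]]; first exact: LW.
  by exists x => //; exact: IH.
have Xle m n : (m <= n)%N -> X n `<=` X m.
  elim: n => [|n IH]; first by rewrite leqn0 => /eqP ->.
  rewrite leq_eqVlt => /orP[/eqP ->//|mn] x /XS; exact: IH.
have Xy n : X n (iter n L y) /\ ~ X n.+1 (iter n L y).
  elim: n => [|n [IH1 IH2]].
    by split=> // -[x Wx xy]; apply: no; exists x.
  split; first by exists (iter n L y).
  move=> [x Xx /= xy]; apply: IH2.
  suff -> : iter n L y = x by [].
  apply/eqP; rewrite -subr_eq0; apply/eqP/Li.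
    apply: (subspaceB sW) => //; first by have [_ _] := XP n; apply.
    by have [_ _] := XP n.+1; apply.
  by rewrite (opB Lb) xy subrr.
have /choice[e eP] : forall n, exists z, [/\ X n z, orthc (X n.+1) z & hn z = 1].
  move=> n; have [s1 _ _] := XP n; have [s2 c2 _] := XP n.+1; have [h1 h2] := Xy n.
  exact: unit_orth s1 s2 c2 (@XS n) h1 h2.
apply: (compact_not_separated Lc (e := e)) => [n|m n mn].
  by have [_ _ ->] := eP n.
have [Xm om em] := eP m; have [Xn _ _] := eP n.
rewrite !CE hnC.
(* Apart from [e m], all terms lie in [X m.+1], to which [e m] is orthogonal. *)
have -> : L (e n) - e n - (L (e m) - e m) = e m + (L (e n) - e n - L (e m)) by zmod.
rewrite -em; apply: orth_le; apply: om.
have [s _ _] := XP m.+1.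
apply: (subspaceB s) => //; last by exists (e m).
apply: (subspaceB s) => //; last exact: (Xle _ _ mn).
by apply: (Xle m.+1 n.+1 (leqW mn)); exists (e n).
Qed.

(** Dual chain argument: with [L] onto, iterated preimages of a nonzero kernel vector make the
    nullspaces of the powers of [L] increase strictly. *)
Theorem riesz_injective : (forall y, exists x, L x = y) -> forall x, L x = 0 -> x = 0.
Proof.
move=> Ls x Lx; apply/eqP/negPn/negP => x0.
have Nb n : bounded_op (iter n L).
  by elim: n => [|n IH]; [exact: bounded_op_id|exact: (bounded_op_comp Lb IH)].
pose X n := nullspace (iter n L).
have XS n : X n `<=` X n.+1.
  by move=> y; rewrite /X /nullspace /= => ->; exact: op0.
have Xle m n : (m <= n)%N -> X m `<=` X n.
  elim: n => [|n IH]; first by rewrite leqn0 => /eqP ->.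
  rewrite leq_eqVlt => /orP[/eqP ->//|mn] y /(IH mn); exact: XS.
have LX n y : X n.+1 y -> X n (L y).
  by rewrite /X /nullspace /= -iterSr.
have Xx n : exists2 y, iter n L y = x & X n.+1 y /\ ~ X n y.
  suff [y yx] : exists y, iter n L y = x.
    exists y => //; rewrite /X /nullspace /= yx; split=> //; exact/eqP.
  elim: n => [|n [y yx]]; first by exists x.
  by have [w wy] := Ls y; exists w; rewrite iterSr wy.
have /choice[e eP] : forall n, exists z, [/\ X n.+1 z, orthc (X n) z & hn z = 1].
  move=> n; have [y _ [h1 h2]] := Xx n.
  apply: unit_orth (@XS n) h1 h2; [exact: nullspace_subspace|
    exact: nullspace_subspace|exact: nullspace_closed].
apply: (compact_not_separated Lc (e := e)) => [n|m n mn].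
  by have [_ _ ->] := eP n.
have [Xm _ _] := eP m; have [Xn on en] := eP n.
rewrite !CE.
have -> : L (e m) - e m - (L (e n) - e n) = e n + (L (e m) - e m - L (e n)) by zmod.
rewrite -en; apply: orth_le; apply: on.
have sX : subspace (X n) by exact: nullspace_subspace.
apply: (subspaceB sX) => //; last exact: LX.
apply: (subspaceB sX) => //; last exact: (Xle _ _ mn).
by apply: (Xle m n (ltnW mn)); exact: LX.
Qed.

Lemma riesz_invertible : (forall x, L x = 0 -> x = 0) -> invertible L.
Proof.
move=> Li; split=> //.
have sT : subspace [set: H] by [].
have [c c0 cP] := riesz_bounded_below sT closedT (fun x _ => Li x).
have Ls y : exists x, L x = y.
  by have [x _ xy] := riesz_surjective sT closedT (fun _ _ => I) (fun x _ => Li x) (y := y) I; exists x.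
have [G GP] := choice Ls.
have inj x y : L x = L y -> x = y.
  move=> /eqP; rewrite -subr_eq0 -(opB Lb) => /eqP/Li/eqP.
  by rewrite subr_eq0 => /eqP.
exists G; last by split; apply/funext => x //=; apply: inj; rewrite GP.
apply/bounded_op_hnP; split.
  by move=> a x y; apply: inj; rewrite (opD Lb) (opZ Lb) !GP.
exists c^-1; rewrite ?invr_gt0 // => x.
by rewrite mulrC ler_pdivlMr // mulrC -{2}[x]GP; exact: cP.
Qed.

(** On [W] the compact operator [L - 1] is -1, so [W] cannot contain an infinite orthonormal
    sequence. *)
Lemma riesz_kernel_finite W : subspace W -> (forall x, W x -> L x = 0) ->
  exists n, ~ has_indep W n.
Proof.
move=> sW WL; apply: contrapT => /forallNP no.
have /choice[f fP] : forall s : seq H, exists x,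
    [/\ W x, hn x = 1 & forall y, y \in s -> hdot x y = 0].
  move=> s; have /contrapT h := no (size s + 1)%N.
  have [v vP vi] := has_indep_orthogonal sW h.
  have v0 : v ord0 != 0.
    apply/eqP => v0; have := vi (fun=> 1); rewrite big_ord1 scale1r v0.
    by move=> /(_ erefl ord0) /eqP; rewrite oner_eq0.
  have [Wv vs] := vP ord0; have [h1 h2] := normalize sW Wv v0.
  by eexists; split; [exact: h1|exact: h2|move=> y /vs /= h3; rewrite dotZl h3 mulr0].
(* [l n] lists the vectors chosen so far, and [f] picks a unit vector of [W] orthogonal to all of
   them. *)
pose l n := iter n (fun s => f s :: s) [::].
pose e n := f (l n).
have el m n : (m < n)%N -> e m \in l n.
  elim: n => // n IH; rewrite ltnS leq_eqVlt => /orP[/eqP ->|/IH h].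
    by rewrite /l iterS inE eqxx.
  by rewrite /l iterS inE -/(l n) h orbT.
apply: (compact_not_separated Lc (e := e)) => [n|m n mn].
  by have [_ -> _] := fP (l n).
have [Wm em _] := fP (l m); have [Wn en on] := fP (l n).
rewrite !CE !WL // !sub0r opprK addrC -[X in X <= _]en.
by apply: orth_le; rewrite dotNr on ?oppr0 //; exact: el.
Qed.

End Riesz.

Lemma span1_dim y (W : set H) : (forall x, W x -> exists a : R[i], x = a *: y) ->
  ~ has_indep W 2.
Proof.
move=> Wy [v Wv vi].
have [a0 v0] := Wy _ (Wv ord0); have [a1 v1] := Wy _ (Wv ord_max).
have sum (b : 'I_2 -> R[i]) : \sum_i b i *: v i = (b ord0 * a0 + b ord_max * a1) *: y.
  rewrite big_ord_recl big_ord1 v0 (_ : lift ord0 ord0 = ord_max); last exact: val_inj.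
  by rewrite v1 !scalerA -scalerDl.
have := vi (fun i => if i == ord0 then a1 else - a0).
rewrite sum eqxx /= mulNr mulrC subrr scale0r => /(_ erefl) h.
have a10 := h ord0; have := h ord_max; rewrite /= in a10 *.
move=> /eqP; rewrite oppr_eq0 => /eqP a00.
have := vi (fun=> 1); rewrite sum a10 a00 !mulr0 addr0 scale0r => /(_ erefl ord0)/eqP.
by rewrite oner_eq0.
Qed.

Definition rank1 z y : H -> H := fun u => hdot u z *: y.

Lemma rank1_bounded z y : bounded_op (rank1 z y).
Proof.
apply/bounded_op_hnP; split=> [a u v|].
  by rewrite /rank1 dotDl dotZl scalerDl scalerA.
exists (hn z * hn y + 1); first by rewrite ltr_wpDl // mulr_ge0 // hn_ge0.
move=> u; rewrite /rank1 hnZ mulrDl mul1r.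
have := cauchy_schwarz u z; have := hn_ge0 u; have := hn_ge0 y; have := hn_ge0 z.
nra.
Qed.

Lemma rank1_finite z y : finite_rank_op (rank1 z y).
Proof.
split; first exact: rank1_bounded.
apply: (@le_lt_trans _ _ ((1%:R : R)%:E)); last exact: ltry.
apply: hdim_le; first exact/range_subspace/rank1_bounded.
apply: (@span1_dim y) => _ [u _ <-]; by exists (hdot u z).
Qed.

End CompactPerturbations.

(** * Perturbations by the ideal *)

Section IdealPerturbations.
Context {R : realType} {H : hilbertType R} (S : sn_ideal H).
Implicit Types (x y z u v : H) (W V D U : set H) (A B C L : H -> H) (G K : Gl S).

Lemma bounded_opD A B : bounded_op A -> bounded_op B -> bounded_op (A + B).
Proof.
move=> /bounded_op_hnP[Al [c c0 Ac]] /bounded_op_hnP[Bl [d d0 Bd]].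
apply/bounded_op_hnP; split=> [a x y|].
  rewrite -[LHS]/(A _ + B _) Al Bl addrACA -scalerDr //.
exists (c + d); first exact: addr_gt0.
move=> x; rewrite mulrDl; apply: le_trans (hnD _ _) _; exact: lerD.
Qed.

Lemma bounded_opN A : bounded_op A -> bounded_op (- A).
Proof.
move=> /bounded_op_hnP[Al [c c0 Ac]].
apply/bounded_op_hnP; split=> [a x y|].
  by rewrite -[LHS]/(- A _) Al opprD -scalerN.
by exists c => // x; rewrite -[(- A) x]/(- A x) hnN.
Qed.

Lemma bounded_opB A B : bounded_op A -> bounded_op B -> bounded_op (A - B).
Proof. by move=> hA hB; apply: bounded_opD => //; exact: bounded_opN. Qed.

Definition oneS L := sn_set S (L - idfun).

Lemma oneS_bounded L : oneS L -> bounded_op L.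
Proof.
move=> /sn_bounded h; rewrite -(subrK idfun L); apply: bounded_opD h _.
exact: bounded_op_id.
Qed.

Lemma oneS_compact L : oneS L -> compact_op (L - idfun).
Proof. exact: sn_compact. Qed.

Lemma oneS_add L B : oneS L -> sn_set S B -> oneS (L + B).
Proof. by move=> hL hB; rewrite /oneS addrAC; exact: sn_add. Qed.

Lemma oneS_id : oneS idfun.
Proof. by rewrite /oneS subrr; exact: sn_set0. Qed.

Lemma Gl_oneS G : oneS (Gl_op G).
Proof. exact: Gl_sub1. Qed.

Lemma rank1_S z y : sn_set S (rank1 z y).
Proof. apply: sn_finite_rank; exact: rank1_finite. Qed.

Lemma oneS_Gl L : oneS L -> (forall x, L x = 0 -> x = 0) -> exists G, Gl_op G = L.
Proof.
move=> hL Li.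
have Linv : invertible L by exact: riesz_invertible (oneS_bounded hL) (oneS_compact hL) Li.
by exists (Gl_of hL Linv).
Qed.

Lemma GlK G x : Gl_op (G^-1)%g (Gl_op G x) = x.
Proof. by rewrite -[LHS]/((Gl_op (G^-1)%g \o Gl_op G) x) -Gl_opM mulVg. Qed.

Lemma GlVK G x : Gl_op G (Gl_op (G^-1)%g x) = x.
Proof. by rewrite -[LHS]/((Gl_op G \o Gl_op (G^-1)%g) x) -Gl_opM mulgV. Qed.

Lemma Gl_injective G : injective (Gl_op G).
Proof. exact: can_inj (GlK G). Qed.

(* The kernel of L shrinks by one dimension for each rank-one perturbation by a
   vector outside the range of L; it stays transverse to W. *)
Lemma oneS_repair W L : subspace W -> closed W -> oneS L ->
  (forall x, W x -> L x = 0 -> x = 0) ->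
  exists G, forall x, W x -> Gl_op G x = L x.
Proof.
move=> sW cW hL Li.
have Lb := oneS_bounded hL; have Lc := oneS_compact hL.
have [n hn] := riesz_kernel_finite Lc (nullspace_subspace Lb) (fun x h => h).
elim: n L hL Li Lb Lc hn => [|n IH] L hL Li Lb Lc hn; first by case: hn; exact: has_indep0.
have [h|/existsNP[x /not_implyP[Lx /eqP x0]]] := pselect (forall x, L x = 0 -> x = 0).
  by have [G GL] := oneS_Gl hL h; exists G => y _; rewrite GL.
have [y Ly] : exists y, forall u, L u <> y.
  apply: contrapT => /forallNP h; case/eqP: x0; apply: (riesz_injective Lb Lc) Lx => y.
  by apply: contrapT => h'; apply: (h y) => u Lu; apply: h'; exists u.
(* As [z] is orthogonal to [W], the perturbation [rank1 z y] does not change [L] on [W]. *)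
pose z := x - orthproj W x.
have oz : orthc W z by exact: orthproj_orth.
have z0 : z != 0.
  apply: contra_neqN x0 => /eqP/eqP; rewrite subr_eq0 => /eqP xW; apply: Li => //.
  by rewrite xW; exact: orthproj_in.
have xz : hdot x z != 0.
  rewrite -[x](subrK (orthproj W x)) dotDl (dot_sym0 (oz _ (orthproj_in sW cW x))).
  by rewrite addr0 dotxx_eq0.
have hL' : oneS (L + rank1 z y) by apply: oneS_add => //; exact: rank1_S.
have L'W u : W u -> (L + rank1 z y) u = L u.
  move=> Wu; rewrite -[LHS]/(L u + hdot u z *: y) (dot_sym0 (oz _ Wu)).
  by rewrite scale0r addr0.
have [||||G GP] := IH _ hL'.
- by move=> u Wu; rewrite L'W //; exact: Li.
- exact: oneS_bounded.
- exact: oneS_compact.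
(* A kernel vector [u] of the new operator has [hdot u z = 0], as [y] is not a value of [L]; so it
   is in the old kernel. The old kernel also contains [x], on which this functional does not vanish,
   hence one more dimension. *)
- move=> h; apply: hn.
  apply: (@has_indep_cons _ _ _ _ x (hdot^~ z)) => //.
  + exact: nullspace_subspace.
  + by move=> a u v; rewrite dotDl dotZl.
  + apply: subset_has_indep h => u; rewrite /nullspace /= => Lu.
    have uz : hdot u z = 0.
      apply/eqP/negPn/negP => uz; apply: (Ly (- (hdot u z)^-1 *: u)).
      have /eqP := Lu; rewrite addr_eq0 => /eqP h1.
      by rewrite (opZ Lb) h1 scaleNr scalerN opprK /rank1 scalerA mulVf ?scale1r.
    split=> //=; move: Lu; rewrite -[LHS]/(L u + hdot u z *: y) uz scale0r addr0.
    by [].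
by exists G => u Wu; rewrite GP // L'W.
Qed.

(** * Relative dimension counting up to the group *)

Definition addv W x := [set u | exists a : R[i], W (u - a *: x)].

Lemma addv_subset W x : W `<=` addv W x.
Proof. by move=> u Wu; exists 0; rewrite scale0r subr0. Qed.

Lemma addv_in W x : subspace W -> addv W x x.
Proof. by move=> [W0 _]; exists 1; rewrite scale1r subrr. Qed.

Lemma addv_subspace W x : subspace W -> subspace (addv W x).
Proof.
move=> sW; split; first by apply: addv_subset; case: sW.
move=> a u v [b Wb] [c Wc]; exists (a * b + c).
have -> : a *: u + v - (a * b + c) *: x = a *: (u - b *: x) + (v - c *: x).
  by rewrite scalerDl scalerBr scalerA opprD addrACA.
by case: sW => _; exact.
Qed.

Lemma addv_sub W V x : subspace V -> W `<=` V -> V x -> addv W x `<=` V.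
Proof.
move=> sV WV Vx u [a /WV Vu]; rewrite -(subrK (a *: x) u).
by apply: subspaceD => //; exact: subspaceZ.
Qed.

Lemma orth_part W x : subspace W -> closed W -> ~ W x ->
  [/\ orthc W (x - orthproj W x), x - orthproj W x != 0 &
      hdot x (x - orthproj W x) = hdot (x - orthproj W x) (x - orthproj W x)].
Proof.
move=> sW cW Wx; have oz := orthproj_orth sW cW x; split=> //.
  by rewrite subr_eq0; apply/eqP => xW; apply: Wx; rewrite xW; exact: orthproj_in.
have := oz _ (orthproj_in sW cW x); set z := x - orthproj W x => /dot_sym0 h.
have -> : hdot x z = hdot (z + orthproj W x) z by rewrite subrK.
by rewrite dotDl h addr0.
Qed.

Lemma addv_orth W x u : subspace W -> closed W -> ~ W x -> addv W x u ->
  hdot u (x - orthproj W x) = 0 -> W u.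
Proof.
move=> sW cW Wx [a Wa]; have [oz z0 xz] := orth_part sW cW Wx.
rewrite -(subrK (a *: x) u) dotDl (dot_sym0 (oz _ Wa)) add0r dotZl xz => /eqP.
rewrite mulf_eq0 dotxx_eq0 (negbTE z0) orbF => /eqP a0.
by move: Wa; rewrite a0 scale0r subr0 addr0.
Qed.

(** With [z] the part of [x] orthogonal to [W], the oblique map that subtracts [hdot u z / hdot z z]
    times [x] has [addv W x] as preimage of [W]. *)
Lemma addv_closed W x : subspace W -> closed W -> ~ W x -> closed (addv W x).
Proof.
move=> sW cW Wx; have [oz z0 xz] := orth_part sW cW Wx.
set z := x - orthproj W x in oz z0 xz.
pose T := idfun - rank1 z ((hdot z z)^-1 *: x).
have Tb : bounded_op T.
  by apply: bounded_opB; [exact: bounded_op_id|exact: rank1_bounded].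
have -> : addv W x = T @^-1` W.
  apply/seteqP; split=> u.
    move=> [a Wa]; rewrite /= -[T u]/(u - hdot u z *: ((hdot z z)^-1 *: x)).
    rewrite -[in hdot u z](subrK (a *: x) u) dotDl (dot_sym0 (oz _ Wa)) add0r.
    by rewrite dotZl xz scalerA mulfK // dotxx_eq0.
  rewrite /= -[T u]/(u - hdot u z *: ((hdot z z)^-1 *: x)) scalerA => Wu.
  by exists (hdot u z * (hdot z z)^-1).
by apply: closed_comp => // u _; case: Tb => _; exact.
Qed.

Definition csub W := subspace W /\ closed W.

Lemma csub_Gl K W : csub W -> csub (Gl_op K @` W).
Proof.
move=> [sW cW]; have Kb := Gl_bounded K; split; first exact: image_subspace.
have KV : Gl_op K @` W = Gl_op (K^-1)%g @^-1` W.
  apply/seteqP; split=> [_ [x Wx <-]|x Wx]; first by rewrite /= GlK.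
  by exists (Gl_op (K^-1)%g x) => //; exact: GlVK.
rewrite KV; apply: closed_comp => // u _; case: (Gl_bounded (K^-1)%g) => _; exact.
Qed.

(* ext n D W: W is D plus n dimensions *)
Inductive ext : nat -> set H -> set H -> Prop :=
| ext0 D : ext 0 D D
| extS n D W x : ext n D W -> ~ W x -> ext n.+1 D (addv W x).

Lemma ext_subset n D W : ext n D W -> D `<=` W.
Proof. by elim=> [{}D u //|{}n {}D {}W x _ IH _ u /IH]; exact: addv_subset. Qed.

Lemma ext_csub n D W : ext n D W -> csub D -> csub W.
Proof.
elim=> [//|{}n {}D {}W x _ IH Wx /IH[sW cW]].
by split; [exact: addv_subspace|exact: addv_closed].
Qed.

Lemma ext_trans a b D W U : ext a D W -> ext b W U -> ext (b + a) D U.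
Proof.
by move=> DW WU; elim: WU DW => [//|{}b {}W {}U x _ IH Ux DW]; apply: extS => //; exact: IH.
Qed.

Lemma ext_inv n D W : ext n.+1 D W -> exists W1 x, [/\ ext n D W1, ~ W1 x & W = addv W1 x].
Proof.
by move=> h; inversion h as [|k D' W' x e Wx]; exists W', x.
Qed.

Lemma ext0_inv D W : ext 0 D W -> W = D.
Proof. by move=> h; inversion h. Qed.

Lemma ext_split a b D U : ext (b + a) D U -> exists2 W, ext a D W & ext b W U.
Proof.
elim: b U => [|b IH] U; first by move=> h; exists U => //; exact: ext0.
by rewrite addSn => /ext_inv[U1 [x [/IH[W DW WU1] U1x ->]]]; exists W => //; exact: extS.
Qed.

Lemma Gl_addv K W x : Gl_op K @` addv W x = addv (Gl_op K @` W) (Gl_op K x).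
Proof.
have Kb := Gl_bounded K.
apply/seteqP; split=> [_ [u [a Wu] <-]|u [a [w Ww wE]]].
  by exists a; exists (u - a *: x) => //; rewrite (opB Kb) (opZ Kb).
exists (w + a *: x); first by exists a; rewrite addrK.
by rewrite (opD Kb) (opZ Kb) wE subrK.
Qed.

Lemma ext_Gl K n D W : ext n D W -> ext n (Gl_op K @` D) (Gl_op K @` W).
Proof.
elim=> [{}D|{}n {}D {}W x _ IH Wx]; first exact: ext0.
rewrite Gl_addv; apply: extS => // -[w Ww /Gl_injective wx]; apply: Wx.
by rewrite -wx.
Qed.

Definition sim W V := exists K, Gl_op K @` W = V.

Lemma sim_refl W : sim W W.
Proof. by exists 1%g; rewrite Gl_op1 image_id. Qed.

Lemma Gl_imageM G K W : Gl_op (G * K)%g @` W = Gl_op G @` (Gl_op K @` W).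
Proof. by rewrite Gl_opM image_comp. Qed.

Lemma sim_trans W V U : sim W V -> sim V U -> sim W U.
Proof. by move=> [K <-] [G <-]; exists (G * K)%g; rewrite Gl_imageM. Qed.

Lemma sim_sym W V : sim W V -> sim V W.
Proof. by move=> [K <-]; exists (K^-1)%g; rewrite -Gl_imageM mulVg Gl_op1 image_id. Qed.

(** A vector [z] orthogonal to [V] but to neither [x] nor [y] gives the rank-one perturbation [J] of
    the identity that fixes [V] and sends [x] to [y]; it multiplies the functional [hdot^~ z] by
    [hdot y z / hdot x z], hence is injective. If the parts of [x] and [y] orthogonal to [V] are
    orthogonal to each other, their sum serves as [z]; otherwise the part of [x] does. *)
Lemma line_move V x y : csub V -> ~ V x -> ~ V y -> sim (addv V x) (addv V y).
Proof.
move=> [sV cV] Vx Vy.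
have [ox x0 xx] := orth_part sV cV Vx; have [oy y0 yy] := orth_part sV cV Vy.
set x0' := x - orthproj V x in ox x0 xx; set y0' := y - orthproj V y in oy y0 yy.
have [z [oz xz yz]] : exists z, [/\ orthc V z, hdot x z != 0 & hdot y z != 0].
  have yx : hdot y x0' = hdot y0' x0'.
    by rewrite -[in LHS](subrK (orthproj V y) y) dotDl
      (dot_sym0 (ox _ (orthproj_in sV cV y))) addr0.
  have xy : hdot x y0' = hdot x0' y0'.
    by rewrite -[in LHS](subrK (orthproj V x) x) dotDl
      (dot_sym0 (oy _ (orthproj_in sV cV x))) addr0.
  have [h|h] := eqVneq (hdot y0' x0') 0; last first.
    by exists x0'; split=> //; [rewrite xx dotxx_eq0|rewrite yx].
  exists (x0' + y0'); split.
  - exact: subspaceD (orthc_subspace V) ox oy.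
  - by rewrite dotDr xx xy (dot_sym0 h) addr0 dotxx_eq0.
  - by rewrite dotDr yy yx h add0r dotxx_eq0.
pose J := idfun + rank1 z ((hdot x z)^-1 *: (y - x)).
have JE u : J u = u + (hdot u z / hdot x z) *: (y - x).
  by rewrite -[J u]/(u + hdot u z *: _) scalerA.
have JS : oneS J by apply: oneS_add oneS_id _; exact: rank1_S.
have Ji u : J u = 0 -> u = 0.
  rewrite JE => h; have := congr1 (hdot^~ z) h.
  rewrite dotDl dotZl dotBl dot0l mulrBr divfK // addrC subrK => /eqP.
  rewrite !mulf_eq0 invr_eq0 (negbTE xz) (negbTE yz) !orbF => /eqP uz.
  by move: h; rewrite uz mul0r scale0r addr0.
have [G GJ] := oneS_Gl JS Ji; exists G.
have GV : Gl_op G @` V = V.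
  apply/seteqP; split=> [_ [u Vu <-]|u Vu]; last exists u => //;
  by rewrite GJ JE (dot_sym0 (oz _ Vu)) mul0r scale0r addr0.
rewrite Gl_addv GV GJ JE divff // scale1r addrC subrK //.
Qed.

Lemma ext_up n D W D' W' : csub D -> ext n D W -> ext n D' W' -> sim D D' -> sim W W'.
Proof.
elim: n W W' => [|n IH] W W' cD; first by move=> /ext0_inv -> /ext0_inv ->.
move=> /ext_inv[W1 [x [e1 W1x ->]]] /ext_inv[W2 [y [e2 W2y ->]]] h.
have [K KW] := IH _ _ cD e1 e2 h.
apply: (@sim_trans _ (addv W2 (Gl_op K x))).
  by exists K; rewrite Gl_addv KW.
apply: line_move => //.
  by rewrite -KW; apply: csub_Gl; exact: ext_csub e1 cD.
by rewrite -KW => -[w Ww /Gl_injective wx]; apply: W1x; rewrite -wx.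
Qed.

(** A vector of [V2] outside [V1] has a nonzero coefficient along [a]; so [a], then the whole common
    space, and finally [b] would lie in [V2]. *)
Lemma hyperplane_subset V1 V2 a b : subspace V1 -> subspace V2 ->
  addv V1 a = addv V2 b -> ~ V2 b -> V1 `<=` V2 -> V2 `<=` V1.
Proof.
move=> s1 s2 E V2b V12 v Vv.
have [c Vc] : addv V1 a v by rewrite E; exact: addv_subset.
have [c0|c0] := eqVneq c 0; first by move: Vc; rewrite c0 scale0r subr0.
exfalso; apply: V2b.
have V2a : V2 a.
  have -> : a = c^-1 *: (v - (v - c *: a)).
    by rewrite opprB addrC subrK scalerA mulVf // scale1r.
  by apply: subspaceZ => //; apply: subspaceB => //; exact: V12.
by apply: (addv_sub s2 V12 V2a); rewrite E; exact: addv_in.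
Qed.

Lemma hyperplane_inter V1 V2 b p : subspace V1 -> subspace V2 ->
  V1 `<=` addv V2 b -> V1 p -> ~ V2 p -> V1 = addv (V1 `&` V2) p.
Proof.
move=> s1 s2 V1s Vp V2p; apply/seteqP; split; last first.
  by apply: addv_sub => // u [].
move=> v Vv; have [c Vc] := V1s _ Vp; have [e Ve] := V1s _ Vv.
have c0 : c != 0 by apply/eqP => c0; move: Vc; rewrite c0 scale0r subr0.
exists (e / c); split; first by apply: subspaceB => //; exact: subspaceZ.
have -> : v - (e / c) *: p = (v - e *: b) - (e / c) *: (p - c *: b).
  by rewrite scalerBr scalerA divfK //; zmod.
by apply: subspaceB => //; exact: subspaceZ.
Qed.

(** Two distinct hyperplanes of one space are both one vector larger than their intersection, so
    [line_move] over the intersection applies. *)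
Lemma hyperplane_sim V1 V2 a b : csub V1 -> csub V2 ->
  addv V1 a = addv V2 b -> ~ V1 a -> ~ V2 b -> sim V1 V2.
Proof.
move=> [s1 c1] [s2 c2] E V1a V2b.
have [h|/existsNP[p /not_implyP[V1p V2p]]] := pselect (V1 `<=` V2).
  have h' := hyperplane_subset s1 s2 E V2b h.
  by have -> : V1 = V2 by [apply/seteqP]; exact: sim_refl.
have [h|/existsNP[q /not_implyP[V2q V1q]]] := pselect (V2 `<=` V1).
  by case: V2p; apply: (hyperplane_subset s2 s1 (esym E) V1a h).
have e1 : V1 = addv (V1 `&` V2) p.
  by apply: (@hyperplane_inter _ _ b) => //; rewrite -E; exact: addv_subset.
have e2 : V2 = addv (V1 `&` V2) q.
  by rewrite setIC; apply: (@hyperplane_inter _ _ a) => //; rewrite E; exact: addv_subset.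
rewrite {1}e1 {2}e2; apply: line_move => [|[]|[]] //.
by split; [exact: subspaceI|exact: closedI].
Qed.

(** Descends one step at a time: after a group element identifies the top spaces, the two subspaces
    just below become hyperplanes of the same space. *)
Lemma ext_down n D W D' W' : csub D -> csub D' ->
  ext n D W -> ext n D' W' -> sim W W' -> sim D D'.
Proof.
elim: n W W' => [|n IH] W W' cD cD'; first by move=> /ext0_inv -> /ext0_inv ->.
move=> /ext_inv[W1 [x [e1 W1x ->]]] /ext_inv[W2 [y [e2 W2y ->]]] [K].
rewrite Gl_addv => E; apply: (IH _ _ cD cD' e1 e2).
apply: (@sim_trans _ (Gl_op K @` W1)); first by exists K.
apply: hyperplane_sim E _ _ => //.
- by apply: csub_Gl; exact: ext_csub e1 cD.
- exact: ext_csub e2 cD'.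
- by move=> -[w Ww /Gl_injective wx]; apply: W1x; rewrite -wx.
Qed.

(** The group element carrying [W] to [D] maps [W] into itself injectively, hence onto by Riesz
    theory. This replaces finiteness of dimension. *)
Lemma sim_subset D W : csub W -> D `<=` W -> sim D W -> D = W.
Proof.
move=> [sW cW] DW /sim_sym[K KW].
have Kb := Gl_bounded K.
apply/seteqP; split=> // y Wy.
have [||x Wx <-] := riesz_surjective Kb (oneS_compact (Gl_oneS K)) sW cW _ _ Wy.
- by move=> x Wx; apply: DW; rewrite -KW; exists x.
- by move=> x _ h; apply: (@Gl_injective K); rewrite h (op0 Kb).
- by rewrite -KW; exists x.
Qed.

Lemma ext_free n D W : csub D -> ext n D W -> sim D W -> n = 0%N.
Proof.
case: n => // n cD e h; have cW := ext_csub e cD.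
have DW := sim_subset cW (ext_subset e) h.
have [W1 [x [e1 W1x E]]] := ext_inv e; case: W1x.
apply: (ext_subset e1); rewrite DW E; apply: addv_in.
by have [] := ext_csub e1 cD.
Qed.

(** Going down [a] steps in both chains leaves [D] similar to a subspace [b - a] dimensions above
    it, which Riesz theory allows only for [b - a = 0]. *)
Lemma ext_cancel a b D W W' : csub D -> ext a D W -> ext b D W' -> sim W W' -> a = b.
Proof.
wlog ab : a b W W' / (a <= b)%N => [wl cD e1 e2 h|].
  have [ab|/ltnW ba] := leqP a b; first exact: (wl _ _ _ _ ab cD e1 e2 h).
  by apply/esym; exact: (wl _ _ _ _ ba cD e2 e1 (sim_sym h)).
move=> cD e1; rewrite -(subnKC ab) => e2 h.
have [W1 e3 e4] := ext_split e2.
have := ext_down cD (ext_csub e3 cD) e1 e4 h.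
by move=> /(ext_free cD e3) ->; rewrite addn0.
Qed.

(* W is V minus m dimensions plus n dimensions, up to sim *)
Definition cod W V n m := exists D W1, [/\ csub D, ext m D V, ext n D W1 & sim W1 W].

(** The longer descent from [V] to [D'] passes through a subspace [m] steps below [V], which is
    similar to [D]. Transporting the first chain there and extending it down to [D'] lets both
    chains start at [D']. *)
Lemma cod_align W W' V n m n' m' : (m <= m')%N -> cod W V n m -> cod W' V n' m' ->
  exists D U U', [/\ csub D, ext (n + (m' - m)) D U, ext n' D U', sim U W & sim U' W'].
Proof.
move=> mm [D [W1 [cD e1 e2 s]]] [D' [W1' [cD' e1' e2' s']]].
rewrite -(subnKC mm) in e1'; have [D1 e3 e4] := ext_split e1'.
have [K KD] := ext_down (ext_csub e3 cD') cD e4 e1 (sim_refl V).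
have [L KL] : sim D D1 by apply: sim_sym; exists K.
exists D', (Gl_op L @` W1), W1'; split=> //.
  by apply: ext_trans e3 _; rewrite -KL; exact: ext_Gl.
by apply: sim_trans s; apply: sim_sym; exists L.
Qed.

Lemma cod_sim W W' V n m n' m' : cod W V n m -> cod W' V n' m' ->
  (n + m' = n' + m)%N -> sim W W'.
Proof.
wlog mm : W W' n m n' m' / (m <= m')%N => [wl h1 h2 E|].
  have [mm|/ltnW mm] := leqP m m'; first exact: (wl _ _ _ _ _ _ mm h1 h2 E).
  by apply/sim_sym; exact: (wl _ _ _ _ _ _ mm h2 h1 (esym E)).
move=> h1 h2 E; have [D [U [U' [cD e e' s s']]]] := cod_align mm h1 h2.
have En : (n + (m' - m) = n')%N by lia.
rewrite En in e; apply: sim_trans (sim_sym s) (sim_trans _ s').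
exact: ext_up cD e e' (sim_refl D).
Qed.

Lemma sim_cod W W' V n m n' m' : cod W V n m -> cod W' V n' m' ->
  sim W W' -> (n + m' = n' + m)%N.
Proof.
wlog mm : W W' n m n' m' / (m <= m')%N => [wl h1 h2 E|].
  have [mm|/ltnW mm] := leqP m m'; first exact: (wl _ _ _ _ _ _ mm h1 h2 E).
  by apply/esym; exact: (wl _ _ _ _ _ _ mm h2 h1 (sim_sym E)).
move=> h1 h2 h; have [D [U [U' [cD e e' s s']]]] := cod_align mm h1 h2.
have := ext_cancel cD e e' (sim_trans s (sim_trans h (sim_sym s'))); lia.
Qed.

(** The bridge from the dimensions in the essential codimension to chains: one vector of the
    orthogonal complement is adjoined at a time. *)
Lemma hdim_ext n D W : csub D -> csub W -> D `<=` W ->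
  hdim (W `&` orthc D) = (n%:R : R)%:E -> ext n D W.
Proof.
move=> + [sW cW]; elim: n D => [|n IH] D cD DW; have [sD clD] := cD.
  have sWD : subspace (W `&` orthc D) by apply: subspaceI => //; exact: orthc_subspace.
  move=> /(hdim_eqP _ sWD)[_ no].
  suff -> : D = W by exact: ext0.
  apply/seteqP; split=> // x Wx; apply: contrapT => Dx; apply: no.
  have [ox x0 _] := orth_part sD clD Dx.
  exists (fun=> x - orthproj D x) => [i|a].
    by split=> //; apply: subspaceB => //; apply: DW; exact: orthproj_in.
  rewrite big_ord1 => /eqP; rewrite scaler_eq0 (negbTE x0) orbF => /eqP a0 i.
  by rewrite ord1.
have sWD : subspace (W `&` orthc D) by apply: subspaceI => //; exact: orthc_subspace.
move=> /(hdim_eqP _ sWD)[yes no].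
have [v vP vi] := yes; pose x := v ord0; have [Wx ox] := vP ord0.
have x0 : x != 0.
  apply/eqP => x0; have := vi (fun i => if i == ord0 then 1 else 0).
  rewrite big_ord_recl eqxx scale1r -[v ord0]/x x0 add0r big1 => [/(_ erefl ord0)/eqP|i _].
    by rewrite ?eqxx oner_eq0.
  by rewrite -[lift ord0 i == ord0]/false scale0r.
have Dx : ~ D x by move=> Dx; case/eqP: x0; exact: orthc_disjoint Dx ox.
have e1 : ext 1 D (addv D x) by apply: extS => //; exact: ext0.
rewrite -addn1; apply: ext_trans e1 _; apply: IH.
- by split; [exact: addv_subspace|exact: addv_closed].
- exact: addv_sub.
have E : W `&` orthc (addv D x) = (W `&` orthc D) `&` [set u | hdot u x = 0].
  apply/seteqP; split=> u.
    by move=> [Wu ou]; split=> /=; [split=> // y Dy; apply: ou; exact: addv_subset|apply: ou; exact: addv_in].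
  move=> [[Wu ou] /= ux]; split=> // y [a Da].
  by rewrite -(subrK (a *: x) y) dotDr dotZr ux mulr0 addr0 ou.
have lin (a : R[i]) (u w : H) : hdot (a *: u + w) x = a * hdot u x + hdot w x.
  by rewrite dotDl dotZl.
rewrite E; apply/hdim_eqP.
  apply: subspaceI => //; split; first by rewrite /= dot0l.
  by move=> a u w /= hu hw; rewrite lin hu hw mulr0 addr0.
split; first exact: has_indep_kernel yes.
move=> h; apply: no; apply: (@has_indep_cons _ _ _ _ x (hdot^~ x)) => //.
by rewrite dotxx_eq0.
Qed.

(** Each step of the chain is undone by one linear functional, which costs at most one dimension of
    the intersection. *)
Lemma ext_has_indep j m D W V : csub D -> subspace V -> ext j D W ->
  has_indep (W `&` V) (j + m) -> has_indep (D `&` V) m.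
Proof.
move=> cD sV; elim: j W => [|j IH] W; first by move=> /ext0_inv ->.
move=> /ext_inv[W1 [x [e W1x ->]]] h; apply: (IH _ e).
have [s1 c1] := ext_csub e cD.
have [||k] := @has_indep_kernel _ _ _ (j + m) (hdot^~ (x - orthproj W1 x)) _ _ h.
- by apply: subspaceI => //; exact: addv_subspace.
- by move=> a u v; rewrite dotDl dotZl.
move=> hk ki; exists k => // i; have [[Wk Vk] /= ok] := hk i.
by split=> //; exact: addv_orth Wk ok.
Qed.

End IdealPerturbations.

(** * Closed range operators and essential codimension *)

Section RealSubspace.
Context {R : realType} {H : hilbertType R} (W : set H) (cW : csub W).

Let hsubP (a : R) (x y : realify H) : W x -> W y -> W (a *: x + y).
Proof. by case: cW => -[_ h] _ Wx Wy; exact: h. Qed.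

Let hsub_complete (u : nat -> realify H) : (forall n, W (u n)) ->
  (forall e : R, 0 < e -> exists N, forall m n, (N <= m)%N -> (N <= n)%N ->
     hn (u m - u n : H) < e) ->
  exists2 l, W l & forall e : R, 0 < e -> exists N, forall n, (N <= n)%N ->
     hn (u n - l : H) < e.
Proof.
move=> Wu /(@hcomplete R H)[l lP]; exists l.
  have [_ /closed_hn cl] := cW; apply: cl => e /lP[N NP]; exists (u N) => //; exact: NP.
by move=> e /lP[N NP]; exists N => n /NP; rewrite hnC.
Qed.

(* closed subspaces of H as real Banach spaces, where Baire's theorem applies *)
Definition real_banach : banach_subspace (realify H) :=
  @BanachSubspace R (realify H) W (fun x => hn (x : H)) (proj1 (proj1 cW)) hsubP
    (fun x y _ _ => hnD (x : H) y) (fun a x _ => hnZr a (x : H))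
    (fun x _ h => eqP (etrans (esym (hn_eq0 (x : H))) (introT eqP h)))
    hsub_complete.

Lemma real_banach_in x : W x -> (x : realify H) \in bs_pred real_banach.
Proof. by move=> Wx; rewrite unfold_in; exact: mem_set. Qed.

End RealSubspace.

Section ClosedRange.
Context {R : realType} {H : hilbertType R}.
Implicit Types (x y z u v : H) (W V D U : set H) (A B C L T : H -> H).

Lemma orthc_csub W : csub (orthc W).
Proof. by split; [exact: orthc_subspace|exact: orthc_closed]. Qed.

Lemma nullspace_csub A : bounded_op A -> csub (nullspace A).
Proof. by move=> Ab; split; [exact: nullspace_subspace|exact: nullspace_closed]. Qed.

Lemma range_csub A : closed_range_op A -> csub (range A).
Proof. by move=> [Ab Ac]; split=> //; exact: range_subspace. Qed.

(** The open mapping theorem for the restriction of [A] from the orthogonal complement of its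
    nullspace onto its range, both seen as real Banach spaces. *)
Lemma closed_range_lift A : closed_range_op A ->
  exists2 C : R, 0 <= C & forall y, range A y ->
    exists x, [/\ orthc (nullspace A) x, A x = y & hn x <= C * hn y].
Proof.
move=> hA; have [Ab Ac] := hA.
set N := nullspace A; have [sN cN] := nullspace_csub Ab.
have cU := orthc_csub N; have cV := range_csub hA.
have rA x : range A (A x) by exists x.
pose f (x : bs_type (real_banach cU)) : bs_type (real_banach cV) :=
  BsElem (real_banach_in cV (rA (bs_val x))).
have fl : linear f by move=> a x y; apply: val_inj => /=; rewrite (opD Ab) (opZ Ab).
have /bounded_op_hnP[_ [K K0 AK]] := Ab.
have fb (x : bs_type (real_banach cU)) : `|f x| <= K * `|x| by exact: (AK (bs_val x)).
have fc : continuous f := bounded_linear_continuousE fl fb.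
have fs (v : bs_type (real_banach cV)) : exists u : bs_type (real_banach cU), f u = v.
  have [x _ xy] : range A (bs_val v) by exact: (bs_valS v).
  have ox : orthc N (x - orthproj N x) by exact: orthproj_orth.
  exists (BsElem (real_banach_in cU ox)); apply: val_inj => /=.
  by rewrite (opB Ab) (_ : A (orthproj N x) = 0) ?subr0 //; exact: (orthproj_in sN cN x).
have [C C0 fC] := open_mapping fl fc fs; exists C => // y Ry.
have [x xy xC] := fC (BsElem (real_banach_in cV Ry)).
exists (bs_val x : H); split; [exact: (bs_valS x)| |exact: xC].
by have := congr1 (@bs_val _ _ _) xy.
Qed.

(** The Moore-Penrose inverse: [T y] is the preimage, orthogonal to the nullspace, of the projection
    of [y] onto the range. Uniqueness of this preimage makes [T] linear, and the bounded lift makes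
    it bounded. *)
Lemma pseudo_inverse A : closed_range_op A -> exists T, [/\ bounded_op T,
  forall x, T (A x) = x - orthproj (nullspace A) x &
  forall y, A (T y) = orthproj (range A) y].
Proof.
move=> hA; have [Ab _] := hA; have [sN cN] := nullspace_csub Ab.
have [sR cR] := range_csub hA; set N := nullspace A in sN cN *.
have [C C0 AC] := closed_range_lift hA.
have /choice[T TP] : forall y, exists x, [/\ orthc N x, A x = orthproj (range A) y
    & hn x <= C * hn (orthproj (range A) y)].
  by move=> y; apply: AC; exact: orthproj_in.
have uniq x y : orthc N x -> orthc N y -> A x = A y -> x = y.
  move=> ox oy xy; apply/eqP; rewrite -subr_eq0; apply/eqP/(@orthc_disjoint _ _ N).
    by rewrite /N /nullspace /= (opB Ab) xy subrr.
  exact: subspaceB (orthc_subspace N) ox oy.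
have Pb := orthproj_bounded sR cR.
have Tl : linear T.
  move=> a x y; apply: uniq; first by case: (TP (a *: x + y)).
    have [_ h] := orthc_subspace N; apply: h; [by case: (TP x)|by case: (TP y)].
  have [_ h1 _] := TP x; have [_ h2 _] := TP y; have [_ h3 _] := TP (a *: x + y).
  by rewrite (opD Ab) (opZ Ab) h1 h2 h3 (opD Pb) (opZ Pb).
exists T; split.
- apply/bounded_op_hnP; split=> //; exists (C + 1); first by rewrite ltr_wpDl.
  move=> x; have [_ _ h] := TP x; apply: le_trans h _.
  have : hn (orthproj (range A) x) <= hn x.
    rewrite -{2}[x](subrK (orthproj (range A) x)) addrC.
    by apply: orth_le; exact: (dot_sym0 (orthproj_orth sR cR x (orthproj_in sR cR x))).
  by have := hn_ge0 x; have := hn_ge0 (orthproj (range A) x); nra.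
- move=> x; apply: uniq; [by case: (TP (A x))|exact: orthproj_orth|].
  have [_ -> _] := TP (A x); rewrite (orthproj_id sR cR) ?(opB Ab); last by exists x.
  by rewrite (_ : A (orthproj N x) = 0) ?subr0 //; exact: (orthproj_in sN cN x).
- by move=> y; case: (TP y).
Qed.

(** The range of [B] is the nullspace of the bounded operator 1 - BT. *)
Lemma generalized_inverse_closed_range B T : bounded_op B -> bounded_op T ->
  (forall x, B (T (B x)) = B x) -> closed_range_op B.
Proof.
move=> Bb Tb BTB; split=> //.
have -> : range B = nullspace (idfun - (B \o T)).
  apply/seteqP; split=> [_ [x _ <-]|x]; rewrite /nullspace /=.
    by rewrite -[LHS]/(B x - B (T (B x))) BTB subrr.
  by move=> /eqP; rewrite subr_eq0 => /eqP h; exists (T x) => //; exact: esym h.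
apply: nullspace_closed; apply: bounded_opB; first exact: bounded_op_id.
exact: bounded_op_comp.
Qed.

Variable S : sn_ideal H.
Implicit Types (G K : Gl S).

Lemma sn_sub A B : sn_set S (A - B) -> sn_set S (B - A).
Proof. by move=> /(@sn_opp _ _ S); rewrite opprB. Qed.

Section NullspaceCod.
Variables A B : H -> H.
Hypotheses (hA : closed_range_op A) (hB : closed_range_op B) (BA : sn_set S (B - A)).

Let V := nullspace A.
Let W := nullspace B.

(* L = 1 - T (A - B) for the pseudo-inverse T of A; on N(B) it is 1 - T A. *)
Lemma nullspace_projection_oneS : exists L, oneS S L /\ forall x, W x -> L x = orthproj V x.
Proof.
have [T [Tb TA _]] := pseudo_inverse hA.
exists (idfun - (T \o (A - B))); split.
  rewrite /oneS addrAC subrr add0r; apply: sn_opp.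
  by have [] := sn_mul Tb (sn_sub BA).
move=> x Bx; rewrite -[LHS]/(x - T (A x - B x)) (Bx : B x = 0) subr0 TA.
by rewrite opprB addrC subrK.
Qed.

(** On this intersection the operator [L] of 1 + S acts as the projection onto [V], which vanishes
    there; kernels of such operators are finite-dimensional. *)
Lemma nullspace_finite : exists n, hdim (W `&` orthc V) = (n%:R : R)%:E.
Proof.
have [L [LS LP]] := nullspace_projection_oneS; have [sV cV] := nullspace_csub hA.1.
have [sW cW] := nullspace_csub hB.1.
have s : subspace (W `&` orthc V) by apply: subspaceI => //; exact: orthc_subspace.
have [|n hn] := riesz_kernel_finite (oneS_compact LS) s.
  move=> x [Wx ox]; rewrite LP //.
  by have := orthproj_nullspace sV cV; rewrite -/V => E; rewrite -E in ox.
exact: hdim_finite s hn.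
Qed.

End NullspaceCod.

(** Let [N] be the part of [W] orthogonal to [V] and [W0] its orthogonal complement in [W]. On [W]
    the operator [L] of 1 + S is the projection onto [V], so it is injective on [W0] and is repaired
    there to a group element [G]. Then [G] maps [W0] into [V], and this image lies [m] dimensions
    below [V] and [n] dimensions below the image of [W]. *)
Lemma nullspace_cod A B : closed_range_op A -> closed_range_op B -> sn_set S (B - A) ->
  exists n m, cod S (nullspace B) (nullspace A) n m /\
    ess_codim (orthproj (nullspace B)) (orthproj (nullspace A)) = (n%:R - m%:R : R)%:E.
Proof.
move=> hA hB BA; have [n hn] := nullspace_finite hA hB BA.
have [m hm] := nullspace_finite hB hA (sn_sub BA).
exists n, m.
have [sV cV] := nullspace_csub hA.1; have [sW cW] := nullspace_csub hB.1.
set V := nullspace A in hn hm sV cV *; set W := nullspace B in hn hm sW cW *.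
split; last first.
  rewrite /ess_codim !orthproj_range // !orthproj_nullspace //.
  by rewrite setIC hn hm -EFinB.
have [L [LS LP]] := nullspace_projection_oneS hA BA; rewrite -/V -/W in LP.
pose N := W `&` orthc V.
have cN : csub N.
  split; first by apply: subspaceI => //; exact: orthc_subspace.
  by apply: closedI => //; exact: orthc_closed.
pose W0 := W `&` orthc N.
have cW0 : csub W0.
  split; first by apply: subspaceI => //; exact: orthc_subspace.
  by apply: closedI => //; exact: orthc_closed.
have [sN clN] := cN; have [sW0 clW0] := cW0.
have Lb := oneS_bounded LS.
have Linj x : W0 x -> L x = 0 -> x = 0.
  move=> [Wx ox]; rewrite LP // => Px; apply: (@orthc_disjoint _ _ N) => //; split=> //.
  by rewrite -(orthproj_nullspace sV cV).
have [G GP] := oneS_repair sW0 clW0 LS Linj.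
have e1 : ext n W0 W.
  apply: hdim_ext => //; first by move=> x [].
  rewrite (_ : W `&` orthc W0 = N) //; apply/seteqP; split=> x.
    move=> [Wx ox]; have Nx := orthproj_in sN clN x.
    suff -> : x = orthproj N x by [].
    apply/eqP; rewrite -subr_eq0; apply/eqP/(@orthc_disjoint _ _ W0).
      split; last exact: orthproj_orth.
      by apply: subspaceB => //; case: Nx.
    apply: subspaceB ox _; first exact: orthc_subspace.
    by move=> y [_ oy]; apply: dot_sym0; exact: oy.
  move=> [Wx ox]; split=> // y [_ oy]; apply: dot_sym0; exact: oy.
have GW0 : Gl_op G @` W0 = L @` W0.
  by apply/seteqP; split=> _ [x Wx <-]; exists x => //; rewrite GP.
exists (Gl_op G @` W0), (Gl_op G @` W); split.
- exact: csub_Gl.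
- apply: hdim_ext => //.
  + exact: csub_Gl.
  + by rewrite GW0 => _ [x [Wx _] <-]; rewrite LP //; exact: orthproj_in.
  (* For [y] in [V], pairing with [x] in [W] is pairing with its projection onto [V]. This
     projection kills [N], so orthogonality to the projected [W0] is orthogonality to [W]. *)
  rewrite (_ : V `&` orthc _ = V `&` orthc W) //; apply/seteqP; split=> y [Vy oy]; split=> //.
    have dP x : W x -> hdot y x = hdot y (orthproj V x).
      move=> Wx; rewrite -{1}(subrK (orthproj V x) x) dotDr.
      by rewrite (dot_sym0 (orthproj_orth sV cV _ Vy)) add0r.
    move=> x Wx; rewrite -(subrK (orthproj N x) x) dotDr.
    have Wp : W (orthproj N x) by case: (orthproj_in sN clN x).
    rewrite (dP (orthproj N x) Wp) (_ : orthproj V _ = 0).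
      have W0x : W0 (x - orthproj N x).
        by split; [exact: subspaceB|exact: orthproj_orth].
      rewrite dot0r addr0 dP; last by case: W0x.
      by apply: oy; rewrite GW0; exists (x - orthproj N x) => //; rewrite LP //; case: W0x.
    have [_ h] := orthproj_in sN clN x.
    by rewrite -(orthproj_nullspace sV cV) in h.
  move=> _ [x W0x <-]; rewrite GP // LP; last by case: W0x.
  rewrite -[orthproj V x](subrK x) dotDr (oy x) ?addr0; last by case: W0x.
  rewrite -opprB dotNr; apply/eqP; rewrite oppr_eq0; apply/eqP/dot_sym0.
  exact: orthproj_orth.
- exact: ext_Gl.
- by apply: sim_sym; exists G.
Qed.

Definition in_Ck A (k : int) B := [/\ sn_set S (B - A), closed_range_op B &
  ess_codim (orthproj (nullspace B)) (orthproj (nullspace A)) = (k%:~R : R)%:E].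

Lemma in_Ck_cod A k B : closed_range_op A -> in_Ck A k B ->
  exists n m, cod S (nullspace B) (nullspace A) n m /\ k = n%:Z - m%:Z.
Proof.
move=> hA [BA hB]; have [n [m [h ->]]] := nullspace_cod hA hB BA => -[E].
exists n, m; split=> //; apply/eqP; rewrite -(eqr_int R) rmorphB /=.
by rewrite -!pmulrn E.
Qed.

(** Any count, not only the canonical one by orthogonal complements, computes the essential
    codimension, because the difference is an invariant of similarity. *)
Lemma cod_in_Ck A B n m : closed_range_op A -> closed_range_op B ->
  sn_set S (B - A) -> cod S (nullspace B) (nullspace A) n m ->
  in_Ck A (n%:Z - m%:Z) B.
Proof.
move=> hA hB BA h; split=> //; have [n' [m' [h' ->]]] := nullspace_cod hA hB BA.
have := sim_cod h h' (sim_refl S _) => E.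
congr (_%:E); rewrite rmorphB /= -!pmulrn.
have : (n + m')%:R = (n' + m)%:R :> R by rewrite E.
by rewrite !natrD; lra.
Qed.

Lemma in_Ck_sim A k B B' : closed_range_op A -> in_Ck A k B -> in_Ck A k B' ->
  sim S (nullspace B) (nullspace B').
Proof.
move=> hA /(in_Ck_cod hA)[n [m [h ->]]] /(in_Ck_cod hA)[n' [m' [h' E]]].
apply: cod_sim h h' _; lia.
Qed.

(** Equal index makes the nullspaces similar, and similar nested subspaces coincide. This is what
    forces the lower right corner to vanish in the Schur chart. *)
Lemma in_Ck_nested A k B B' : closed_range_op A -> in_Ck A k B -> in_Ck A k B' ->
  nullspace B `<=` nullspace B' -> nullspace B = nullspace B'.
Proof.
move=> hA hB hB' BB'; apply: sim_subset (in_Ck_sim hA hB hB') => //.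
by apply: nullspace_csub; case: hB' => _ [].
Qed.

Lemma orbit_bounded B G K : bounded_op B -> bounded_op (Gl_op G \o B \o Gl_op K).
Proof.
move=> Bb; apply: bounded_op_comp; last exact: Gl_bounded.
by apply: bounded_op_comp => //; exact: Gl_bounded.
Qed.

Lemma orbit_diff B G K : bounded_op B -> sn_set S (Gl_op G \o B \o Gl_op K - B).
Proof.
move=> Bb.
have -> : Gl_op G \o B \o Gl_op K - B =
    (Gl_op G - idfun) \o (B \o Gl_op K) + (B \o (Gl_op K - idfun)).
  apply/funext => x.
  rewrite -[LHS]/(Gl_op G (B (Gl_op K x)) - B x).
  rewrite -[RHS]/(Gl_op G (B (Gl_op K x)) - B (Gl_op K x) + B (Gl_op K x - x)).
  by rewrite (opB Bb); zmod.
apply: sn_add.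
  have b : bounded_op (B \o Gl_op K) by apply: bounded_op_comp => //; exact: Gl_bounded.
  by have [] := sn_mul b (Gl_sub1 G).
by have [] := sn_mul Bb (Gl_sub1 K).
Qed.

Lemma orbit_nullspace B G K : bounded_op B ->
  nullspace (Gl_op G \o B \o Gl_op K) = Gl_op (K^-1)%g @` nullspace B.
Proof.
move=> Bb; have Gb := Gl_bounded G; apply/seteqP; split=> [x|_ [x Bx <-]].
  rewrite /nullspace /= => h; exists (Gl_op K x); last exact: GlK.
  by apply: (@Gl_injective _ _ _ G); rewrite h (op0 Gb).
by rewrite /nullspace /= GlVK (Bx : B x = 0) (op0 Gb).
Qed.

Lemma orbit_closed_range B G K : closed_range_op B ->
  closed_range_op (Gl_op G \o B \o Gl_op K).
Proof.
move=> hB; split; first by apply: orbit_bounded; case: hB.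
have -> : range (Gl_op G \o B \o Gl_op K) = Gl_op G @` range B.
  apply/seteqP; split=> [_ [x _ <-]|_ [_ [x _ <-] <-]].
    by exists (B (Gl_op K x)) => //; exists (Gl_op K x).
  by exists (Gl_op (K^-1)%g x) => //=; rewrite GlVK.
by have [] := csub_Gl G (range_csub hB).
Qed.

Lemma orbit_in_Ck A k B G K : closed_range_op A -> in_Ck A k B ->
  in_Ck A k (Gl_op G \o B \o Gl_op K).
Proof.
move=> hA hB; have [n [m [h ->]]] := in_Ck_cod hA hB; have [BA cB _] := hB.
apply: cod_in_Ck => //; first exact: orbit_closed_range.
  rewrite -(subrK B (_ \o _)) -addrA; apply: sn_add => //.
  by apply: orbit_diff; case: cB.
have [D [W1 [cD e1 e2 s]]] := h; exists D, W1; split=> //.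
apply: sim_trans s _; exists (K^-1)%g.
by rewrite orbit_nullspace //; case: cB.
Qed.

(** With [T] the pseudo-inverse of [B], the operator 1 + (B' - B)T sends [B x] to [B' x]. Equality
    of the nullspaces makes it injective on the range of [B], so it can be repaired to a group
    element without changing it there. *)
Lemma range_complete B B' : closed_range_op B -> bounded_op B' ->
  sn_set S (B' - B) -> nullspace B' = nullspace B ->
  exists G, B' = Gl_op G \o B.
Proof.
move=> hB B'b B'B NN; have [T [Tb TB BT]] := pseudo_inverse hB.
have [sR cR] := range_csub hB; have [sN cN] := nullspace_csub hB.1.
pose L := idfun + ((B' - B) \o T).
have LS : oneS S L.
  by apply: oneS_add; [exact: oneS_id|have [] := sn_mul Tb B'B].
have LB x : L (B x) = B' x.
  have rB : range B (B x) by exists x.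
  rewrite -[LHS]/(B x + (B' (T (B x)) - B (T (B x)))) BT (orthproj_id sR cR rB).
  rewrite addrC subrK TB (opB B'b).
  have := orthproj_in sN cN x; rewrite -NN => ->; exact: subr0.
have Li y : range B y -> L y = 0 -> y = 0.
  by move=> [x _ <-]; rewrite LB => h; have : nullspace B' x by []; rewrite NN.
have [G GL] := oneS_repair sR cR LS Li.
by exists G; apply/funext => x /=; rewrite GL ?LB //; exists x.
Qed.

(** The right factor first matches the nullspaces, after which the left factor matches the operators
    on the range. *)
Lemma in_Ck_transitive A k B B' : closed_range_op A -> in_Ck A k B -> in_Ck A k B' ->
  exists G K, B' = Gl_op G \o B \o Gl_op K.
Proof.
move=> hA hB hB'; have [K KB] := in_Ck_sim hA hB hB'.
have [BA cB _] := hB; have [B'A cB' _] := hB'.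
pose C := Gl_op (1%g : Gl S) \o B' \o Gl_op K.
have NC : nullspace C = nullspace B.
  by rewrite (orbit_nullspace _ _ (proj1 cB')) -KB -Gl_imageM mulVg Gl_op1 image_id.
have [||G CG] := @range_complete B C cB _ _ NC.
- by apply: orbit_bounded; case: cB'.
- have -> : C - B = (C - B') + ((B' - A) - (B - A)) by zmod.
  apply: sn_add; first by apply: orbit_diff; case: cB'.
  by apply: sn_add => //; exact: sn_opp.
exists G, (K^-1)%g; rewrite -CG; apply/funext => x /=.
by rewrite /C /= GlVK.
Qed.

(** * Operators of each admissible index *)

(** Each step composes [B] with the projection that kills a vector [z] orthogonal to its nullspace.
    Such a [z] exists as long as fewer dimensions have been added than the complement of the
    nullspace of [A] offers. *)
Lemma in_Ck_exists_pos A j : closed_range_op A ->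
  has_indep (orthc (nullspace A)) j ->
  exists B, [/\ closed_range_op B, sn_set S (B - A) & ext j (nullspace A) (nullspace B)].
Proof.
move=> hA; have [sV cV] := nullspace_csub hA.1.
elim: j => [_|j IH hj].
  by exists A; split=> //; [rewrite subrr; exact: sn_set0|exact: ext0].
have [B [cB BA e]] := IH (has_indepW (orthc_subspace _) (leqnSn j) hj).
have [Bb _] := cB; have [sW cW] := nullspace_csub Bb.
have [T [Tb TB _]] := pseudo_inverse cB.
have [x Wx] : exists x, ~ nullspace B x.
  apply: contrapT => /forallNP h.
  have : has_indep (nullspace B `&` orthc (nullspace A)) (j + 1).
    by rewrite addn1; apply: subset_has_indep hj => u ou; split=> //; exact: (contrapT (h u)).
  move=> /(ext_has_indep (conj sV cV) (orthc_subspace _) e)[v vP vi].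
  have [Vv ov] := vP ord0; have := vi (fun=> 1).
  rewrite big_ord1 (orthc_disjoint Vv ov) scaler0 => /(_ erefl ord0)/eqP.
  by rewrite oner_eq0.
have [oz z0 _] := orth_part sW cW Wx; set z := x - _ in oz z0.
have Wz : ~ nullspace B z.
  by move=> Wz; case/eqP: z0; exact: orthc_disjoint Wz oz.
pose w := (hdot z z)^-1 *: z.
pose B' := B - rank1 z (B w).
have B'b : bounded_op B' by apply: bounded_opB => //; exact: rank1_bounded.
pose p := idfun - rank1 z w.
have pE u : p u = u - (hdot u z / hdot z z) *: z.
  by rewrite -[p u]/(u - hdot u z *: ((hdot z z)^-1 *: z)) scalerA.
have B'p u : B' u = B (p u).
  by rewrite -[B' u]/(B u - hdot u z *: B w) -(opZ Bb) -(opB Bb).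
have pz u : hdot (p u) z = 0.
  by rewrite pE dotBl dotZl divfK ?subrr // dotxx_eq0.
have p_id u : hdot u z = 0 -> p u = u.
  by move=> uz; rewrite pE uz mul0r scale0r subr0.
have pb : bounded_op p by apply: bounded_opB; [exact: bounded_op_id|exact: rank1_bounded].
exists B'; split.
- apply: (@generalized_inverse_closed_range _ (p \o T)) => //; first exact: bounded_op_comp.
  move=> u; rewrite !B'p /= TB.
  have Nu := orthproj_in sW cW (p u).
  have h : hdot (p u - orthproj (nullspace B) (p u)) z = 0.
    by rewrite dotBl pz (dot_sym0 (oz _ Nu)) subrr.
  by rewrite !(p_id _ h) (opB Bb) (Nu : B _ = 0) subr0.
- rewrite /B' addrAC; apply: sn_add => //; apply: sn_opp; exact: rank1_S.
- have -> : nullspace B' = addv (nullspace B) z; last exact: extS.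
  apply/seteqP; split=> u; rewrite /nullspace /= B'p.
    by rewrite pE => h; exists (hdot u z / hdot z z).
  move=> [a Wu]; suff -> : p u = u - a *: z by [].
  rewrite pE -[in hdot u z](subrK (a *: z) u) dotDl (dot_sym0 (oz _ Wu)) add0r dotZl.
  by rewrite mulfK // dotxx_eq0.
Qed.

(** Each step sends a kernel vector to a vector outside the range, which shrinks the nullspace and
    enlarges the range by one dimension; both chains are tracked so that both kinds of vectors
    remain available. *)
Lemma in_Ck_exists_neg A j : closed_range_op A ->
  has_indep (nullspace A) j -> has_indep (orthc (range A)) j ->
  exists B, [/\ closed_range_op B, sn_set S (B - A),
    ext j (nullspace B) (nullspace A) & ext j (range A) (range B)].
Proof.
move=> hA; have [sV cV] := nullspace_csub hA.1; have [sR cR] := range_csub hA.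
elim: j => [_ _|j IH hj hj'].
  by exists A; split=> //; [rewrite subrr; exact: sn_set0|exact: ext0|exact: ext0].
have [B [cB BA e e']] := IH (has_indepW sV (leqnSn j) hj)
  (has_indepW (orthc_subspace _) (leqnSn j) hj').
have [Bb _] := cB; have [sW cW] := nullspace_csub Bb; have [sRB cRB] := range_csub cB.
have [x [Wx x0]] : exists x, nullspace B x /\ x != 0.
  have : has_indep (nullspace A `&` setT) (j + 1) by rewrite setIT addn1.
  move=> /(ext_has_indep (conj sW cW) _ e)[//|v vP vi].
  exists (v ord0); split; first by case: (vP ord0).
  apply/eqP => v0; have := vi (fun=> 1); rewrite big_ord1 v0 scaler0 => /(_ erefl ord0)/eqP.
  by rewrite oner_eq0.
have [y Ry] : exists y, ~ range B y.
  apply: contrapT => /forallNP h.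
  have : has_indep (range B `&` orthc (range A)) (j + 1).
    by rewrite addn1; apply: subset_has_indep hj' => u ou; split=> //; exact: (contrapT (h u)).
  move=> /(ext_has_indep (conj sR cR) (orthc_subspace _) e')[v vP vi].
  have [Vv ov] := vP ord0; have := vi (fun=> 1).
  rewrite big_ord1 (orthc_disjoint Vv ov) scaler0 => /(_ erefl ord0)/eqP.
  by rewrite oner_eq0.
pose B' := B + rank1 x y.
have B'E u : B' u = B u + hdot u x *: y by [].
have B'b : bounded_op B' by apply: bounded_opD => //; exact: rank1_bounded.
have xx : hdot x x != 0 by rewrite dotxx_eq0.
have NB' u : nullspace B' u <-> nullspace B u /\ hdot u x = 0.
  rewrite /nullspace /= B'E; split=> [h|[-> ->]]; last by rewrite scale0r addr0.
  have ux : hdot u x = 0.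
    apply/eqP/negPn/negP => ux; apply: Ry; exists (- (hdot u x)^-1 *: u) => //.
    have /eqP := h; rewrite addr_eq0 => /eqP h1.
    by rewrite (opZ Bb) h1 scaleNr scalerN opprK scalerA mulVf ?scale1r.
  by move: h; rewrite ux scale0r addr0.
have RB' : range B' = addv (range B) y.
  apply/seteqP; split=> [_ [u _ <-]|u [a [w _ wE]]].
    by exists (hdot u x); rewrite B'E addrK; exists u.
  exists (w + ((a - hdot w x) / hdot x x) *: x) => //.
  rewrite B'E (opD Bb) (opZ Bb) (Wx : B x = 0) scaler0 addr0 dotDl dotZl divfK //.
  by rewrite [_ + (_ - _)]addrC subrK wE subrK.
have NB : nullspace B = addv (nullspace B') x.
  apply/seteqP; split=> u.
    move=> Bu; exists (hdot u x / hdot x x); apply/NB'; split.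
      by apply: subspaceB => //; exact: subspaceZ.
    by rewrite dotBl dotZl divfK ?subrr.
  by apply: addv_sub => // w /NB'[].
exists B'; split.
- split=> //; rewrite RB'; exact: addv_closed.
- rewrite /B' addrAC; apply: sn_add => //; exact: rank1_S.
- rewrite -addn1; apply: ext_trans e; rewrite NB; apply: extS; first exact: ext0.
  by move=> /NB'[_ /eqP]; rewrite (negbTE xx).
- by rewrite RB'; exact: extS.
Qed.

Lemma in_Ck_exists A k : closed_range_op A -> index_range A k -> exists B, in_Ck A k B.
Proof.
move=> hA /andP[k1 k2]; have [sV cV] := nullspace_csub hA.1.
have cVV : csub (nullspace A) by [].
case: k k1 k2 => [j _ hj|j + _].
  have [B [cB BA e]] := in_Ck_exists_pos hA (hdim_geP (orthc_subspace _) hj).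
  exists B; rewrite -[Posz j]subr0; apply: (@cod_in_Ck _ _ j 0) => //.
  exists (nullspace A), (nullspace B); split=> //; [exact: ext0|exact: sim_refl].
(* A negative index is [- j.+1], and the bound becomes a lower bound [j.+1] for both dimensions,
   which may be infinite. *)
rewrite NegzE rmorphN /= EFinN leeN2 le_min => /andP[h1 h2].
have [B [cB BA e _]] := in_Ck_exists_neg hA (hdim_geP sV h1) (hdim_geP (orthc_subspace _) h2).
exists B; rewrite -[- _]add0r; apply: (@cod_in_Ck _ _ 0 j.+1) => //.
exists (nullspace B), (nullspace B); split=> //; [exact: nullspace_csub cB.1|exact: ext0|exact: sim_refl].
Qed.

End ClosedRange.

(** * The ideal as a Banach algebra *)

Section IdealAlgebra.
Context {R : realType} {H : hilbertType R} (S : sn_ideal H).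
Implicit Types (x y z u v : H) (A B C L T : H -> H) (G K : Gl S) (X Y Z : sn_type S).

Lemma opnorm_has_sup A : bounded_op A ->
  has_sup [set complex.Re `|A x| | x in [set x : H | `|x| <= 1]].
Proof.
move=> Ab; have /bounded_op_hnP[_ [C C0 AC]] := Ab; split.
  by exists (complex.Re `|A 0|), 0 => //=; rewrite normr0 ler01.
exists C => _ [x /= x1 <-]; apply: le_trans (AC x) _.
rewrite -[leRHS]mulr1; apply: ler_wpM2l; first exact: ltW.
by rewrite -lecR -hnE.
Qed.

Lemma opnormP A x : bounded_op A -> hn (A x) <= opnorm A * hn x.
Proof.
move=> Ab; have [->|x0] := eqVneq x 0; first by rewrite (op0 Ab) hn0 mulr0.
have nx : 0 < hn x by rewrite hn_gt0.
have [_ h2] := @normalize _ _ setT x (conj I (fun _ _ _ _ _ => I)) I x0.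
rewrite -ler_pdivrMr //.
have -> : hn (A x) / hn x = complex.Re `|A ((hn x)^-1%:C%C *: x)|.
  by rewrite -[RHS]/(hn _) (opZ Ab) hnZr ger0_norm ?invr_ge0 ?hn_ge0 // mulrC.
apply: sup_upper_bound; first exact: opnorm_has_sup.
by exists ((hn x)^-1%:C%C *: x) => //=; rewrite hnE h2.
Qed.

Lemma opnorm_ge0 A : bounded_op A -> 0 <= opnorm A.
Proof.
move=> Ab; apply: le_trans (hn_ge0 (A 0)) _.
apply: sup_upper_bound; first exact: opnorm_has_sup.
by exists 0 => //=; rewrite normr0 ler01.
Qed.

Lemma opnorm_le A (C : R) : bounded_op A -> 0 <= C ->
  (forall x, hn (A x) <= C * hn x) -> opnorm A <= C.
Proof.
move=> Ab C0 AC; apply: ge_sup; first by have [] := opnorm_has_sup Ab.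
move=> _ [x /= x1 <-]; apply: le_trans (AC x) _.
rewrite -[leRHS]mulr1; apply: ler_wpM2l => //.
by rewrite -lecR -hnE.
Qed.

Lemma opnorm_id : opnorm (idfun : H -> H) <= 1.
Proof. by apply: opnorm_le => [||x] //; [exact: bounded_op_id|rewrite mul1r]. Qed.

Lemma sn_norm_ge0 B : sn_set S B -> 0 <= sn_norm S B.
Proof. by move=> SB; exact: (normr_ge0 (BsElem (sn_type_pred SB) : sn_type S)). Qed.

Lemma sn_norm_comp B T : sn_set S B -> bounded_op T ->
  sn_norm S (T \o B) <= opnorm T * sn_norm S B /\
  sn_norm S (B \o T) <= sn_norm S B * opnorm T.
Proof.
move=> SB Tb; have i1 := opnorm_id; have n0 := sn_norm_ge0 SB.
have ib : bounded_op (idfun : H -> H) by exact: bounded_op_id.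
have i0 := opnorm_ge0 ib; have t0 := opnorm_ge0 Tb.
split.
  apply: le_trans (sn_norm_ideal Tb SB ib) _.
  by rewrite ler_piMr // mulr_ge0.
apply: le_trans (sn_norm_ideal ib SB Tb) _.
by apply: ler_wpM2r => //; rewrite ler_piMl.
Qed.

Lemma hdim_line y (W : set H) : subspace W -> W y -> y != 0 ->
  (forall x, W x -> exists a : R[i], x = a *: y) -> hdim W = 1%E.
Proof.
move=> sW Wy y0 h; apply/(hdim_eqP 1 sW); split; last exact: span1_dim h.
exists (fun=> y) => // a; rewrite big_ord1 => /eqP.
by rewrite scaler_eq0 (negbTE y0) orbF => /eqP a0 i; rewrite ord1.
Qed.

(* B composed with the projection onto the line of x has rank one. *)
Lemma sn_norm_opP B x : sn_set S B -> hn (B x) <= sn_norm S B * hn x.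
Proof.
move=> SB; have Bb := sn_bounded SB; have n0 := sn_norm_ge0 SB.
have [->|Bx0] := eqVneq (B x) 0; first by rewrite hn0 mulr_ge0 // hn_ge0.
have x0 : x != 0 by apply/eqP => x0; case/eqP: Bx0; rewrite x0 (op0 Bb).
have xx0 : hdot x x != 0 by rewrite dotxx_eq0.
pose p := rank1 x ((hdot x x)^-1 *: x).
have pb : bounded_op p by exact: rank1_bounded.
have px : p x = x by rewrite /p /rank1 scalerA divff // scale1r.
have p1 : opnorm p <= 1.
  apply: opnorm_le => // u; rewrite mul1r.
  have h1 : hdot (u - p u) x = 0.
    by rewrite dotBl /p /rank1 scalerA dotZl divfK // subrr.
  have h : hdot (p u) (u - p u) = 0.
    by rewrite {1}/p /rank1 scalerA dotZl (dot_sym0 h1) mulr0.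
  by have := orth_le h; rewrite addrC subrK.
have Bpb : bounded_op (B \o p) by exact: bounded_op_comp.
have dB : hdim (range (B \o p)) = 1%E.
  apply: (@hdim_line (B x)) => //; first exact: range_subspace.
    by exists x => //=; rewrite px.
  move=> _ [u _ <-] /=; rewrite /p /rank1 scalerA (opZ Bb).
  by exists (hdot u x * (hdot x x)^-1).
have [_ h] := sn_norm_comp SB pb; rewrite sn_norm_rank1 // in h.
have := opnormP x Bpb; rewrite /= px => /le_trans; apply.
apply: ler_wpM2r; first exact: hn_ge0.
by apply: le_trans h _; rewrite ler_piMr.
Qed.

Lemma opnorm_sn B : sn_set S B -> opnorm B <= sn_norm S B.
Proof.
move=> SB; apply: opnorm_le; [exact: sn_bounded SB|exact: sn_norm_ge0|].
by move=> x; exact: sn_norm_opP.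
Qed.

Definition mkS B (SB : sn_set S B) : sn_type S := BsElem (sn_type_pred SB).

Definition opS X : H -> H := bs_val X.

Lemma opS_inj : injective opS.
Proof. by move=> X Y h; apply: val_inj. Qed.

Lemma opSS X : sn_set S (opS X).
Proof. exact: (bs_valS X). Qed.

Lemma opSb X : bounded_op (opS X).
Proof. exact: sn_bounded (opSS X). Qed.

Lemma opSD X Y u : opS (X + Y) u = opS X u + opS Y u. Proof. by []. Qed.
Lemma opSN X u : opS (- X) u = - opS X u. Proof. by []. Qed.
Lemma opSZ (a : R) X u : opS (a *: X) u = (a%:C)%C *: opS X u. Proof. by []. Qed.
Lemma opS0 u : opS 0 u = 0. Proof. by []. Qed.

Lemma opS_ext X Y : (forall u, opS X u = opS Y u) -> X = Y.
Proof. by move=> h; apply: opS_inj; apply/funext. Qed.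

Section BoundedMul.
Variables (T : H -> H) (Tb : bounded_op T).

Definition lmulS X : sn_type S := mkS (proj1 (sn_mul Tb (opSS X))).
Definition rmulS X : sn_type S := mkS (proj2 (sn_mul Tb (opSS X))).

Lemma lmulSE X u : opS (lmulS X) u = T (opS X u). Proof. by []. Qed.
Lemma rmulSE X u : opS (rmulS X) u = opS X (T u). Proof. by []. Qed.

Lemma lmulS_linear : linear lmulS.
Proof. by move=> a X Y; apply: opS_ext => u; rewrite opSD opSZ !lmulSE opSD opSZ (opD Tb) (opZ Tb). Qed.
Lemma rmulS_linear : linear rmulS.
Proof. by move=> a X Y; apply: opS_ext. Qed.

Lemma lmulS_bound X : `|lmulS X| <= opnorm T * `|X|.
Proof. by have [] := sn_norm_comp (opSS X) Tb. Qed.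
Lemma rmulS_bound X : `|rmulS X| <= opnorm T * `|X|.
Proof. by rewrite mulrC; have [] := sn_norm_comp (opSS X) Tb. Qed.

Lemma lmulS_continuous : continuous lmulS.
Proof. exact: bounded_linear_continuousE lmulS_linear lmulS_bound. Qed.
Lemma rmulS_continuous : continuous rmulS.
Proof. exact: bounded_linear_continuousE rmulS_linear rmulS_bound. Qed.

Lemma analytic_lmulS (E : normedModType R) (f : E -> sn_type S) (e : E) :
  analytic_at f e -> analytic_at (fun p => lmulS (f p)) e.
Proof.
move=> fa; apply: (analytic_comp (g := lmulS) fa).
by apply: analytic_linear; [exact: lmulS_linear|exact: lmulS_continuous].
Qed.
Lemma analytic_rmulS (E : normedModType R) (f : E -> sn_type S) (e : E) :
  analytic_at f e -> analytic_at (fun p => rmulS (f p)) e.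
Proof.
move=> fa; apply: (analytic_comp (g := rmulS) fa).
by apply: analytic_linear; [exact: rmulS_linear|exact: rmulS_continuous].
Qed.
End BoundedMul.

Definition mulS X Y : sn_type S := lmulS (opSb X) Y.

Lemma mulSE X Y u : opS (mulS X Y) u = opS X (opS Y u). Proof. by []. Qed.

Lemma mulS_linear_r X : linear (mulS X). Proof. exact: lmulS_linear. Qed.
Lemma mulS_linear_l Y : linear (mulS^~ Y).
Proof. by move=> a X Z; apply: opS_ext. Qed.

Lemma mulS_bound X Y : `|mulS X Y| <= 1 * `|X| * `|Y|.
Proof.
rewrite mul1r; apply: le_trans (lmulS_bound _ _) _.
by apply: ler_wpM2r => //; exact: opnorm_sn (opSS X).
Qed.

Lemma analytic_mulS (E : normedModType R) (f g : E -> sn_type S) (e : E) :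
  analytic_at f e -> analytic_at g e -> analytic_at (fun p => mulS (f p) (g p)) e.
Proof.
move=> fa ga; apply: (analytic_comp2 (g := fun p => mulS p.1 p.2) fa ga).
exact: (analytic_bilinear (f e, g e) mulS_linear_r mulS_linear_l ler01 mulS_bound).
Qed.

Lemma analyticN (E : normedModType R) (f : E -> sn_type S) (e : E) :
  analytic_at f e -> analytic_at (fun p => - f p) e.
Proof.
move=> fa; apply: (analytic_comp (g := -%R) fa); apply: analytic_linear.
  by move=> a X Y; rewrite opprD scalerN.
exact: opp_continuous.
Qed.

Lemma Gl_opE G u : Gl_op G u = u + opS (Gl_chart S G) u.
Proof.
by rewrite -[opS _ u]/(Gl_op G u - u) addrC subrK.
Qed.

Lemma Gl_chart_inj : injective (Gl_chart S).
Proof.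
move=> G K h; apply: Gl_inj; apply/funext => u.
by rewrite !Gl_opE h.
Qed.

Definition Sinv X := invertible (idfun + opS X).

Lemma Sinv_sub X : sn_set S ((idfun + opS X) - idfun).
Proof. by rewrite addrAC subrr add0r; exact: opSS. Qed.

(** The inverse of the chart, with the default value 1 where 1 + X is not invertible. *)
Definition toGl X : Gl S :=
  if pselect (Sinv X) is left h then Gl_of (Sinv_sub X) h else 1%g.

Lemma toGlE X u : Sinv X -> Gl_op (toGl X) u = u + opS X u.
Proof. by rewrite /toGl; case: pselect. Qed.

Lemma toGlK X : Sinv X -> Gl_chart S (toGl X) = X.
Proof.
move=> hX; apply: opS_ext => u; apply: (@addrI _ u).
by rewrite -Gl_opE toGlE.
Qed.

Lemma Sinv_chart G : Sinv (Gl_chart S G).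
Proof.
have -> : Sinv (Gl_chart S G) = invertible (Gl_op G); last exact: Gl_invertible.
by congr invertible; apply/funext => u; rewrite Gl_opE.
Qed.

Lemma chartK G : toGl (Gl_chart S G) = G.
Proof. by apply: Gl_chart_inj; apply: toGlK; exact: Sinv_chart. Qed.

Lemma Sinv_injective X : (forall u, u + opS X u = 0 -> u = 0) -> Sinv X.
Proof.
move=> h; apply: riesz_invertible => //.
- by apply: bounded_opD; [exact: bounded_op_id|exact: opSb].
- by apply: sn_compact; exact: Sinv_sub.
Qed.

(** The norm of S dominates the operator norm, so [u = - X u] forces [u = 0]; invertibility then
    comes from Riesz theory, before any Neumann series. *)
Lemma Sinv_small X : `|X| < 1 -> Sinv X.
Proof.
move=> X1; apply: Sinv_injective => u /eqP; rewrite addr_eq0 => /eqP uX.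
apply/eqP; rewrite -hn_eq0 eq_le hn_ge0 andbT leNgt; apply/negP => u0.
have := sn_norm_opP u (opSS X); rewrite -[sn_norm S _]/(`|X|) -hnN -uX => h.
by have : `|X| * hn u < 1 * hn u; [rewrite ltr_pM2r|lra].
Qed.

(** Inversion read in the chart: (1 + X)^-1 - 1. *)
Definition invS X : sn_type S := Gl_chart S ((toGl X)^-1)%g.

Lemma invS_l X u : Sinv X -> (u + opS X u) + opS (invS X) (u + opS X u) = u.
Proof. by move=> hX; rewrite -(toGlE u hX) /invS -Gl_opE GlK. Qed.

Lemma invS_chart G : invS (Gl_chart S G) = Gl_chart S (G^-1)%g.
Proof. by rewrite /invS chartK. Qed.

(** The product has [n.+1] factors: S contains no unit in general, so there is no empty product. *)
Fixpoint cprod n (w : nat -> sn_type S) : sn_type S :=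
  if n is n'.+1 then mulS (w 0%N) (cprod n' (fun j => w j.+1)) else w 0%N.

(* the Neumann series of (1 + X)^-1 - 1 *)
Definition neumann n (w : nat -> sn_type S) : sn_type S :=
  if n is n'.+1 then (-1) ^+ n *: cprod n' w else 0.

Lemma cprod_bound n w : `|cprod n w| <= \prod_(i < n.+1) `|w i|.
Proof.
elim: n w => [|n IH] w; first by rewrite big_ord1.
rewrite big_ord_recl; apply: le_trans (mulS_bound _ _) _; rewrite mul1r.
by apply: ler_wpM2l => //; exact: (IH (fun j => w j.+1)).
Qed.

Lemma neumann_fps : fps neumann 1 1.
Proof.
split.
- move=> [//|n] w w' ww'; congr (_ *: _).
  elim: n w w' ww' => [|n IH] w w' ww' /=; first exact: ww'.
  by rewrite ww' // (IH _ (fun j => w' j.+1)) // => i lti; exact: ww'.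
- move=> [//|n] w i k x y lti /=.
  rewrite scalerA [k * _]mulrC -scalerA -scalerDr; congr (_ *: _).
  elim: n w i lti => [|n IH] w [|i] lti //=.
    exact: mulS_linear_l.
  have E Z : (fun j => upd w i.+1 Z j.+1) = upd (fun j => w j.+1) i Z by apply/funext.
  by rewrite !E IH // mulS_linear_r.
- move=> [|n] w; first by rewrite normr0 big_ord0 expr0 invr1 !mulr1.
  rewrite expr1n invr1 !mul1r normrZ normrX normrN normr1 expr1n mul1r.
  exact: cprod_bound.
Qed.

(** The telescoping identity (1 + X)(1 + s) - 1 for the partial sum [s], written without the
    unit. *)
Lemma neumann_sum X n : X + \sum_(i < n.+1) neumann i (fun=> X) +
  mulS X (\sum_(i < n.+1) neumann i (fun=> X)) = - neumann n.+1 (fun=> X).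
Proof.
have mulD Y Z : mulS X (Y + Z) = mulS X Y + mulS X Z.
  by rewrite -[Y]scale1r mulS_linear_r !scale1r.
have mulZ (a : R) Y : mulS X (a *: Y) = a *: mulS X Y.
  by apply: opS_ext => u; rewrite mulSE !opSZ (opZ (opSb X)).
elim: n => [|n IH].
  rewrite big_ord1 /= expr1 scaleN1r opprK addr0.
  by apply: opS_ext => u; rewrite opSD mulSE opS0 (op0 (opSb X)) addr0.
rewrite big_ord_recr mulD.
set s := \sum_(i < n.+1) _ in IH *; set a := neumann n.+1 _ in IH *.
have -> : X + (s + a) + (mulS X s + mulS X a) = (X + s + mulS X s) + (a + mulS X a).
  by zmod.
rewrite IH addrA addNr add0r /a /= mulZ.
by rewrite [in RHS]exprS mulN1r scaleNr opprK.
Qed.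

Lemma invS_has_fps : has_fps invS 0 neumann 1 1.
Proof.
split=> //; first exact: neumann_fps.
move=> X X1; rewrite add0r; have hX := Sinv_small X1; set J := invS X.
have key n : `|J - series (fun n => neumann n (fun=> X)) n.+1| <=
    (1 + `|J|) * `|X| ^+ n.+1.
  rewrite seriesEord /=; set s := \sum_(_ < _) _.
  (* Multiplying the telescoping identity on the left by (1 + X)^-1 = 1 + J. *)
  have -> : J - s = neumann n.+1 (fun=> X) + mulS J (neumann n.+1 (fun=> X)).
    have := neumann_sum X n; rewrite -/s => /(congr1 -%R); rewrite opprK => <-.
    apply: opS_ext => u.
    have := @invS_l X (opS s u) hX; have := @invS_l X u hX.
    rewrite !(opSD, opSN, mulSE) -/J.
    rewrite !(opN (opSb J)) !(opD (opSb J)) => h1 h2.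
    apply/eqP; rewrite -subr_eq0; apply/eqP.
    transitivity ((u + opS X u + (opS J u + opS J (opS X u)) - u) +
      (opS s u + opS X (opS s u) + (opS J (opS s u) + opS J (opS X (opS s u))) - opS s u)).
      by zmod.
    by rewrite h1 h2 !subrr addr0.
  apply: le_trans (ler_normD _ _) _.
  have h := @fps_diag _ _ _ _ _ _ X n.+1 neumann_fps ltr01.
  rewrite mul1r divr1 in h.
  rewrite mulrDl mul1r lerD //; apply: le_trans (mulS_bound _ _) _.
  by rewrite mul1r; exact: ler_wpM2l.
rewrite -cvg_shiftS; apply/cvgrPdist_le => e e0.
have h12 : `| `|X| | < 1 by rewrite normr_id.
have /cvgrPdist_le/(_ e e0)[N _ NP] := cvg_geometric ((1 + `|J|) * `|X|) h12.
exists N => // n /NP /=; rewrite sub0r normrN => h.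
apply: le_trans (key n) _; apply: le_trans h; rewrite exprS mulrA.
exact: ler_norm.
Qed.

Lemma invS_diff0 Y : 'd invS 0 Y = - Y.
Proof.
have [_ ->] := has_fps_diff invS_has_fps.
by rewrite /= expr1 scaleN1r.
Qed.

(* 1 + Y = (1 + X) (1 + quotS X Y) *)
Definition quotS X Y : sn_type S := invS X + (Y + mulS (invS X) Y).

Lemma quotS_analytic X Y : analytic_at (quotS X) Y.
Proof.
apply: (analyticD (f := fun=> invS X)); first exact: analytic_cst.
apply: (analyticD (f := id)); first exact: analytic_id.
by apply: (analytic_mulS (f := fun=> invS X)); [exact: analytic_cst|exact: analytic_id].
Qed.

Lemma quotS0 X : Sinv X -> quotS X X = 0.
Proof.
move=> hX; apply: opS_ext => u; have := invS_l u hX.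
rewrite /quotS !opSD mulSE (opD (opSb (invS X))) => E.
by rewrite opS0; apply: (@addrI _ u); rewrite addr0 -[RHS]E; zmod.
Qed.

Lemma quotS_factor X Y : Sinv X -> Sinv (quotS X Y) ->
  Sinv Y /\ toGl Y = (toGl X * toGl (quotS X Y))%g.
Proof.
move=> hX hY.
have E u : Gl_op (toGl (quotS X Y)) u = Gl_op (toGl X)^-1%g (u + opS Y u).
  rewrite toGlE // [RHS]Gl_opE -[Gl_chart _ _]/(invS X) /quotS !opSD mulSE.
  by rewrite (opD (opSb (invS X))); zmod.
have hSY : Sinv Y.
  apply: Sinv_injective => u uY; apply: (@Gl_injective _ _ _ (toGl (quotS X Y))).
  by rewrite E uY !(op0 (Gl_bounded _)).
split=> //; apply: Gl_inj; apply/funext => u.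
by rewrite Gl_opM /= E GlVK toGlE.
Qed.

Lemma quotS_near X : Sinv X -> \forall Y \near X, Sinv (quotS X Y).
Proof.
move=> hX; have hc := analytic_continuous (quotS_analytic X X).
have h1 : nbhs (quotS X X) [set Z : sn_type S | `|Z| < 1].
  apply/nbhs_ballP; exists 1 => //= Z; rewrite (quotS0 hX) -ball_normE /= sub0r normrN //.
have h2 : nbhs X [set Y | `|quotS X Y| < 1] := hc _ h1.
by apply: filterS h2 => Y; exact: Sinv_small.
Qed.

Lemma Sinv_near X : Sinv X -> \forall Y \near X, Sinv Y.
Proof.
by move=> hX; apply: filterS (quotS_near hX) => Y /(quotS_factor hX)[].
Qed.

(** Translation to 0: 1 + Y is (1 + X) times an element near 1, whose inverse is given by the
    Neumann series; the result is multiplied by (1 + X)^-1 on the right. *)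
Lemma invS_analytic X : Sinv X -> analytic_at invS X.
Proof.
move=> hX; set J := invS X.
pose g Z := invS Z + (J + mulS (invS Z) J).
have i0 : analytic_at invS (quotS X X).
  by rewrite (quotS0 hX); exact: fps_analytic invS_has_fps.
have ga : analytic_at g (quotS X X).
  apply: (analyticD (f := invS)) => //.
  apply: (analyticD (f := fun=> J)); first exact: analytic_cst.
  by apply: analytic_mulS => //; exact: analytic_cst.
apply: analytic_near (analytic_comp (quotS_analytic X X) ga).
apply: filterS (quotS_near hX) => Y hY.
have [_ E2] := quotS_factor hX hY.
apply: opS_ext => u; apply: (@addrI _ u).
have E3 : Gl_op (toGl Y)^-1%g u = Gl_op (toGl (quotS X Y))^-1%g (Gl_op (toGl X)^-1%g u).
  by rewrite E2 invgM Gl_opM.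
have -> : u + opS (invS Y) u = Gl_op (toGl Y)^-1%g u by rewrite [RHS]Gl_opE.
have -> : (g \o quotS X) Y = invS (quotS X Y) + (J + mulS (invS (quotS X Y)) J) by [].
rewrite E3 [in RHS]Gl_opE [Gl_op (toGl X)^-1%g u]Gl_opE -/(invS X) -/J -/(invS (quotS X Y)).
by rewrite !opSD mulSE (opD (opSb _)); zmod.
Qed.

End IdealAlgebra.

(** * Charts of the group and of the orbits *)

Section ChartTransport.
Context {R : realType} {M : topologicalType} (A : @atlas R M) (c : @chart R M).
Hypotheses (aA : is_atlas A) (cA : A c).
Variables (E : completeNormedModType R) (phi : model c -> E) (psi : E -> model c).
Variables (D : set (model c)) (D' : set E).
Hypotheses (Do : open D) (D'o : open D').
Hypotheses (phiD : forall x, D x -> D' (phi x)).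
Hypotheses (phiK : forall x, D x -> psi (phi x) = x) (psiK : forall y, D' y -> phi (psi y) = y).
Hypotheses (phi_an : forall x, D x -> analytic_at phi x)
  (psi_an : forall y, D' y -> analytic_at psi y).

Definition transport_chart : chart M := Chart (dom c `&` c @^-1` D) (phi \o c).

Lemma transport_dom_near p : dom transport_chart p -> nbhs p (dom transport_chart).
Proof.
have [Ac _ _] := aA; have cc := Ac _ cA.
move=> [cp Dp]; apply: nbhsI; first exact: chart_nbhs.
by apply: (chart_cont cc cp); exact: open_nbhs_nbhs.
Qed.

Lemma transport_is_chart : is_chart transport_chart.
Proof.
have [Ac _ _] := aA; have cc := Ac _ cA; split.
- by rewrite openE => p; exact: transport_dom_near.
- move=> p p' /set_mem[cp Dp] /set_mem[cp' Dp'] /= h.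
  by apply: (chart_inj cc) => //; rewrite -(phiK Dp) -(phiK Dp') h.
- move=> p /set_mem[cp Dp]; apply: continuous_comp; first exact: chart_cont.
  exact: analytic_continuous (phi_an Dp).
- move=> U Uo UD; rewrite openE => _ [p Up <-].
  have [cp Dp] := UD _ Up.
  have cU := chart_open cc cp (open_nbhs_nbhs (conj Uo Up)).
  have hc := analytic_continuous (psi_an (phiD Dp)).
  suff : nbhs (phi (c p)) ((phi \o c) @` U) by [].
  have h1 : nbhs (phi (c p)) D' by apply: open_nbhs_nbhs; split=> //; exact: phiD.
  have h2 : nbhs (phi (c p)) (psi @^-1` (c @` (U `&` dom c))).
    by apply: hc; rewrite phiK.
  apply: filterS (nbhsI h1 h2) => y [D'y [p' [Up' cp'] py]].
  by exists p' => //=; rewrite py psiK.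
Qed.

(** [phi] and [psi] are themselves the transition maps between [c] and the new chart, and the atlas
    handles the passage from [c] to other charts. *)
Lemma transport_maximal : maximal_atlas A transport_chart.
Proof.
have [Ac _ Aa] := aA; have cc := Ac _ cA; have tc := transport_is_chart.
split=> // d dA p tp dp; have [cp Dp] := tp.
have [cd dc] := Aa _ _ cA dA p cp dp.
have h1 : analytic_in transport_chart c id p.
  exists psi; last exact: psi_an (phiD Dp).
  apply: filterS (transport_dom_near tp) => x [cx Dx].
  by split=> //=; rewrite phiK.
have h2 : analytic_in c transport_chart id p.
  exists phi; last exact: phi_an.
  by apply: filterS (transport_dom_near tp) => x [cx Dx].
by split; [exact: analytic_in_comp tc cc h1 cd|exact: analytic_in_comp (Ac _ dA) cc dc h2].
Qed.

End ChartTransport.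

Section GlobalCharts.
Context {R : realType}.

Lemma global_chart_atlas (M : topologicalType) (c : @chart R M) :
  is_chart c -> dom c = setT -> is_atlas (fun d => d = c).
Proof.
move=> cc cT; split=> [_ ->//|p|_ _ -> -> p _ _]; first by exists c => //; rewrite cT.
suff h : analytic_in c c id p by split.
by exists id; [apply: nearW => x; rewrite cT|exact: analytic_id].
Qed.

Context {H : hilbertType R} (S : sn_ideal H).
Implicit Types (A B T : H -> H) (X Y Z : sn_type S).

(** The chart has open images because invertibility is an open condition in 1 + S. *)
Lemma Gl_chart_is_chart : is_chart (Gl_chart S).
Proof.
have cont : continuous (Gl_chart S : Gl S -> sn_type S).
  move=> G; apply: (@continuous_comp _ _ _ (set_val : Gl S -> aff S idfun) (@aff_vec _ _ S idfun)).
    exact: initial_continuous.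
  exact: initial_continuous.
split.
- exact: openT.
- by move=> G K _ _; exact: Gl_chart_inj.
- by move=> G _; exact: cont.
- move=> U Uo _; rewrite openE => _ [G UG <-].
  have : nbhs G U by exact: open_nbhs_nbhs.
  move=> [_ [[Q Qo <-] /= QG] QU].
  case: Qo QG QU => V Vo <- /= VG VU.
  suff : nbhs (Gl_chart S G : sn_type S) ((Gl_chart S : Gl S -> sn_type S) @` U) by [].
  have h1 : nbhs (Gl_chart S G : sn_type S) V by exact: open_nbhs_nbhs.
  apply: filterS (nbhsI h1 (Sinv_near (Sinv_chart G))) => X [VX hX].
  exists (toGl X); last exact: toGlK.
  apply: VU; rewrite /= -[aff_vec _]/(Gl_chart S (toGl X)) toGlK //.
Qed.

Lemma Gl_is_atlas : is_atlas (Gl_atlas S).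
Proof. by apply: global_chart_atlas => //; exact: Gl_chart_is_chart. Qed.

Lemma aff_of_subproof A X : ((A + opS X) - A) \in sn_set S.
Proof. by apply/mem_set; rewrite addrAC subrr add0r; exact: opSS. Qed.

Definition aff_of A X : aff S A := exist _ (A + opS X) (aff_of_subproof A X).

Lemma aff_ofK A X : aff_vec (aff_of A X : aff_sig S A) = X.
Proof.
apply: opS_ext => u; rewrite -[LHS]/(A u + opS X u - A u).
by rewrite addrAC subrr add0r.
Qed.

Lemma aff_opE A (B : aff S A) u : aff_op B u = A u + opS (aff_vec B) u.
Proof. by rewrite -[opS _ u]/(aff_op B u - A u) addrC subrK. Qed.

Lemma aff_op_inj A : injective (@aff_op _ _ S A).
Proof.
move=> [B p] [B' p']; rewrite /aff_op /= => E; subst B'.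
by rewrite (bool_irrelevance p p').
Qed.

Lemma aff_vec_inj A : injective (@aff_vec _ _ S A).
Proof.
move=> B B' h; apply: aff_op_inj; apply/funext => u.
by rewrite !aff_opE h.
Qed.

Lemma aff_vec_continuous A : continuous (@aff_vec _ _ S A : aff S A -> sn_type S).
Proof. exact: initial_continuous. Qed.

Lemma aff_chart_is_chart A : is_chart (aff_chart S A).
Proof.
split.
- exact: openT.
- by move=> B B' _ _; exact: aff_vec_inj.
- by move=> B _; exact: aff_vec_continuous.
- move=> U [Q Qo <-] _.
  suff -> : aff_chart S A @` ((@aff_vec _ _ S A) @^-1` Q) = Q by [].
  apply/seteqP; split=> [_ [B QB <-] //|X QX].
  by exists (aff_of A X); rewrite /= aff_ofK.
Qed.

Lemma aff_is_atlas A : is_atlas (aff_atlas S A).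
Proof. by apply: global_chart_atlas => //; exact: aff_chart_is_chart. Qed.

End GlobalCharts.

(** * Block elimination around a point of the orbit *)

Section SchurChart.
Context {R : realType} {H : hilbertType R} (S : sn_ideal H).
Implicit Types (x y z u v : H) (X Y Z : sn_type S).
Variables (B T : H -> H).
Hypotheses (Bb : bounded_op B) (Tb : bounded_op T).
Hypotheses (BTB : forall u, B (T (B u)) = B u) (TBT : forall u, T (B (T u)) = T u).

(** [P] and [F] are complementary projections of the domain, [F] onto the nullspace of [B]; [E]
    projects the codomain along the range of [B]. *)
Let P := T \o B.
Let E := idfun - (B \o T).
Let F := idfun - (T \o B).

Let Pb : bounded_op P. Proof. exact: bounded_op_comp. Qed.
Let Eb : bounded_op E.
Proof. by apply: bounded_opB; [exact: bounded_op_id|exact: bounded_op_comp]. Qed.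
Let Fb : bounded_op F.
Proof. by apply: bounded_opB; [exact: bounded_op_id|exact: bounded_op_comp]. Qed.

Let EE u : E u = u - B (T u). Proof. by []. Qed.
Let FE u : F u = u - T (B u). Proof. by []. Qed.
Let PE u : P u = T (B u). Proof. by []. Qed.
Let TE u : T (E u) = 0. Proof. by rewrite EE (opB Tb) TBT subrr. Qed.
Let FT u : F (T u) = 0. Proof. by rewrite FE TBT subrr. Qed.
Let BF u : B (F u) = 0. Proof. by rewrite FE (opB Bb) BTB subrr. Qed.
Let PP u : P (P u) = P u. Proof. by rewrite !PE TBT. Qed.
Let FP u : F (P u) = 0. Proof. by rewrite PE FT. Qed.
Let FF u : F (F u) = F u. Proof. by rewrite [LHS]FE BF (op0 Tb) subr0. Qed.
Let EEE u : E (E u) = E u. Proof. by rewrite [LHS]EE TE (op0 Bb) subr0. Qed.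

(** Composing with [T] turns the components along the range of [B] into operators of the domain, so
    that the blocks can be multiplied and inverted inside 1 + S. *)
Definition schur_diag X := lmulS Tb (rmulS Pb X).
Definition schur_left X := lmulS Eb (rmulS Pb X).
Definition schur_right X := lmulS Tb (rmulS Fb X).

(* In the decompositions of H given by the projections TB and BT, the operator
   B + X is a block matrix with upper left corner B (1 + schur_diag X);
   schur_quad is the subtracted term in its Schur complement. *)
Definition schur_quad X := mulS (schur_left X) (schur_right X) +
  mulS (schur_left X) (mulS (invS (schur_diag X)) (schur_right X)).

Definition schur_dom X := Sinv (schur_diag X).
Definition schur_flat X := X - schur_quad X.
Definition schur_unflat X := X + schur_quad X.

Definition corner X := lmulS Eb (rmulS Fb X).

Lemma schur_quadE X u : opS (schur_quad X) u =
  E (opS X (P (T (opS X (F u)) + opS (invS (schur_diag X)) (T (opS X (F u)))))).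
Proof.
by rewrite /schur_quad opSD !mulSE !lmulSE !rmulSE (opD Pb) (opD (opSb X)) (opD Eb).
Qed.

Lemma T_quad X u : T (opS (schur_quad X) u) = 0.
Proof. by rewrite schur_quadE TE. Qed.

Lemma quad_P X u : opS (schur_quad X) (P u) = 0.
Proof.
rewrite schur_quadE FP (op0 (opSb X)) (op0 Tb) (op0 (opSb _)) addr0.
by rewrite (op0 Pb) (op0 (opSb X)) (op0 Eb).
Qed.

(** The two conditions confine [Y] to the lower right block, which neither the diagonal block nor
    the quadratic term sees. The quadratic term itself is of this kind, so [schur_flat] and
    [schur_unflat] are inverse to each other. *)
Lemma schur_quad_shift X Y : (forall u, T (opS Y u) = 0) -> (forall u, opS Y (P u) = 0) ->
  schur_diag (X + Y) = schur_diag X /\ schur_quad (X + Y) = schur_quad X.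
Proof.
move=> TY YP.
have h : schur_diag (X + Y) = schur_diag X.
  by apply: opS_ext => u; rewrite !lmulSE !rmulSE opSD YP addr0.
split=> //; apply: opS_ext => u; rewrite !schur_quadE h !opSD YP addr0.
by rewrite (opD Tb) TY addr0.
Qed.

Lemma schur_flat_shift X : schur_diag (schur_flat X) = schur_diag X /\
  schur_quad (schur_flat X) = schur_quad X.
Proof.
by apply: schur_quad_shift => u; rewrite opSN ?quad_P ?oppr0 // (opN Tb) T_quad oppr0.
Qed.

Lemma schur_unflat_shift X : schur_diag (schur_unflat X) = schur_diag X /\
  schur_quad (schur_unflat X) = schur_quad X.
Proof. by apply: schur_quad_shift => u; [exact: T_quad|exact: quad_P]. Qed.

Lemma schur_flatK X : schur_unflat (schur_flat X) = X.
Proof. by have [_ h] := schur_flat_shift X; rewrite /schur_unflat h subrK. Qed.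

Lemma schur_unflatK X : schur_flat (schur_unflat X) = X.
Proof. by have [_ h] := schur_unflat_shift X; rewrite /schur_flat h addrK. Qed.

Lemma schur_flat_dom X : schur_dom X -> schur_dom (schur_flat X).
Proof. by rewrite /schur_dom (schur_flat_shift X).1. Qed.

Lemma schur_diag_analytic X : analytic_at schur_diag X.
Proof. by apply/analytic_lmulS/analytic_rmulS; exact: analytic_id. Qed.

Lemma schur_dom_open : open [set X | schur_dom X].
Proof.
rewrite openE => X hX.
exact: (analytic_continuous (schur_diag_analytic X)) (Sinv_near hX).
Qed.

Lemma schur_dom0 : schur_dom 0.
Proof.
apply: Sinv_injective => u; rewrite lmulSE rmulSE opS0 (op0 Tb) addr0 //.
Qed.

Lemma schur_inv_analytic X : schur_dom X -> analytic_at (fun X => invS (schur_diag X)) X.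
Proof.
move=> hX; apply: (analytic_comp (f := schur_diag)); first exact: schur_diag_analytic.
exact: invS_analytic.
Qed.

Lemma schur_left_analytic X : analytic_at schur_left X.
Proof. by apply/analytic_lmulS/analytic_rmulS; exact: analytic_id. Qed.

Lemma schur_quad_analytic X : schur_dom X -> analytic_at schur_quad X.
Proof.
move=> hX.
have ar : analytic_at schur_right X by apply/analytic_lmulS/analytic_rmulS; exact: analytic_id.
have al := schur_left_analytic X.
apply: (analyticD (f := fun X => mulS (schur_left X) (schur_right X))).
  exact: analytic_mulS.
apply: (analytic_mulS (f := schur_left)) => //; apply: analytic_mulS => //.
exact: schur_inv_analytic.
Qed.

Lemma schur_flat_analytic X : schur_dom X -> analytic_at schur_flat X.
Proof.
move=> hX; apply: (analyticD (f := id)); first exact: analytic_id.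
by apply: (analyticN (f := schur_quad)); exact: schur_quad_analytic.
Qed.

Lemma schur_unflat_analytic X : schur_dom X -> analytic_at schur_unflat X.
Proof.
move=> hX; apply: (analyticD (f := id)); first exact: analytic_id.
exact: schur_quad_analytic.
Qed.

(** The triangular factors of the elimination, minus 1: EXP(1 + TXP)^-1 T is the lower one, with
    unit diagonal, and TX the upper one, which absorbs the diagonal block 1 + TXP. *)
Definition schur_G X := rmulS Tb (schur_left X) +
  rmulS Tb (mulS (schur_left X) (invS (schur_diag X))).
Definition schur_K X := lmulS Tb X.

Lemma schur_GE X u : opS (schur_G X) u =
  E (opS X (P (T u + opS (invS (schur_diag X)) (T u)))).
Proof.
by rewrite /schur_G opSD !rmulSE mulSE !lmulSE !rmulSE (opD Pb) (opD (opSb X)) (opD Eb).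
Qed.

Lemma schur_G_analytic X : schur_dom X -> analytic_at schur_G X.
Proof.
move=> hX; have al := schur_left_analytic X.
apply: (analyticD (f := fun X => rmulS Tb (schur_left X))).
  exact: analytic_rmulS.
apply/analytic_rmulS/analytic_mulS => //; exact: schur_inv_analytic.
Qed.

Lemma schur_K_analytic X : analytic_at schur_K X.
Proof. by apply: analytic_lmulS; exact: analytic_id. Qed.

Lemma Sinv_inj Y u : Sinv Y -> u + opS Y u = 0 -> u = 0.
Proof.
move=> hY; rewrite -(toGlE u hY) => h; apply: (@Gl_injective _ _ _ (toGl Y)).
by rewrite h (op0 (Gl_bounded _)).
Qed.

(** The values of [schur_G X] are killed by [T], on which it depends, so it squares to 0 and 1 +
    [schur_G X] is invertible without a condition on [X]. *)
Lemma schur_G_inv X : Sinv (schur_G X).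
Proof.
apply: Sinv_injective => u uG.
have Tu : T u = 0.
  have := congr1 T uG; rewrite (opD Tb) schur_GE TE addr0 (op0 Tb) //.
move: uG; rewrite schur_GE Tu (op0 (opSb _)) addr0 (op0 Pb) (op0 (opSb X)) (op0 Eb).
by rewrite addr0.
Qed.

Lemma schur_K_inv X : schur_dom X -> Sinv (schur_K X).
Proof.
move=> hX; apply: Sinv_injective => u; rewrite lmulSE => uK.
have Fu : F u = 0.
  by have := congr1 F uK; rewrite (opD Fb) FT addr0 (op0 Fb).
have Pu : P u = u by move: Fu; rewrite FE => /eqP; rewrite subr_eq0 => /eqP /esym.
by apply: (Sinv_inj hX); rewrite lmulSE rmulSE Pu.
Qed.

Lemma schur_corner X u : opS (corner (schur_flat X)) u =
  E (opS X (F u)) - opS (schur_quad X) u.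
Proof.
rewrite lmulSE rmulSE opSD opSN (opB Eb); congr (_ - _).
by rewrite !schur_quadE EEE FF.
Qed.

Lemma schur_factor X u : schur_dom X ->
  B u + opS X u = Gl_op (toGl (schur_G X)) (B (Gl_op (toGl (schur_K X)) u) +
    opS (corner (schur_flat X)) (Gl_op (toGl (schur_K X)) u)).
Proof.
move=> hX; rewrite (toGlE u (schur_K_inv hX)) (toGlE _ (schur_G_inv X)).
rewrite [opS (schur_K X) u]lmulSE.
set Q := corner (schur_flat X); set v := u + T (opS X u).
have TQ w : T (opS Q w) = 0 by rewrite /Q lmulSE TE.
have QT w : opS Q (T w) = 0 by rewrite /Q lmulSE rmulSE FT (op0 (opSb _)) (op0 Eb).
rewrite schur_GE (opD Tb) TQ addr0 -PE.
have Pv : P v = (P u + opS (schur_diag X) (P u)) + T (opS X (F u)).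
  rewrite lmulSE rmulSE PP /v (opD Pb) [P (T _)]PE TBT -addrA; congr (_ + _).
  by rewrite -(opD Tb) -(opD (opSb X)) PE FE addrC subrK.
(* Cancels the diagonal block: applying (1 + TXP)^-1 to [P v] leaves [P u] plus the term that
   produces the Schur complement. *)
have WPv : P v + opS (invS (schur_diag X)) (P v) =
    P u + (T (opS X (F u)) + opS (invS (schur_diag X)) (T (opS X (F u)))).
  rewrite Pv (opD (opSb (invS _))) addrACA.
  by rewrite invS_l.
rewrite WPv (opD Pb) (opD (opSb X)) (opD Eb) -schur_quadE PP.
rewrite /v (opD Bb) (opD (opSb Q)) QT addr0 /Q schur_corner.
(* The value of [X] is split by BT and [E], and its argument by [P] and [F] in the second part. *)
have -> : opS X u = B (T (opS X u)) + (E (opS X (P u)) + E (opS X (F u))).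
  by rewrite -(opD Eb) -(opD (opSb X)) PE FE [_ + (u - _)]addrC subrK EE addrC subrK.
rewrite (opD Tb) (opD Tb) !TE addr0 addr0 TBT; zmod.
Qed.

Lemma corner_linear : linear corner.
Proof. by move=> a X Y; rewrite /corner rmulS_linear lmulS_linear. Qed.

Lemma corner_continuous : continuous corner.
Proof.
move=> X; apply: (@continuous_comp _ _ _ (rmulS Fb) (lmulS Eb)).
  exact: rmulS_continuous.
exact: lmulS_continuous.
Qed.

Lemma corner_idem X : corner (corner X) = corner X.
Proof. by apply: opS_ext => u; rewrite /corner !lmulSE !rmulSE !lmulSE !rmulSE EEE FF. Qed.

Lemma corner_in_Ck A k X : closed_range_op A -> in_Ck S A k B -> schur_dom X ->
  in_Ck S A k (B + opS X) <-> corner (schur_flat X) = 0.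
Proof.
move=> hA hB hX; set Q := corner (schur_flat X).
set G := toGl (schur_G X); set K := toGl (schur_K X).
have factor : B + opS X = Gl_op G \o (B + opS Q) \o Gl_op K.
  by apply/funext => u; rewrite -[LHS]/(B u + opS X u) schur_factor.
split=> [h|Q0]; last first.
  rewrite factor Q0; apply: orbit_in_Ck => //.
  by rewrite (_ : B + opS 0 = B) //; exact: addr0.
have hB' : in_Ck S A k (B + opS Q).
  have -> : B + opS Q = Gl_op (G^-1)%g \o (B + opS X) \o Gl_op (K^-1)%g.
    by rewrite factor; apply/funext => u; rewrite /= GlK GlVK.
  exact: orbit_in_Ck.
have TQ w : T (opS Q w) = 0 by rewrite /Q lmulSE TE.
(* BT kills [Q] and fixes [B], so it sends the equation [B u + Q u = 0] to [B u = 0]; the inclusion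
   is then an equality since the indices agree. Consequently [Q] vanishes on the nullspace of [B],
   the image of [F]. *)
have NN : nullspace (B + opS Q) = nullspace B.
  apply: (in_Ck_nested hA hB' hB) => u; rewrite /nullspace /= => Nu.
  have := congr1 (B \o T) Nu; rewrite /= (opD Tb) (opD Bb) BTB TQ (op0 Tb) (op0 Bb).
  by rewrite addr0.
apply: opS_ext => u.
have : nullspace (B + opS Q) (F u) by rewrite NN /nullspace /= BF.
rewrite /nullspace /= -[LHS]/(B (F u) + opS Q (F u)) BF add0r => QF.
transitivity (opS Q (F u)); last exact: QF.
by rewrite -[LHS]/(E (opS (schur_flat X) (F u)))
  -[RHS]/(E (opS (schur_flat X) (F (F u)))) FF.
Qed.

End SchurChart.

Lemma raw_linear0 (R : nzRingType) (E F : lmodType R) (f : E -> F) : linear f -> f 0 = 0.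
Proof. by move=> fl; have := fl (-1) 0 0; rewrite scaler0 addr0 scaleN1r addNr. Qed.

Section KernelSubspace.
Context {R : realType} {E : completeNormedModType R} {F : normedModType R}.
Variables (f : E -> F) (fl : linear f) (fc : continuous f).

Let ker0 : f 0 = 0. Proof. exact: raw_linear0. Qed.

Let kerP (a : R) x y : f x = 0 -> f y = 0 -> f (a *: x + y) = 0.
Proof. by rewrite fl => -> ->; rewrite scaler0 addr0. Qed.

Let ker_closed : closed [set x | f x = 0].
Proof.
apply: (@closed_comp _ _ f [set 0]); first by move=> x _; exact: fc.
exact/accessible_closed_set1/hausdorff_accessible/norm_hausdorff.
Qed.

Definition kernel_subspace : closed_subspace E :=
  @ClosedSubspace R E [set x | f x = 0] ker0 kerP ker_closed.

End KernelSubspace.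

Section SplitSurjection.
Context {R : realType} {E F : completeNormedModType R}.

(** The complement of the kernel of [f] is the image of the right inverse [g], obtained as the
    closed kernel of [1 - g f]. *)
Lemma split_surjection (f : E -> F) (g : F -> E) : linear f -> continuous f ->
  linear g -> continuous g -> (forall y, f (g y) = y) ->
  range f = setT /\ exists K K' : closed_subspace E,
    f @^-1` [set 0] = K /\ topological_complement K K'.
Proof.
move=> fl fc gl gc fg; split.
  by apply/seteqP; split=> // y _; exists (g y).
have fB x y : f (x - y) = f x - f y.
  by rewrite -[in LHS](scaleN1r y) [x + _]addrC fl scaleN1r addrC.
have hl : linear (fun x => x - g (f x)).
  by move=> a x y; rewrite fl gl scalerBr opprD addrACA.
have hc : continuous (fun x => x - g (f x)).
  move=> x; apply: (@continuousB _ _ _ id (g \o f)); first exact: cvg_id.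
  by apply: continuous_comp; [exact: fc|exact: gc].
exists (kernel_subspace fl fc), (kernel_subspace hl hc); split; first by [].
split.
  have f0 := raw_linear0 fl; have g0 := raw_linear0 gl.
  apply/seteqP; split=> [x [/= fx]|_ ->] /=; first by rewrite fx g0 subr0.
  by rewrite f0 g0 subr0.
move=> x; exists (x - g (f x)) => /=; first by rewrite fB fg subrr.
have -> : x - (x - g (f x)) = g (f x) by zmod.
by rewrite fg subrr.
Qed.

End SplitSurjection.

Section CkManifold.
Context {R : realType} {H : hilbertType R} (S : sn_ideal H).
Context (A : H -> H) (hA : closed_range_op A) (k : int).
Implicit Types (X Y Z V : sn_type S) (p : Ck S A k).

(** From BTB = B alone, replacing [T] by TBT yields both identities. *)
Lemma reflexive_inverse (B : H -> H) : closed_range_op B -> exists T, [/\ bounded_op T,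
  forall u, B (T (B u)) = B u & forall u, T (B (T u)) = T u].
Proof.
move=> hB; have [T [Tb TB BT]] := pseudo_inverse hB; have [Bb _] := hB.
have [sR cR] := range_csub hB.
have BTB u : B (T (B u)) = B u by rewrite BT orthproj_id //; exists u.
exists (T \o (B \o T)); split=> [|u|u] /=; last by rewrite !BTB.
  by do 2 apply: bounded_op_comp => //.
by rewrite !BTB.
Qed.

Lemma Ck_opE p u : Ck_op p u = A u + opS (aff_vec (set_val p)) u.
Proof. exact: aff_opE. Qed.

Lemma Ck_op_inj : injective (@Ck_op _ _ S A k).
Proof. by move=> p p' h; apply: val_inj; exact: aff_op_inj h. Qed.

Lemma aff_sub (b : aff S A) : sn_set S (aff_op b - A).
Proof. exact: set_mem (valP b). Qed.

Lemma CkP (b : aff S A) : Ck S A k b <-> in_Ck S A k (aff_op b).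
Proof. by split=> [[h1 h2]|[_ h1 h2]]; split=> //; exact: aff_sub. Qed.

Lemma Ck_in p : in_Ck S A k (Ck_op p).
Proof. by apply/CkP; exact: set_valP. Qed.

Lemma Ck_bounded p : bounded_op (Ck_op p).
Proof. by have [_ []] := Ck_in p. Qed.

Lemma Ck_of_subproof B (hB : in_Ck S A k B) :
  exists p : Ck S A k, Ck_op p = B.
Proof.
have [BA _ _] := hB.
pose b : aff S A := exist _ B (mem_set BA).
have hb : Ck S A k b by apply/CkP.
by exists (SigSub (mem_set hb)).
Qed.

Lemma Ck_submanifold : submanifold (aff_atlas S A) (Ck S A k).
Proof.
move=> b0 hb0; set B := aff_op b0; set v0 := aff_vec b0.
have hB : in_Ck S A k B by apply/CkP.
have [_ cB _] := hB; have [Bb _] := cB.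
have [T [Tb BTB TBT]] := reflexive_inverse cB.
pose D : set (sn_type S) := [set V | schur_dom Bb Tb (V - v0)].
pose D' : set (sn_type S) := [set X | schur_dom Bb Tb X].
(* The chart of A + S measures from [A], the Schur chart from [B]; subtracting [v0] recentres. *)
pose phi V := schur_flat Bb Tb (V - v0).
pose psi X := schur_unflat Bb Tb X + v0.
pose c := @transport_chart _ _ (aff_chart S A) (sn_type S) phi D.
have sub_an V : analytic_at (fun V : sn_type S => V - v0) V.
  apply: (analyticD (f := id)); first exact: analytic_id.
  exact: analytic_cst.
have D'o : open D' by exact: schur_dom_open.
have cmax : maximal_atlas (aff_atlas S A) c.
  apply: (@transport_maximal _ _ _ _ (aff_is_atlas S A) erefl _ _ psi _ D') => //.
  - rewrite openE => V DV.
    have h : nbhs (V - v0) D' by exact: open_nbhs_nbhs.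
    exact: (analytic_continuous (sub_an V)) h.
  - by move=> V; exact: schur_flat_dom.
  - by move=> V _; rewrite /psi /phi schur_flatK // subrK.
  - by move=> X _; rewrite /psi /phi addrK schur_unflatK.
  - move=> V DV; apply: (analytic_comp (f := fun V => V - v0)); first exact: sub_an.
    exact: schur_flat_analytic.
  - move=> X DX; apply: (analyticD (f := schur_unflat Bb Tb)); last exact: analytic_cst.
    exact: schur_unflat_analytic.
pose F := kernel_subspace (corner_linear Bb Tb) (@corner_continuous _ _ S _ _ Bb Tb).
have hl : linear (fun X => X - corner Bb Tb X).
  by move=> a X Y; rewrite corner_linear scalerBr opprD addrACA.
have hc : continuous (fun X => X - corner Bb Tb X).
  by move=> X; apply: continuousB; [exact: cvg_id|exact: corner_continuous].
have opE (b : aff S A) : aff_op b = B + opS (aff_vec b - v0).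
  by apply/funext => u; rewrite -[RHS]/(B u + (opS (aff_vec b) u - opS v0 u))
    /B !aff_opE -/v0; zmod.
exists c, F; split; last first.
  split=> //; suff : schur_dom Bb Tb (v0 - v0) by [].
  by rewrite subrr; exact: schur_dom0.
split=> //.
  (* [corner] is a continuous projection, so its kernel is complemented by its image, the kernel of
     [1 - corner]. *)
  exists (kernel_subspace hl hc); split.
    apply/seteqP; split=> [X [/= h1]|_ ->] /=; first by rewrite h1 subr0.
    have c0 := raw_linear0 (corner_linear Bb Tb); rewrite /= in c0.
    by rewrite c0 subr0.
  move=> X; exists (X - corner Bb Tb X) => /=.
    rewrite -scaleN1r addrC corner_linear corner_idem //.
    by rewrite scaleN1r addNr.
  have -> : X - (X - corner Bb Tb X) = corner Bb Tb X by zmod.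
  by rewrite corner_idem // subrr.
apply/seteqP; split=> [_ [b [[_ Db] hb] <-]|X [/= FX [b [_ Db] bX]]].
  split; last by exists b.
  suff : corner Bb Tb (schur_flat Bb Tb (aff_vec b - v0)) = 0 by [].
  by apply/(corner_in_Ck BTB TBT hA hB Db); rewrite -opE; apply/CkP.
exists b => //; split=> //; apply/CkP; rewrite opE.
apply/(corner_in_Ck BTB TBT hA hB Db).
by move: FX; rewrite -bX.
Qed.

End CkManifold.

Lemma analytic_diffD (R : realType) (E F : normedModType R) (f g : E -> F) x h :
  analytic_at f x -> analytic_at g x ->
  'd (fun y => f y + g y) x h = 'd f x h + 'd g x h.
Proof.
move=> /analytic_differentiable df /analytic_differentiable dg.
by rewrite -[LHS]/('d (f + g) x h) diffD.
Qed.

(** * The group action *)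

Section LieGroup.
Context {R : realType} {H : hilbertType R} (S : sn_ideal H).
Implicit Types (G K : Gl S) (X Y Z : sn_type S).

Let GG : preTopologicalGroupType := (Gl S * Gl S)%type.
Let AG : @atlas R GG := prod_atlas (Gl_atlas S) (Gl_atlas S).
Let gc : @chart R GG := prod_chart (Gl_chart S) (Gl_chart S).

Lemma GlGl_atlasE c : AG c -> c = gc.
Proof. by move=> [c1 [c2 [-> -> ->]]]. Qed.

Lemma GlGl_chart : AG gc.
Proof. by exists (Gl_chart S), (Gl_chart S). Qed.

Lemma GlGl_is_atlas : is_atlas AG.
Proof. by apply: prod_is_atlas; exact: Gl_is_atlas. Qed.

(** The group law in the chart: (1 + X)(1 + Y) - 1. *)
Definition mulG X Y := X + (Y + mulS X Y).

Lemma mulG_chart G K : Gl_chart S (G * K)%g = mulG (Gl_chart S G) (Gl_chart S K).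
Proof.
apply: opS_ext => u; apply: (@addrI _ u); rewrite -Gl_opE.
have -> : Gl_op (G * K)%g u = Gl_op G (Gl_op K u) by rewrite Gl_opM.
rewrite [Gl_op G _]Gl_opE [Gl_op K u]Gl_opE /mulG !opSD mulSE (opD (opSb _)); zmod.
Qed.

Lemma mulG_analytic (E : normedModType R) (f g : E -> sn_type S) e :
  analytic_at f e -> analytic_at g e -> analytic_at (fun x => mulG (f x) (g x)) e.
Proof.
move=> fa ga; apply: (analyticD (f := f)) => //; apply: (analyticD (f := g)) => //.
exact: analytic_mulS.
Qed.

Lemma GlGl_lie_group : is_lie_group AG.
Proof.
split; first exact: GlGl_is_atlas.
- apply: analytic_map_in; [exact: prod_is_atlas GlGl_is_atlas GlGl_is_atlas|exact: GlGl_is_atlas|].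
  move=> p; exists (prod_chart gc gc), gc; split.
  + by exists gc, gc; split=> //; exact: GlGl_chart.
  + exact: GlGl_chart.
  pose m (z : (sn_type S * sn_type S) * (sn_type S * sn_type S)) :=
    (mulG z.1.1 z.2.1, mulG z.1.2 z.2.2).
  exists m.
    apply: (@filterE _ _ (@nbhs_filter (GG * GG)%type p)) => -[[G K] [G' K']]; split=> //.
    by rewrite /m -[LHS]/(Gl_chart S (G * G')%g, Gl_chart S (K * K')%g) !mulG_chart.
  have a1 (z : (sn_type S * sn_type S) * (sn_type S * sn_type S)) :
      analytic_at (fun z : (sn_type S * sn_type S) * (sn_type S * sn_type S) => z.1) z.
    exact: analytic_fst.
  have a2 (z : (sn_type S * sn_type S) * (sn_type S * sn_type S)) :
      analytic_at (fun z : (sn_type S * sn_type S) * (sn_type S * sn_type S) => z.2) z.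
    exact: analytic_snd.
  apply: analytic_pair; apply: mulG_analytic.
  + by apply: (analytic_comp (a1 _)); exact: analytic_fst.
  + by apply: (analytic_comp (a2 _)); exact: analytic_fst.
  + by apply: (analytic_comp (a1 _)); exact: analytic_snd.
  + by apply: (analytic_comp (a2 _)); exact: analytic_snd.
- apply: analytic_map_in; [exact: GlGl_is_atlas|exact: GlGl_is_atlas|].
  move=> [G K]; exists gc, gc; split; [exact: GlGl_chart|exact: GlGl_chart|].
  exists (fun z : sn_type S * sn_type S => (invS z.1, invS z.2)).
    apply: (@filterE _ _ (@nbhs_filter GG (G, K))) => -[G' K']; split=> //.
    by rewrite !invS_chart.
  apply: analytic_pair.
  + apply: (analytic_comp (f := fst)); first exact: analytic_fst.
    by apply: invS_analytic; exact: Sinv_chart.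
  + apply: (analytic_comp (f := snd)); first exact: analytic_snd.
    by apply: invS_analytic; exact: Sinv_chart.
Qed.

Lemma gc_inj (g h : GG) : gc g = gc h -> g = h.
Proof.
case: g h => [G K] [G' K'] E; congr (_, _); apply: Gl_chart_inj.
  exact: (congr1 (fun z : sn_type S * sn_type S => z.1) E).
exact: (congr1 (fun z : sn_type S * sn_type S => z.2) E).
Qed.

Lemma invS0 : invS (0 : sn_type S) = 0.
Proof. exact: (has_fps_at0 (fun=> 0) (invS_has_fps S)). Qed.

Section Action.
Context (A : H -> H) (hA : closed_range_op A) (k : int).
Implicit Types (p : Ck S A k) (g h : GG).

Let C := submanifold_atlas (aff_atlas S A) (Ck S A k).
Let incl : Ck S A k -> aff S A := set_val.
Definition Ck_vec p : sn_type S := aff_vec (set_val p).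

Lemma Ck_is_atlas : is_atlas C.
Proof. by apply: submanifold_is_atlas; [exact: aff_is_atlas|exact: Ck_submanifold]. Qed.

Lemma Ck_act_exists g p : exists p', Ck_op p' = Gl_op g.1 \o Ck_op p \o Gl_op (g.2^-1)%g.
Proof. by apply: Ck_of_subproof; apply: orbit_in_Ck => //; exact: Ck_in. Qed.

Definition Ck_act g p := sval (cid (Ck_act_exists g p)).

Lemma Ck_actE g p : Ck_op (Ck_act g p) = Gl_op g.1 \o Ck_op p \o Gl_op (g.2^-1)%g.
Proof. by rewrite /Ck_act; case: cid. Qed.

Lemma Ck_act1 p : Ck_act 1%g p = p.
Proof. by apply: Ck_op_inj; rewrite Ck_actE /= invg1. Qed.

Lemma Ck_actM g h p : Ck_act (g * h)%g p = Ck_act g (Ck_act h p).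
Proof. by apply: Ck_op_inj; rewrite !Ck_actE /= invgM !Gl_opM. Qed.

Lemma Ck_act_transitive p q : exists g, Ck_act g p = q.
Proof.
have [G [K E]] := in_Ck_transitive hA (Ck_in p) (Ck_in q).
by exists ((G, K^-1)%g : GG); apply: Ck_op_inj; rewrite Ck_actE /= invgK -E.
Qed.

Let Ab : bounded_op A := hA.1.

(** The expansion of (1 + X)(A + V)(1 + Y) - A, where [Y] is the coordinate of the inverse of the
    second group element. *)
Definition actS X Y V := V + (rmulS Ab X + mulS X V) +
  (lmulS Ab Y + mulS V Y + (mulS (rmulS Ab X) Y + mulS X (mulS V Y))).

Lemma vecE g p : Ck_vec (Ck_act g p) =
  actS (Gl_chart S g.1) (invS (Gl_chart S g.2)) (Ck_vec p).
Proof.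
apply: opS_ext => u; rewrite invS_chart; apply: (@addrI _ (A u)).
have -> : A u + opS (Ck_vec (Ck_act g p)) u = Gl_op g.1 (Ck_op p (Gl_op (g.2^-1)%g u)).
  by rewrite -Ck_opE Ck_actE.
rewrite [Gl_op (g.2)^-1%g u]Gl_opE Gl_opE Ck_opE -/(Ck_vec p).
rewrite /actS !opSD !(mulSE, lmulSE, rmulSE).
set X := Gl_chart S g.1; set Y := Gl_chart S _; set V := Ck_vec p.
rewrite (opD Ab) (opD (opSb V)) !(opD (opSb X)); zmod.
Qed.

Lemma actS_analytic (E : normedModType R) (f1 f2 f3 : E -> sn_type S) e :
  analytic_at f1 e -> analytic_at f2 e -> analytic_at f3 e ->
  analytic_at (fun x => actS (f1 x) (f2 x) (f3 x)) e.
Proof.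
move=> a1 a2 a3.
apply: (analyticD (f := fun x => f3 x + (rmulS Ab (f1 x) + mulS (f1 x) (f3 x)))).
  apply: (analyticD (f := f3)) => //.
  apply: (analyticD (f := fun x => rmulS Ab (f1 x))); first exact: analytic_rmulS.
  exact: analytic_mulS.
apply: (analyticD (f := fun x => lmulS Ab (f2 x) + mulS (f3 x) (f2 x))).
  apply: (analyticD (f := fun x => lmulS Ab (f2 x))); first exact: analytic_lmulS.
  exact: analytic_mulS.
apply: (analyticD (f := fun x => mulS (rmulS Ab (f1 x)) (f2 x))).
  by apply: analytic_mulS => //; exact: analytic_rmulS.
by apply: analytic_mulS => //; exact: analytic_mulS.
Qed.

Lemma incl_rep d p : C d -> dom d p ->
  exists2 j : model d -> sn_type S, local_rep d (aff_chart S A) incl p j & analytic_at j (d p).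
Proof.
move=> dC dp; have := submanifold_inclusion_analytic (aff_is_atlas S A) dC.
by move=> /(_ p (aff_chart S A) erefl dp I)[j jr ja]; exists j.
Qed.

(** Since the orbit is a submanifold, it suffices to see that the action is analytic into A + S,
    where [actS] represents it. *)
Lemma Ck_act_analytic : analytic_map (prod_atlas AG C) C (fun gp => Ck_act gp.1 gp.2).
Proof.
have aGC := prod_is_atlas GlGl_is_atlas Ck_is_atlas.
apply: (analytic_map_submanifold (aff_is_atlas S A) aGC).
apply: (analytic_map_in aGC (aff_is_atlas S A)) => -[g p].
have [_ Ccov _] := Ck_is_atlas; have [d dC dp] := Ccov p.
have [j jr ja] := incl_rep dC dp.
exists (prod_chart gc d), (aff_chart S A); split=> //.
  by exists gc, d; split=> //; exact: GlGl_chart.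
pose r (z : (sn_type S * sn_type S) * model d) := actS z.1.1 (invS z.1.2) (j z.2).
exists r.
  exists (setT, [set x | [/\ dom d x, dom (aff_chart S A) (incl x) &
      aff_chart S A (incl x) = j (d x)]]) => /=.
    by split; [exact: filterT|exact: jr].
  move=> [[G K] x] [/= _ [dx _ E]]; split=> //=.
  by rewrite -[LHS]/(Ck_vec (Ck_act (G, K) x)) vecE /r /= -E.
have a1 (z : (sn_type S * sn_type S) * model d) :
    analytic_at (fun z : (sn_type S * sn_type S) * model d => z.1) z.
  exact: analytic_fst.
apply: actS_analytic.
- by apply: (analytic_comp (a1 _)); exact: analytic_fst.
- apply: (analytic_comp (f := fun z : (sn_type S * sn_type S) * model d => z.1.2)).
    by apply: (analytic_comp (a1 _)); exact: analytic_snd.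
  by apply: invS_analytic; exact: Sinv_chart.
- by apply: (analytic_comp (f := snd)); [exact: analytic_snd|exact: ja].
Qed.

(** The coordinate of G B K^-1 for fixed [B], expanded around [B] rather than [A] so that the
    differential at 0 can be read off. *)
Definition orbS p (z : sn_type S * sn_type S) : sn_type S :=
  Ck_vec p + (rmulS (Ck_bounded p) z.1 +
    (lmulS (Ck_bounded p) (invS z.2) + mulS (rmulS (Ck_bounded p) z.1) (invS z.2))).

Lemma orbSE g p : Ck_vec (Ck_act g p) = orbS p (gc g).
Proof.
apply: opS_ext => u; apply: (@addrI _ (A u)).
have -> : A u + opS (Ck_vec (Ck_act g p)) u = Gl_op g.1 (Ck_op p (Gl_op (g.2^-1)%g u)).
  by rewrite -Ck_opE Ck_actE.
rewrite [Gl_op (g.2)^-1%g u]Gl_opE Gl_opE (opD (Ck_bounded p)).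
rewrite /orbS !opSD !(mulSE, lmulSE, rmulSE) invS_chart.
rewrite (opD (opSb (Gl_chart S g.1))) {1}Ck_opE -/(Ck_vec p).
rewrite -[(gc g).1]/(Gl_chart S g.1).
set a := Ck_op p u; set b := Ck_op p (opS _ u).
set d := opS _ a; set e := opS _ b; zmod.
Qed.

Lemma orbS_analytic p z : Sinv z.2 -> analytic_at (orbS p) z.
Proof.
move=> hz.
have ar : analytic_at (fun z : sn_type S * sn_type S => rmulS (Ck_bounded p) z.1) z.
  by apply: analytic_rmulS; exact: analytic_fst.
have ai : analytic_at (fun z : sn_type S * sn_type S => invS z.2) z.
  by apply: (analytic_comp (f := snd)); [exact: analytic_snd|exact: invS_analytic].
apply: (analyticD (f := fun=> Ck_vec p)); first exact: analytic_cst.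
apply: (analyticD (f := fun z : sn_type S * sn_type S => rmulS (Ck_bounded p) z.1)) => //.
apply: (analyticD (f := fun z : sn_type S * sn_type S => lmulS (Ck_bounded p) (invS z.2))).
  exact: analytic_lmulS.
exact: analytic_mulS.
Qed.

Lemma orbS_diff p (h : sn_type S * sn_type S) :
  'd (orbS p) 0 h = rmulS (Ck_bounded p) h.1 - lmulS (Ck_bounded p) h.2.
Proof.
pose f1 (z : sn_type S * sn_type S) := rmulS (Ck_bounded p) z.1.
pose f2 (z : sn_type S * sn_type S) := lmulS (Ck_bounded p) (invS z.2).
pose f3 (z : sn_type S * sn_type S) := mulS (rmulS (Ck_bounded p) z.1) (invS z.2).
have l1 : linear f1 by move=> a x y; rewrite /f1 /= rmulS_linear.
have c1 : continuous f1.
  move=> z; apply: (@continuous_comp _ _ _ fst (rmulS (Ck_bounded p))).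
    exact: cvg_fst.
  exact: rmulS_continuous.
have s0 : Sinv (0 : sn_type S) by apply: Sinv_small; rewrite normr0.
have a1 : analytic_at f1 0 by exact: analytic_linear.
have ai : analytic_at (fun z : sn_type S * sn_type S => invS z.2) 0.
  by apply: (analytic_comp (f := snd)); [exact: analytic_snd|exact: invS_analytic].
have di v : 'd (fun z : sn_type S * sn_type S => invS z.2) 0 v = - v.2.
  have := @diff_comp _ _ _ _ (snd : sn_type S * sn_type S -> sn_type S) (@invS _ _ S) 0.
  have ds : differentiable (snd : sn_type S * sn_type S -> sn_type S) 0.
    by apply: analytic_differentiable; exact: analytic_snd.
  have di : differentiable (@invS _ _ S) ((snd : sn_type S * sn_type S -> sn_type S) 0).
    by apply: analytic_differentiable; exact: invS_analytic.
  move=> /(_ ds di) E.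
  rewrite -[LHS]/('d (@invS _ _ S \o snd) 0 v) E /= invS_diff0 diff_linear //.
  by move=> z; exact: cvg_snd.
have a2 : analytic_at f2 0 by exact: analytic_lmulS.
have a3 : analytic_at f3 0 by exact: analytic_mulS.
have d2 v : 'd f2 0 v = - lmulS (Ck_bounded p) v.2.
  have E := @diff_comp _ _ _ _ (fun z : sn_type S * sn_type S => invS z.2)
    (lmulS (S := S) (Ck_bounded p)) 0 (analytic_differentiable ai)
    (analytic_differentiable (analytic_linear _ (lmulS_linear _) (@lmulS_continuous _ _ _ _ _))).
  rewrite -[LHS]/('d (lmulS (Ck_bounded p) \o (fun z : sn_type S * sn_type S => invS z.2)) 0 v) E.
  rewrite -[LHS]/('d (lmulS (Ck_bounded p)) _ ('d (fun z : sn_type S * sn_type S => invS z.2) 0 v)) di.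
  rewrite diff_linear; [|exact: lmulS_linear|exact: lmulS_continuous].
  by apply: opS_ext => u; rewrite lmulSE !opSN lmulSE (opN (Ck_bounded p)).
(* A product of two factors that both vanish at 0. *)
have d3 v : 'd f3 0 v = 0.
  pose g (z : sn_type S * sn_type S) := (f1 z, invS z.2).
  have ga : analytic_at g 0 by exact: analytic_pair.
  pose m (q : sn_type S * sn_type S) := mulS q.1 q.2.
  have ma q : analytic_at m q.
    exact: (analytic_bilinear q (@mulS_linear_r _ _ S) (@mulS_linear_l _ _ S) ler01 (@mulS_bound _ _ S)).
  have E := @diff_comp _ _ _ _ g m 0 (analytic_differentiable ga)
    (analytic_differentiable (ma _)).
  rewrite -[LHS]/('d (m \o g) 0 v) E -[LHS]/('d m (g 0) ('d g 0 v)).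
  rewrite (bilinear_diff _ _ (@mulS_linear_r _ _ S) (@mulS_linear_l _ _ S) ler01 (@mulS_bound _ _ S)).
  rewrite /g /= invS0 (raw_linear0 l1) /=; set w := 'd _ _ _.
  apply: opS_ext => u; rewrite opSD !mulSE !opS0 (op0 (opSb _)) addr0 //.
have a0 : analytic_at (fun=> Ck_vec p : sn_type S) (0 : sn_type S * sn_type S).
  exact: analytic_cst.
have a23 : analytic_at (fun z => f2 z + f3 z) 0 by exact: analyticD.
have a123 : analytic_at (fun z => f1 z + (f2 z + f3 z)) 0 by exact: analyticD.
rewrite -[LHS]/('d (fun z => Ck_vec p + (f1 z + (f2 z + f3 z))) 0 h).
have e1 := analytic_diffD h a0 a123.
have e2 := analytic_diffD h a1 a23.
have e3 := analytic_diffD h a2 a3.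
have d0 : 'd (fun=> Ck_vec p : sn_type S) (0 : sn_type S * sn_type S) h = 0 by rewrite diff_cst.
have d1 := diff_linear 0 h l1 c1.
have e : 'd (fun z => Ck_vec p + (f1 z + (f2 z + f3 z))) 0 h = 0 + (f1 h + (- lmulS (Ck_bounded p) h.2 + 0)).
  apply: (etrans e1); congr (_ + _); first exact: d0.
  apply: (etrans e2); congr (_ + _); first exact: d1.
  by apply: (etrans e3); congr (_ + _); [exact: d2|exact: d3].
apply: (etrans e); rewrite add0r addr0 //.
Qed.

End Action.
End LieGroup.
Arguments Ck_act {R H S A} hA {k} g p.

Lemma diff_lc (R : realType) (E F : normedModType R) (f : E -> F) x : analytic_at f x ->
  linear ('d f x : E -> F) /\ continuous ('d f x : E -> F).
Proof.
move=> /analytic_differentiable df; split; first exact: linearP.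
exact: diff_continuous.
Qed.

Lemma analytic_diff_comp (R : realType) (E F G : normedModType R) (f : E -> F) (g : F -> G) x h :
  analytic_at f x -> analytic_at g (f x) ->
  'd (fun y => g (f y)) x h = 'd g (f x) ('d f x h).
Proof.
move=> /analytic_differentiable df /analytic_differentiable dg.
by rewrite -[LHS]/('d (g \o f) x h) diff_comp.
Qed.

(** * Orbit maps: sections, submersion, tangent spaces *)

Section Orbit.
Context {R : realType} {H : hilbertType R} (S : sn_ideal H).
Context (A : H -> H) (hA : closed_range_op A) (k : int).
Implicit Types (X Y Z V : sn_type S) (p : Ck S A k) (g : Gl S * Gl S).

Let AG := prod_atlas (Gl_atlas S) (Gl_atlas S).
Let gc := prod_chart (Gl_chart S) (Gl_chart S).
Let C := submanifold_atlas (aff_atlas S A) (Ck S A k).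
Let incl : Ck S A k -> aff S A := set_val.

Lemma orbit_rep p g : local_rep gc (aff_chart S A) (incl \o (Ck_act hA ^~ p)) g (orbS p).
Proof.
apply: (@filterE _ _ (@nbhs_filter (Gl S * Gl S)%type g)) => g'; split=> //.
exact: orbSE.
Qed.

Lemma orbit_analytic p : analytic_map AG C (Ck_act hA ^~ p).
Proof.
apply: (analytic_map_submanifold (aff_is_atlas S A) (GlGl_is_atlas S)).
apply: (analytic_map_in (GlGl_is_atlas S) (aff_is_atlas S A)) => g.
exists gc, (aff_chart S A); split=> //; first exact: GlGl_chart.
exists (orbS p); first exact: orbit_rep.
by apply: orbS_analytic; exact: Sinv_chart.
Qed.

(** [s] is analytic at the coordinate of [p] in the ambient space S, but it inverts the orbit map
    only at coordinates of orbit points, where the corner vanishes. *)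
Lemma orbit_section p : exists s : sn_type S -> sn_type S * sn_type S,
  [/\ analytic_at s (Ck_vec p), s (Ck_vec p) = (0, 0) &
      \forall V \near Ck_vec p, forall b, Ck_vec b = V ->
        exists2 g, gc g = s V & Ck_act hA g p = b].
Proof.
have hB := Ck_in p; have [_ cB _] := hB; have [Bb _] := cB.
have [T [Tb BTB TBT]] := reflexive_inverse cB.
pose D := schur_dom (S := S) Bb Tb.
exists (fun V => (schur_G Bb Tb (V - Ck_vec p), invS (schur_K Tb (V - Ck_vec p)))).
have sub_an V : analytic_at (fun V : sn_type S => V - Ck_vec p) V.
  apply: (analyticD (f := id)); first exact: analytic_id.
  exact: analytic_cst.
have D0 : D (Ck_vec p - Ck_vec p) by rewrite subrr; exact: schur_dom0.
have K0 : schur_K Tb (0 : sn_type S) = 0.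
  exact: raw_linear0 (lmulS_linear Tb).
have G0 : schur_G Bb Tb (0 : sn_type S) = 0.
  apply: opS_ext => u; rewrite schur_GE opS0.
  by rewrite -[LHS]/(0 - Ck_op p (T 0)) (op0 Tb) (op0 Bb) subr0.
split.
- apply: analytic_pair.
    apply: (analytic_comp (f := fun V => V - Ck_vec p)); first exact: sub_an.
    exact: schur_G_analytic.
  apply: (analytic_comp (f := fun V => schur_K Tb (V - Ck_vec p))).
    apply: (analytic_comp (f := fun V => V - Ck_vec p)); first exact: sub_an.
    exact: schur_K_analytic.
  by apply: invS_analytic; apply: (schur_K_inv (Bb := Bb)).
- by rewrite subrr G0 K0 invS0.
have Dn : nbhs (Ck_vec p - Ck_vec p) [set X | D X].
  by apply: open_nbhs_nbhs; split=> //; exact: schur_dom_open.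
have Dv : nbhs (Ck_vec p) ((fun V => V - Ck_vec p) @^-1` [set X | D X]).
  exact: (analytic_continuous (sub_an (Ck_vec p))) Dn.
apply: filterS Dv => V DV b bV; set X := V - Ck_vec p.
have hX : D X := DV.
exists ((toGl (schur_G Bb Tb X), (toGl (schur_K Tb X))^-1)%g : Gl S * Gl S).
  rewrite -[LHS]/(Gl_chart S (toGl (schur_G Bb Tb X)), invS (schur_K Tb X)).
  by rewrite toGlK //; exact: schur_G_inv.
have bX : Ck_op b = Ck_op p + opS X.
  apply/funext => u; rewrite -[RHS]/(Ck_op p u + (opS V u - opS (Ck_vec p) u)) -bV.
  by rewrite !Ck_opE -/(Ck_vec p) -/(Ck_vec b); zmod.
have Q0 : corner Bb Tb (schur_flat Bb Tb X) = 0.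
  by apply/(corner_in_Ck BTB TBT hA hB hX); rewrite -bX; exact: Ck_in.
apply: Ck_op_inj; rewrite Ck_actE bX; apply/funext => u.
rewrite -[RHS]/(Ck_op p u + opS X u) (schur_factor BTB TBT u hX) Q0 opS0 addr0.
by rewrite -[LHS]/(Gl_op _ (Ck_op p (Gl_op _ u))) invgK.
Qed.

Lemma vec_cont p : {for p, continuous (@Ck_vec _ _ S A k)}.
Proof.
move=> B hB; have [Ac _ _] := aff_is_atlas S A.
have h : nbhs (set_val p) (@aff_vec _ _ S A @^-1` B).
  exact: (chart_cont (c := aff_chart S A) (p := set_val p) (Ac _ erefl) I) hB.
exact: (set_val_nbhs h).
Qed.

Lemma Gl_chart1 : Gl_chart S 1%g = 0.
Proof.
apply: opS_ext => u; apply: (@addrI _ u); rewrite -Gl_opE opS0 addr0 //.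
Qed.

Lemma mulG_0l X : mulG 0 X = X.
Proof.
by apply: opS_ext => u; rewrite /mulG !opSD mulSE !opS0 addr0 add0r.
Qed.

Lemma orbit_rep_analytic p g d f : C d -> dom d (Ck_act hA g p) ->
  local_rep gc d (Ck_act hA ^~ p) g f -> analytic_at f (gc g).
Proof.
move=> dC dp fr.
have [f' fr' fa'] : analytic_in gc d (Ck_act hA ^~ p) g.
  exact: (@orbit_analytic p g gc d (GlGl_chart S) dC (conj I I) dp).
have [Gc _ _] := GlGl_is_atlas S.
exact: analytic_near (local_rep_uniq (Gc _ (GlGl_chart S)) fr' fr) fa'.
Qed.

(** The section at [q] yields group elements that move [q]; multiplied on the right by [g] they move
    [p]. So the section at one group element becomes one at any other. *)
Lemma orbit_rep_section p g d f : C d -> dom d (Ck_act hA g p) ->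
  local_rep gc d (Ck_act hA ^~ p) g f ->
  exists2 s : model d -> sn_type S * sn_type S, analytic_at s (d (Ck_act hA g p)) &
    s (d (Ck_act hA g p)) = gc g /\ \forall z \near d (Ck_act hA g p), f (s z) = z.
Proof.
set q := Ck_act hA g p => dC dq fr.
have [Gc _ _] := GlGl_is_atlas S; have [Cc _ _] := Ck_is_atlas S hA k.
have [s [sa s0 sn]] := orbit_section q.
have [j jr ja] := incl_rep dC dq.
have [_ _ jq] := local_rep_dom jr; rewrite -[LHS]/(Ck_vec q) in jq.
pose r z := (mulG (s (j z)).1 (Gl_chart S g.1), mulG (s (j z)).2 (Gl_chart S g.2)).
have sja : analytic_at (fun z => s (j z)) (d q).
  by apply: (analytic_comp (f := j)) => //; rewrite -jq.
have ra : analytic_at r (d q).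
  apply: analytic_pair; apply: mulG_analytic; try exact: analytic_cst.
    by apply: (analytic_comp sja); exact: analytic_fst.
  by apply: (analytic_comp sja); exact: analytic_snd.
have rq : r (d q) = gc g by rewrite /r -jq s0 !mulG_0l.
exists r => //; split=> //.
have W1 := chart_open (Gc _ (GlGl_chart S)) (conj I I : dom gc g) fr.
have W2 : nbhs (d q) [set z | (gc @` ([set x | [/\ dom gc x, dom d (Ck_act hA x p) &
    d (Ck_act hA x p) = f (gc x)]] `&` dom gc)) (r z)].
  by apply: (analytic_continuous ra); rewrite rq.
have V1 : nbhs q [set q' | forall b, Ck_vec b = Ck_vec q' ->
        exists2 g, gc g = s (Ck_vec q') & Ck_act hA g q = b].
  exact: (vec_cont sn).
have V2 := chart_open (Cc _ dC) dq (nbhsI jr V1).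
apply: filterS (nbhsI W2 V2) => z [[g' [[_ _ fg'] _] rz] [b [[[db _ jb] sb] _] bz]].
rewrite -rz -fg' -bz; have [g1 g1s g1b] := sb b erefl.
congr (d _); rewrite -g1b /q -Ck_actM; congr (Ck_act _ _ _).
apply: gc_inj; rewrite [LHS]rz -bz.
rewrite -[LHS]/(mulG (s (j (d b))).1 (Gl_chart S g.1), mulG (s (j (d b))).2 (Gl_chart S g.2)).
rewrite -jb -[aff_chart S A _]/(Ck_vec b) -g1s.
by rewrite -[RHS]/(Gl_chart S (g1.1 * g.1)%g, Gl_chart S (g1.2 * g.2)%g) !mulG_chart.
Qed.

(** Differentiating [f (s z) = z] makes the differential of the section a continuous right inverse
    of that of [f], which gives surjectivity and a complemented kernel. *)
Lemma orbit_submersion p : submersion AG C (Ck_act hA ^~ p).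
Proof.
split; first exact: orbit_analytic.
move=> g c d + /GlGl_atlasE E; rewrite E => f dC _ dp fr.
have [s sa [sp fs]] := orbit_rep_section dC dp fr.
have fa := orbit_rep_analytic dC dp fr.
have [fl fc] := diff_lc fa; have [sl sc] := diff_lc sa.
apply: (split_surjection fl fc sl sc) => y.
have fa' : analytic_at f (s (d (Ck_act hA g p))) by rewrite sp.
rewrite -sp -(analytic_diff_comp y sa fa').
rewrite (analytic_near_diff _ fs (analytic_comp sa fa')).
by rewrite diff_linear // => z; exact: cvg_id.
Qed.

(** Near the point the inclusion factors through [orbS p] by the section, so its differential has
    values in the range of that of [orbS p] at 0. Conversely [orbS p] is locally the inclusion after
    the orbit map, so every value of its differential at 0 is tangent. *)
Lemma Ck_tangent p : tangent_space C incl (aff_chart S A) p =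
  [set V | exists X Y, V = rmulS (Ck_bounded p) X - lmulS (Ck_bounded p) Y].
Proof.
have [Gc _ _] := GlGl_is_atlas S; have [Cc Ccov _] := Ck_is_atlas S hA k.
have Sinv0 : Sinv (0 : sn_type S) by apply: Sinv_small; rewrite normr0.
have gc1 : gc 1%g = 0.
  by rewrite -[LHS]/(Gl_chart S 1%g, Gl_chart S 1%g) !Gl_chart1.
apply/seteqP; split=> [V [c [f [w [cC cp fr fa ->]]]]|V [X [Y ->]]].
  have [s [sa s0 sn]] := orbit_section p.
  have [_ _ fp] := local_rep_dom fr; rewrite -[LHS]/(Ck_vec p) in fp.
  have sfa : analytic_at (fun z => s (f z)) (c p).
    by apply: (analytic_comp fa); rewrite -fp.
  have V1 : nbhs p [set q | forall b, Ck_vec b = Ck_vec q ->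
        exists2 g, gc g = s (Ck_vec q) & Ck_act hA g p = b].
    exact: (vec_cont sn).
  have E : \forall z \near c p, f z = orbS p (s (f z)).
    apply: filterS (chart_open (Cc _ cC) cp (nbhsI fr V1)) => z [q [[[_ _ fq] sq] _] qz].
    have [g gs gq] := sq q erefl.
    by rewrite -qz -fq -[aff_chart S A _]/(Ck_vec q) -gs -orbSE gq.
  have sp0 : s (f (c p)) = 0 by rewrite -fp s0.
  have oa : analytic_at (orbS p) (s (f (c p))) by rewrite sp0; exact: orbS_analytic.
  rewrite (analytic_near_diff w E fa) (analytic_diff_comp w sfa oa) sp0 orbS_diff.
  by eexists; eexists.
have [c cC cp] := Ccov p; have [j jr ja] := incl_rep cC cp.
have cp1 : dom c (Ck_act hA 1%g p) by rewrite Ck_act1.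
have [f fr fa] : analytic_in gc c (Ck_act hA ^~ p) 1%g.
  exact: (@orbit_analytic p 1%g gc c (GlGl_chart S) cC (conj I I) cp1).
have [_ _ fp] := local_rep_dom fr; rewrite Ck_act1 gc1 in fp.
rewrite gc1 in fa.
exists c, j, ('d f 0 (X, Y)); split=> //.
have ja' : analytic_at j (f 0) by rewrite -fp.
rewrite fp -(analytic_diff_comp _ fa ja').
rewrite -[LHS]/(rmulS (Ck_bounded p) (X, Y).1 - lmulS (Ck_bounded p) (X, Y).2).
rewrite -orbS_diff; apply: analytic_near_diff; last exact: orbS_analytic.
rewrite -gc1; apply: (local_rep_uniq (Gc _ (GlGl_chart S)) (orbit_rep p 1%g)).
apply: (local_rep_comp _ fr).
  by apply: (local_rep_cont _ _ fr); [exact: Gc (GlGl_chart S)|exact: Cc|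
    rewrite gc1; exact: analytic_continuous].
by rewrite Ck_act1.
Qed.

End Orbit.

Theorem theorem3p14 (R : realType) (H : hilbertType R)
  (Hseparable : exists2 D : set H, countable D & dense D)
  (Hinfinite : hdim [set: H] = +oo%E)
  (S : sn_ideal H) (A : H -> H) (hA : closed_range_op A)
  (k : int) (hk : index_range A k) :
  exists (C : atlas (Ck S A k))
         (act : (Gl S * Gl S)%type -> Ck S A k -> Ck S A k),
  [/\ forall (g : (Gl S * Gl S)%type) B,
        Ck_op (act g B) = Gl_op g.1 \o Ck_op B \o Gl_op (g.2^-1)%g,
      homogeneous_space (prod_atlas (Gl_atlas S) (Gl_atlas S)) C act,
      submanifold (aff_atlas S A) (Ck S A k),
      same_structure C (submanifold_atlas (aff_atlas S A) (Ck S A k)) &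
      forall B : Ck S A k,
        tangent_space C set_val (aff_chart S A) B =
        [set V : sn_type S | exists X Y : sn_type S,
           bs_val V = (bs_val X \o Ck_op B) - (Ck_op B \o bs_val Y) :> (H -> H)]].
Proof.
(* With the submanifold atlas as structure, agreement of the structures is the compatibility of that
   atlas with itself. *)
exists (submanifold_atlas (aff_atlas S A) (Ck S A k)), (Ck_act hA).
(* The index range provides a point, so that the orbit is nonempty and has a base point for the
   submersion. *)
have [B hB] := in_Ck_exists S hA hk; have [p _] := Ck_of_subproof hB.
split.
- exact: Ck_actE.
- split.
  + by split; [exact: GlGl_lie_group|exact: Ck_is_atlas].
  + by split; [exact: Ck_act1|exact: Ck_actM].
  + by split; [exists p|exact: Ck_act_transitive].
  + exact: Ck_act_analytic.
  + by exists p; exact: orbit_submersion.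
- exact: Ck_submanifold.
- by have [_ _ h] := Ck_is_atlas S hA k; exact: h.
- move=> b; rewrite (Ck_tangent hA b); apply/seteqP; split=> V [X [Y h]]; exists X, Y.
    by rewrite h; apply/funext.
  by apply: opS_ext => u; rewrite /opS h.
Qed.
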